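(* The group $G = PSU(5,3)$ has a complex irreducible character of real Schur index $2$. Moreover, $G$ has a string $C$-group representation $(G,\{s_0,s_1,s_2\})$ of rank $3$ and Schläfli type $\{5,5\}$ with respect to which every nontrivial complex irreducible character of $G$ is polytopal; that is, with $H = \langle s_1, s_2\rangle$, every complex irreducible character $\chi \ne 1_G$ of $G$ is a constituent of the permutation character $(1_H)^G$.
   Context: $PSU(5,3)$ denotes the projective special unitary group of degree $5$ defined over the field $\mathbb{F}_{9}$, i.e. $SU(5,3)$ modulo its center, where $SU(5,3) \le SL(5,9)$ is the group of determinant-one isometries of a nondegenerate Hermitian form on $\mathbb{F}_9^5$. It is also written $U_5(3)$ or ${}^2A_4(3)$, and has order $258190571520$. A string $C$-group representation of rank $m+1$ of a finite group $G$ is a pair $(G,S)$ where $S = \{s_0, s_1, \dots, s_m\}$ is a set of $m+1$ involutions generating $G$ such that $(s_i s_j)^2 = 1$ whenever $|i-j| \ge 2$, and such that the intersection condition holds: $\langle I \rangle \cap \langle J \rangle = \langle I \cap J \rangle$ for all subsets $I, J \subseteq S$. Its Schläfli type is $\{m_1,\dots,m_m\}$, where $m_i$ is the order of $s_{i-1}s_i$. Given a string $C$-group representation $(G,\{s_0,\dots,s_m\})$, let $H = \langle s_1, \dots, s_m\rangle$ (the stabilizer of a vertex in the associated abstract regular polytope). The polytopal irreducible characters of $G$ with respect to this representation are the irreducible constituents, other than the trivial character $1_G$, of the permutation character $(1_H)^G$ induced from the trivial character of $H$. A complex irreducible character $\chi$ of a finite group $G$ has real Schur index $2$ if $\chi$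 is real-valued but is not afforded by any representation of $G$ over the field $\mathbb{R}$; equivalently, its Frobenius–Schur indicator $\nu_2(\chi) = \frac{1}{|G|}\sum_{g\in G}\chi(g^2)$ equals $-1$. *)

(* Defs.v *)
From HB Require Import structures.
From mathcomp Require Import all_boot all_order all_algebra all_fingroup.
From mathcomp Require Import all_solvable all_field all_character.
From mathcomp Require Import sesquilinear reals.

Set Implicit Arguments.
Unset Strict Implicit.
Unset Printing Implicit Defensive.

Import Order.TTheory GroupScope GRing.Theory Num.Theory.
Local Open Scope ring_scope.

Section SpecialUnitary.

Variables (F : finFieldType) (n : nat) (theta : {rmorphism F -> F}).
Variable f : {hermitian 'rV[F]_n.+1 for false & theta}.

(* Matrices act on row vectors from the right. *)
Definition SU_set : {set {'GL_n.+1[F]}} :=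
  [set A : {'GL_n.+1[F]} | (\det (GLval A) == 1)
    && [forall u, forall v, f (u *m GLval A) (v *m GLval A) == f u v]].

Fact SU_group_set : group_set SU_set.
Proof.
apply/group_setP; split.
  rewrite inE GL_1E det1 eqxx; apply/forallP=> u; apply/forallP=> v.
  by rewrite !mulmx1.
move=> A B; rewrite !inE => /andP[/eqP dA /forallP fA] /andP[/eqP dB /forallP fB].
rewrite GL_MxE det_mulmx dA dB mulr1 eqxx; apply/forallP=> u; apply/forallP=> v.
rewrite !mulmxA (eqP (forallP (fB _) _)).
exact: (forallP (fA u) v).
Qed.

Definition SU : {group {'GL_n.+1[F]}} := Group SU_group_set.

Definition PSU : {group coset_of 'Z(SU)} := (SU / 'Z(SU))%G.

End SpecialUnitary.

Section StringCGroup.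

Variables (gT : finGroupType) (m : nat).
Implicit Types (G : {group gT}) (s : 'I_m.+1 -> gT).

Definition generators s : {set gT} := [set s i | i : 'I_m.+1].

Record string_C_group G s : Prop := StringCGroup {
  string_C_inj : injective s;
  string_C_involution : forall i, #[s i]%g = 2%N;
  string_C_gen : <<generators s>>%g = G;
  string_C_string : forall i j : 'I_m.+1,
    (i + 2 <= j)%N || (j + 2 <= i)%N -> ((s i * s j) ^+ 2 = 1)%g;
  string_C_intersection : forall I J : {set gT},
    I \subset generators s -> J \subset generators s ->
    (<<I>> :&: <<J>> = <<I :&: J>>)%g
}.

(* Entry i, counted from 0, is the order of s_i s_(i+1). *)
Definition schlafli_type s : seq nat :=
  [seq #[s (widen_ord (leqnSn m) i) * s (lift ord0 i)]%g | i <- enum 'I_m].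

Definition vertex_stabilizer s : {group gT} :=
  <<[set s i | i : 'I_m.+1 & i != ord0]>>%G.

(* 'chi_0 is the trivial character of G. *)
Definition polytopal G s (i : Iirr G) : Prop :=
  i != 0 /\ i \in irr_constt ('Ind[G, vertex_stabilizer s] 1).

End StringCGroup.

Section RealSchurIndex.

Variable R : realType.

(* Characters take their values in algC and real matrices have their traces   *)
(* in R. A real algebraic number a and an element r of R are the same real    *)
(* number when they cut the rationals at the same place; this relation fails  *)
(* for every r when a is not real.                                            *)
Definition same_real (r : R) (a : algC) : Prop :=
  forall q : rat, (ratr q <= r) = (ratr q <= a).

Definition afforded_over_reals (gT : finGroupType) (G : {group gT})
    (chi : 'CF(G)) : Prop :=
  exists n (rG : mx_representation R G n),
    forall x, x \in G -> same_real (\tr (rG x)) (chi x).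

Definition real_schur_index_2 (gT : finGroupType) (G : {group gT})
    (chi : 'CF(G)) : Prop :=
  cfReal chi /\ ~ afforded_over_reals chi.

End RealSchurIndex.

(* Main.v *)
(* The centre of SU(5, 3) is trivial, so PSU(5, 3) may be handled through the
   unitary matrices of determinant one over F_9 = F_3[i].

   Polytope. The generators are an explicit matrix s0 and two permutation
   matrices s1, s2 which generate H, dihedral of order 10. A word in them is a
   unitary transvection, and a subgroup which is normalised by s0, s1, s2 and
   contains it contains SU(2, 3) on every pair of coordinates, hence is G. A
   nontrivial irreducible representation without H-fixed vector satisfies
   sum_(h in H) rho(h) = 0. Let Z be the elementary abelian group of order 81
   at the centre of the unipotent radical of the stabiliser of an H-invariant
   isotropic plane. Every nontrivial weight of Z is conjugate either to one on
   which H acts regularly or to one of rank one fixed by s1; in both cases the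
   vanishing sum kills the weight space. Thus Z, which contains the
   transvection, acts trivially, and so does G: a contradiction.

   Schur index. Let B = <u, g> be the group of order 24 with u^3 = g^8 = 1 and
   g^-1 u g = u^-1 inside the stabiliser K of an isotropic line and a plane
   through it, and let phi be a character of degree 2 of K whose restriction psi
   to B is irreducible of quaternionic type. By Mackey's formula the
   multiplicity of psi in the restriction of Ind phi is odd: the trivial double
   coset contributes 1, and every other one an even number. Pairing complex
   conjugates, some real irreducible character of G contains psi with odd
   multiplicity m. If it were afforded over the reals, the psi-part of its
   module, of dimension 2m, would be a vector space over the quaternions, and 4
   would divide 2m. *)

(* Finite computations take place in concrete copies, [f9] for the field and lists of lists for
   matrices, where [vm_compute] decides them; [ev9] and [evm] carry the results to an arbitrary
   field of order 9. The group enters only through a map M, multiplicative and injective on G, whose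
   image is the group of determinant-one isometries of a chosen Gram matrix. Two bases serve: an
   orthonormal one, in which s1 and s2 are permutation matrices, and one containing a hyperbolic
   pair, in which membership in K is read off the first two rows. Neither the order of G nor its
   character table is computed. The evenness in Mackey's formula has two sources. If the
   intersection of B with the conjugate of K is abelian, psi restricts to it as a linear character
   plus its complex conjugate, and these have equal multiplicity in a real character. Otherwise the
   intersection is all of B, and outside K the double coset contributes 0. Real traces are compared
   with character values through rational cuts; the argument only forms integer combinations of
   traces, and these respect cuts. *)
Require Import Defs.
From HB Require Import structures.
From mathcomp Require Import all_boot all_order all_algebra all_fingroup.
From mathcomp Require Import all_solvable all_field all_character.
From mathcomp Require Import sesquilinear reals ring lra.

Set Implicit Arguments.
Unset Strict Implicit.
Unset Printing Implicit Defensive.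

Import Order.TTheory GroupScope GRing.Theory Num.Theory.
Local Open Scope ring_scope.

(** * The fields with three and nine elements *)

(* F_3 as option bool: None is 0, Some true is 1 and Some false is -1. *)
Definition f3 := option bool.
Definition opp3 (x : f3) : f3 := omap negb x.
Definition add3 (x y : f3) : f3 :=
  match x, y with
  | None, _ => y
  | _, None => x
  | Some a, Some b => if eqb a b then Some (~~ a) else None
  end.
Definition mul3 (x y : f3) : f3 :=
  match x, y with
  | Some a, Some b => Some (eqb a b)
  | _, _ => None
  end.

(* F_9 = F_3[i]; the pair (a, b) stands for a + b i. *)
Definition f9 : Type := f3 * f3.
HB.instance Definition _ := Finite.on f9.
Definition zero9 : f9 := (None, None).
Definition one9 : f9 := (Some true, None).
Definition add9 (x y : f9) : f9 := (add3 x.1 y.1, add3 x.2 y.2).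
Definition opp9 (x : f9) : f9 := (opp3 x.1, opp3 x.2).
Definition conj9 (x : f9) : f9 := (x.1, opp3 x.2).
Definition mul9 (x y : f9) : f9 :=
  (add3 (mul3 x.1 y.1) (opp3 (mul3 x.2 y.2)),
   add3 (mul3 x.1 y.2) (mul3 x.2 y.1)).
Definition all3 : seq f3 := [:: None; Some true; Some false].
Definition all9 : seq f9 := [seq (a, b) | a <- all3, b <- all3].

Lemma mem_all9 x : x \in all9.
Proof. by move: x => [[[]|] [[]|]]. Qed.

Definition sum9 (n : nat) (g : nat -> f9) : f9 :=
  foldr (fun k => add9 (g k)) zero9 (iota 0 n).

Definition mat9 := seq (seq f9).
Definition get9 (A : mat9) i j : f9 := nth zero9 (nth [::] A i) j.
Definition mk9 (g : nat -> nat -> f9) : mat9 := mkseq (fun i => mkseq (g i) 5) 5.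
Definition mul9m (A B : mat9) : mat9 :=
  mk9 (fun i j => sum9 5 (fun k => mul9 (get9 A i k) (get9 B k j))).
Definition one9m : mat9 := mk9 (fun i j => if i == j then one9 else zero9).
Definition star9m (A : mat9) : mat9 := mk9 (fun i j => conj9 (get9 A j i)).
Definition prod9m (s : seq mat9) : mat9 := foldr mul9m one9m s.

Fixpoint det9 (n : nat) (a : nat -> nat -> f9) : f9 :=
  if n is n'.+1 then
    sum9 n (fun j => let c := mul9 (a 0%N j) (det9 n' (fun i k => a i.+1 (bump j k)))
                     in if odd j then opp9 c else c)
  else one9.

Lemma get_mk9 g i j : (i < 5)%N -> (j < 5)%N -> get9 (mk9 g) i j = g i j.
Proof. by move=> hi hj; rewrite /get9 /mk9 !nth_mkseq. Qed.

(** * Evaluation in a field of characteristic 3 containing a square root of -1 *)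

Section Eval.

Variables (F : fieldType) (char3 : 3%N \in [pchar F]) (im : F).
Variable theta : {rmorphism F -> F}.
Hypothesis thetaE : forall x, theta x = x ^+ 3.
Hypothesis im2 : im * im = -1.

Definition ev3 (x : f3) : F := if x is Some a then (if a then 1 else -1) else 0.
Definition ev9 (x : f9) : F := ev3 x.1 + ev3 x.2 * im.

Lemma two_char3 : 1 + 1 = -1 :> F.
Proof.
apply/eqP; rewrite -subr_eq0 opprK -(pcharf0 char3).
by rewrite -[1]/(1%:R) -!natrD.
Qed.

Lemma ev3D x y : ev3 (add3 x y) = ev3 x + ev3 y.
Proof.
by move: x y => [[]|] [[]|]; rewrite /= ?addr0 ?add0r ?subrr ?addNr ?two_char3 //
  -opprD two_char3 opprK.
Qed.

Lemma ev3N x : ev3 (opp3 x) = - ev3 x.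
Proof. by move: x => [[]|]; rewrite /= ?opprK ?oppr0. Qed.

Lemma ev3M x y : ev3 (mul3 x y) = ev3 x * ev3 y.
Proof. by move: x y => [[]|] [[]|]; rewrite /= ?mulr0 ?mul0r ?mulrNN ?mulr1 ?mul1r. Qed.

Lemma ev9_0 : ev9 zero9 = 0. Proof. by rewrite /ev9 /= mul0r addr0. Qed.
Lemma ev9_1 : ev9 one9 = 1. Proof. by rewrite /ev9 /= mul0r addr0. Qed.

Lemma ev9D x y : ev9 (add9 x y) = ev9 x + ev9 y.
Proof. by rewrite /ev9 !ev3D mulrDl addrACA. Qed.

Lemma ev9N x : ev9 (opp9 x) = - ev9 x.
Proof. by rewrite /ev9 !ev3N mulNr -opprD. Qed.

Lemma ev9M x y : ev9 (mul9 x y) = ev9 x * ev9 y.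
Proof.
rewrite /ev9 /= !(ev3D, ev3N, ev3M).
have -> : - (ev3 x.2 * ev3 y.2) = ev3 x.2 * ev3 y.2 * (im * im) by rewrite im2 mulrN1.
ring.
Qed.

Lemma ev3_cube x : ev3 x ^+ 3 = ev3 x.
Proof. by move: x => [[]|]; rewrite /= ?expr0n ?expr1n // exprS sqrrN expr1n mulr1. Qed.

Lemma ev9_conj x : ev9 (conj9 x) = theta (ev9 x).
Proof.
rewrite /ev9 rmorphD rmorphM /= !thetaE !ev3_cube ev3N.
by rewrite exprS expr2 im2 mulrN1 mulrN mulNr.
Qed.

Lemma im_neq0 : im != 0.
Proof. by apply: contra_eq_neq im2 => ->; rewrite mulr0 eq_sym oppr_eq0 oner_eq0. Qed.

Lemma one_neqN1 : 1 != -1 :> F.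
Proof. by rewrite -two_char3 -subr_eq0 opprD addNKr oppr_eq0 oner_eq0. Qed.

(** From a + b i = 0 follows a^2 = - b^2, and -1 is not a square in F_3. *)
Lemma ev9_eq0 x : (ev9 x == 0) = (x == zero9).
Proof.
case: x => a b; apply/idP/eqP => [|->]; last by rewrite ev9_0.
have h3 (c : f3) : ev3 c = 0 -> c = None.
  by move: c => [[]|] //= /eqP; rewrite ?oppr_eq0 oner_eq0.
rewrite /ev9 /= addr_eq0 => /eqP e.
have e2 : ev3 a * ev3 a = - (ev3 b * ev3 b).
  by rewrite e mulrNN mulrACA im2 mulrN1.
move: a b e e2 => [[]|] [[]|] //=; rewrite ?mulr1 ?mulrNN ?mul0r ?mulr0 ?oppr0 ?mulr1.
all: by do ?[move=> _ /eqP; rewrite ?(negPf one_neqN1) ?oner_eq0 ?(eq_sym 0) ?oppr_eq0 ?oner_eq0 //].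
Qed.

Lemma ev9_inj : injective ev9.
Proof.
move=> x y e; have : ev9 (add9 x (opp9 y)) == 0 by rewrite ev9D ev9N e subrr.
rewrite ev9_eq0 => /eqP; move: x y {e} => [[[]|] [[]|]] [[[]|] [[]|]] //=.
Qed.

Lemma ev9_sum n g : ev9 (sum9 n g) = \sum_(k < n) ev9 (g k).
Proof.
rewrite -(big_mkord xpredT (fun k => ev9 (g k))) /index_iota subn0 /sum9.
elim: (iota 0 n) => [|k s IH] /=; first by rewrite big_nil ev9_0.
by rewrite big_cons ev9D IH.
Qed.

Definition evm (A : mat9) : 'M[F]_5 := \matrix_(i, j) ev9 (get9 A i j).

(** [evm] sees only the entries with indices below 5, a missing one counting as zero, so it
    determines a list of lists only up to normalisation by [mk9]. *)
Lemma evm_inj A B : evm A = evm B -> mk9 (get9 A) = mk9 (get9 B).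
Proof.
move=> e; apply/eq_in_map => i; rewrite mem_iota => hi; apply/eq_in_map => j.
rewrite mem_iota => hj; apply: ev9_inj.
by have /matrixP/(_ (Ordinal hi) (Ordinal hj)) := e; rewrite !mxE.
Qed.

Lemma evm_mul A B : evm (mul9m A B) = evm A *m evm B.
Proof.
apply/matrixP=> i j; rewrite !mxE get_mk9 // ev9_sum.
by apply: eq_bigr => k _; rewrite ev9M !mxE.
Qed.

Lemma evm1 : evm one9m = 1%:M.
Proof. by apply/matrixP=> i j; rewrite !mxE get_mk9 // -val_eqE; case: eqP; rewrite ?ev9_1 ?ev9_0. Qed.

Lemma evm_star A : evm (star9m A) = map_mx theta (evm A)^T.
Proof. by apply/matrixP=> i j; rewrite !mxE get_mk9 // ev9_conj. Qed.

Lemma evm_det A : \det (evm A) = ev9 (det9 5 (get9 A)).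
Proof.
have h n (a : nat -> nat -> f9) :
    \det (\matrix_(i < n, j < n) ev9 (a i j)) = ev9 (det9 n a).
  elim: n a => [|n IH] a; first by rewrite det_mx00 ev9_1.
  rewrite (expand_det_row _ ord0) [det9 _ _]/= ev9_sum; apply: eq_bigr => j _.
  rewrite mxE /cofactor add0n.
  have -> : row' ord0 (col' j (\matrix_(i, j) ev9 (a i j)))
      = \matrix_(i < n, k < n) ev9 (a i.+1 (bump j k)).
    by apply/matrixP=> i k; rewrite !mxE.
  rewrite (IH (fun i k => a i.+1 (bump j k)) : @determinant _ n.+1.-1 _ = _).
  by rewrite -signr_odd; case: (odd j); rewrite ?ev9N ev9M ?mul1r ?mulN1r ?mulrN.
by rewrite -h.
Qed.

End Eval.

(* The digit 3 a + b, with a and b in {0, 1, 2}, stands for a + b i. *)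
Definition dec3 (n : nat) : f3 :=
  match n with 0%N => None | 1%N => Some true | _ => Some false end.
Definition dec9 (n : nat) : f9 := (dec3 (n %/ 3), dec3 (n %% 3)).
Definition mx9 (s : seq (seq nat)) : mat9 := [seq [seq dec9 n | n <- r] | r <- s].

(* Found by computer search, like all the explicit matrices and words below. *)
Definition s0m : mat9 := mx9
  [:: [:: 6; 6; 3; 0; 6]; [:: 6; 6; 6; 0; 3]; [:: 3; 6; 0; 5; 0];
      [:: 0; 0; 4; 0; 4]; [:: 6; 3; 0; 5; 0]]%N.
(* The permutation matrices of i |-> - i and i |-> 1 - i on Z/5. *)
Definition s1m : mat9 := mk9 (fun i j => if ((i + j) %% 5 == 0)%N then one9 else zero9).
Definition s2m : mat9 := mk9 (fun i j => if ((i + j) %% 5 == 1)%N then one9 else zero9).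
Definition gen9m (k : nat) : mat9 := nth one9m [:: s0m; s1m; s2m] k.
Definition word9m (w : seq nat) : mat9 := prod9m [seq gen9m k | k <- w].
(* A unitary transvection. *)
Definition taum : mat9 := mx9
  [:: [:: 5; 4; 0; 8; 1]; [:: 7; 4; 0; 2; 5]; [:: 0; 0; 3; 0; 0];
      [:: 5; 2; 0; 4; 7]; [:: 1; 8; 0; 4; 5]]%N.
Definition conj9m (w : seq nat) (A : mat9) : mat9 :=
  mul9m (word9m (rev w)) (mul9m A (word9m w)).

Definition norm9 (x : f9) : f9 := mul9 x (conj9 x).

Definition emb9 (k l : nat) (p q : f9) : mat9 :=
  mk9 (fun i j => if i == k then if j == k then p else if j == l then q else zero9
                  else if i == l then
                    if j == k then opp9 (conj9 q) else if j == l then conj9 p else zero9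
                  else if i == j then one9 else zero9).

(* Conjugating taum by these two words, then by the k-th power of the 5-cycle,
   gives generators of SU(2, 3) on the coordinates k and k + d. *)
Definition words_su2 (d : nat) : seq nat * seq nat :=
  if d == 1%N then
   ([:: 0; 1; 0; 1; 2; 1; 0; 2; 1; 0; 1; 2; 1; 0; 1; 0; 2; 1; 0],
    [:: 1; 0; 1; 2; 1; 0; 1; 2; 1; 0; 1; 2; 1; 0; 1; 2; 1; 0; 1])%N
  else
   ([:: 0; 1; 0; 2; 1; 0; 2; 1; 0; 2; 1; 2; 1; 0; 1; 2; 1; 0; 1; 0; 2; 1; 0; 2],
    [:: 0; 2; 1; 0; 2; 1; 2; 1; 0; 1; 0; 2; 1; 0; 1; 0; 2; 1; 0; 2; 1; 0; 1; 0; 2])%N.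

Definition rotword (k : nat) : seq nat := flatten (nseq k [:: 1; 2]%N).

Definition su2_gens (d k : nat) : mat9 * mat9 :=
  (conj9m ((words_su2 d).1 ++ rotword k) taum,
   conj9m ((words_su2 d).2 ++ rotword k) taum).

(** The words of length at most 5 in the two generators; SU(2, 3) has order 24, and [su2_check]
    confirms that these words exhaust it. *)
Definition su2_elts (d k : nat) : seq mat9 :=
  let: (t, t') := su2_gens d k in
  iter 5 (fun L => undup (L ++ [seq mul9m t A | A <- L] ++ [seq mul9m t' A | A <- L]))
    [:: one9m].

Lemma su2_check :
  all (fun d => all (fun k =>
    let L := su2_elts d k in
    all (fun p => all (fun q =>
      (add9 (norm9 p) (norm9 q) == one9) ==> (emb9 k ((k + d) %% 5)%N p q \in L))
      all9) all9) (iota 0 5)) [:: 1; 2]%N.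
Proof. by vm_compute. Qed.

Definition tau_word : seq nat :=
  [:: 0; 2; 1; 0; 2; 1; 2; 1; 0; 1; 2; 1; 0; 1; 0; 2; 1; 2; 1; 0; 1; 0]%N.
(** The repeated block has order dividing 24; its eighth power, of order 3, is conjugate to the
    transvection [taum]. *)
Definition tau0_word : seq nat :=
  flatten (nseq 8 [:: 1; 2; 1; 0; 2; 1; 0; 2; 1; 0]%N).

Lemma tau_word_check :
  [&& conj9m tau_word (word9m tau0_word) == taum,
      all (fun k => mul9m (gen9m k) (gen9m k) == one9m) (iota 0 3) ,
      all (fun k => mul9m (gen9m k) (star9m (gen9m k)) == one9m) (iota 0 3),
      all (fun k => det9 5 (get9 (gen9m k)) == one9) (iota 0 3) &
      ~~ has (fun k => gen9m k == one9m) (iota 0 3)].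
Proof. by vm_compute. Qed.

(** * Generation by unitary transvections *)

Section F9.

Variables (F : finFieldType) (cardF : #|F| = 9%N) (char3 : 3%N \in [pchar F]).
Variable theta : {rmorphism F -> F}.
Hypothesis thetaE : forall x, theta x = x ^+ 3.

Lemma exp9 (x : F) : x ^+ 9 = x.
Proof. by rewrite -cardF expf_card. Qed.

Lemma thetaK : involutive theta.
Proof. by move=> x; rewrite !thetaE -exprM exp9. Qed.

(** Every nonzero x has x^4 = 1 or x^4 = -1. The eight nonzero elements cannot all be roots of X^4 -
    1, and if x^4 = -1 then x^2 is a square root of -1. *)
Lemma exists_im : exists im : F, im * im = -1.
Proof.
have [x hx|h] := pickP (fun x : F => x ^+ 4 == -1).
  by exists (x ^+ 2); rewrite -expr2 -exprM; apply/eqP.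
have h4 (x : F) : x != 0 -> x ^+ 4 == 1.
  move=> nx; have /eqP : x ^+ 8 = 1 by apply: (mulfI nx); rewrite -exprS exp9 mulr1.
  by rewrite (exprM x 4 2) sqrf_eq1 h orbF.
have hall : all 4.-unity_root (enum (predC1 (0 : F))).
  by apply/allP=> x; rewrite mem_enum inE unity_rootE => /h4.
have := max_unity_roots (isT : (0 < 4)%N) hall (enum_uniq _).
by rewrite -cardE; have := cardC1 (0 : F); rewrite cardF => ->.
Qed.

Section Im.
Variable im : F.
Hypothesis im2 : im * im = -1.
Local Notation ev := (ev9 im).

Lemma ev9_surj (x : F) : exists a, ev a = x.
Proof.
have hb : bijective ev.
  by apply: inj_card_bij; [exact: (ev9_inj char3) | rewrite cardF card_prod !card_option card_bool].
by case: hb => g _ gK; exists (g x).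
Qed.

Definition adj m n (A : 'M[F]_(m, n)) : 'M_(n, m) := map_mx theta A^T.

Lemma adjM m n p (A : 'M[F]_(m, n)) (B : 'M_(n, p)) : adj (A *m B) = adj B *m adj A.
Proof. by rewrite /adj trmx_mul map_mxM. Qed.

Lemma adjK m n (A : 'M[F]_(m, n)) : adj (adj A) = A.
Proof. by apply/matrixP=> i j; rewrite !mxE thetaK. Qed.

Lemma adj1 n : adj 1%:M = 1%:M :> 'M[F]_n.
Proof. by rewrite /adj trmx1 map_mx1. Qed.

Definition unitary (A : 'M[F]_5) := A *m adj A = 1%:M.

Lemma norm_cases (x : F) : theta x = x -> [\/ x = 0, x = 1 | x = -1].
Proof.
rewrite thetaE => h.
have /eqP : x * ((x - 1) * (x + 1)) = 0.
  by rewrite -subr_sqr expr1n mulrBr mulr1 -exprS h subrr.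
rewrite !mulf_eq0 subr_eq0 addr_eq0 => /or3P[] /eqP; by [constructor 1|constructor 2|constructor 3].
Qed.

Lemma normF_theta (x : F) : theta (x * theta x) = x * theta x.
Proof. by rewrite rmorphM /= thetaK mulrC. Qed.

(** The fixed points of [theta] are 0, 1 and -1, and 1 + i has norm 2 = -1. *)
Lemma exists_norm (n : F) : theta n = n -> exists z, z * theta z = n.
Proof.
have hz : (1 + im) * theta (1 + im) = -1.
  rewrite rmorphD rmorph1 /= thetaE exprS expr2 im2 mulrN1.
  have -> : (1 + im) * (1 - im) = 1 - im * im by ring.
  by rewrite im2 opprK (two_char3 char3).
by case/norm_cases=> ->; [exists 0; rewrite mul0r | exists 1; rewrite rmorph1 mulr1 | exists (1 + im)].
Qed.

Definition emb (k l : 'I_5) (p q : F) : 'M[F]_5 :=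
  \matrix_(i, j) (if i == k then if j == k then p else if j == l then q else 0
                  else if i == l then
                    if j == k then - theta q else if j == l then theta p else 0
                  else (i == j)%:R).

Lemma emb_evm (k l : 'I_5) p q : evm im (emb9 k l p q) = emb k l (ev p) (ev q).
Proof.
apply/matrixP=> i j; rewrite !mxE get_mk9 // -!(inj_eq val_inj) /=.
do !case: ifP => _; rewrite ?ev9_0 ?ev9_1 ?ev9N ?(ev9_conj thetaE im2) //.
Qed.

Lemma emb_swap k l p q : k != l -> emb l k p q = emb k l (theta p) (- theta q).
Proof.
move=> nkl; apply/matrixP=> i j; rewrite !mxE rmorphN /= !thetaK opprK.
have [->|nik] := eqVneq i k; first by rewrite (negPf nkl); do !case: eqVneq => // ?; subst; rewrite eqxx in nkl.
by case: eqVneq => // _; do !case: eqVneq => // ?; subst; rewrite eqxx in nkl.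
Qed.

Lemma mul_emb (v : 'rV[F]_5) k l p q j : k != l ->
  (v *m emb k l p q) 0 j =
  if j == k then v 0 k * p - v 0 l * theta q
  else if j == l then v 0 k * q + v 0 l * theta p else v 0 j.
Proof.
move=> nkl; rewrite mxE (bigD1 k) //= (bigD1 l) ?(eq_sym l) //= !mxE !eqxx.
rewrite [l == k]eq_sym (negPf nkl) addrA.
have [->|njk] := eqVneq j k.
  rewrite mulrN big1 ?addr0 // => i /andP[nik nil]; rewrite !mxE (negPf nik) (negPf nil).
  by rewrite mulr0.
have [->|njl] := eqVneq j l.
  rewrite big1 ?addr0 // => i /andP[nik nil]; rewrite !mxE (negPf nik) (negPf nil).
  by rewrite mulr0.
rewrite !mulr0 !add0r (bigD1 j) /=; last by rewrite njk.
rewrite mxE (negPf njk) (negPf njl) eqxx mulr1 big1 ?addr0 // => i /andP[/andP[nik nil] nij].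
by rewrite mxE (negPf nik) (negPf nil) (negPf nij) mulr0.
Qed.

(** The pair (x, y) is to become (0, z), where z carries the sum of the two norms; this dictates p =
    y / z and q = (x / z)^3. *)
Lemma emb_collapse (v : 'rV[F]_5) k l z : k != l ->
  v 0 k * theta (v 0 k) + v 0 l * theta (v 0 l) = z * theta z -> z != 0 ->
  exists p q, [/\ p * theta p + q * theta q = 1,
    (v *m emb k l p q) 0 k = 0, (v *m emb k l p q) 0 l = z &
    forall j, j != k -> j != l -> (v *m emb k l p q) 0 j = v 0 j].
Proof.
move=> nkl hz nz; have ntz : theta z != 0 by rewrite fmorph_eq0.
set x := v 0 k in hz *; set y := v 0 l in hz *.
exists (y / z), (theta x / theta z); rewrite !rmorphM /= !fmorphV /= !thetaK.
have E : (theta z)^-1 * theta z = 1 by rewrite mulVf.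
split.
- have -> : y / z * (theta y / theta z) + theta x / theta z * (x / z)
     = (x * theta x + y * theta y) / (z * theta z) by field; rewrite nz ntz.
  by rewrite hz divff // mulf_neq0.
- by rewrite mul_emb // eqxx !rmorphM /= !fmorphV /= !thetaK -/x -/y mulrCA subrr.
- rewrite mul_emb // eq_sym (negPf nkl) eqxx !rmorphM /= !fmorphV /= -/x -/y.
  by rewrite !mulrA -mulrDl hz mulfK.
by move=> j njk njl; rewrite mul_emb // (negPf njk) (negPf njl).
Qed.

Section Transitivity.

Variable P : 'M[F]_5 -> Prop.
Variable m : 'I_5.
Hypothesis PM : forall A B, P A -> P B -> P (A *m B).
Hypothesis Pemb : forall (k l : 'I_5) p q, k != l -> (k <= m)%N -> (l <= m)%N ->
  p * theta p + q * theta q = 1 -> P (emb k l p q).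

(** Induction on the size of the support. Two nonzero coordinates whose norms do not cancel are
    collapsed into one. If any two cancel, there cannot be three of them, since n = - n forces n =
    0, nor exactly two, since the total norm is 1. The single one left is moved to m. *)
Lemma reach_last (v : 'rV[F]_5) : (0 < m)%N ->
  (forall k : 'I_5, (m < k)%N -> v 0 k = 0) ->
  \sum_k v 0 k * theta (v 0 k) = 1 ->
  exists2 A, P A & v *m A = delta_mx 0 m.
Proof.
move=> m0; pose N (v : 'rV[F]_5) k := v 0 k * theta (v 0 k).
have Nz w k : (N w k == 0) = (w 0 k == 0) by rewrite mulf_eq0 fmorph_eq0 orbb.
have [r] := ubnP #|[pred k | v 0 k != 0]|; elim: r v => // r IH v hr hv hN.
have hle k : v 0 k != 0 -> (k <= m)%N by rewrite leqNgt => h; apply/negP=> /hv /eqP; exact/negP.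
have [[k l] /= /and3P[nkl nk hkl]|hno] :=
    pickP (fun kl : 'I_5 * 'I_5 => [&& kl.1 != kl.2, v 0 kl.1 != 0 &
      (v 0 kl.2 != 0) && (N v kl.1 + N v kl.2 != 0)]).
  have /andP[nl nN] := hkl.
  have [z hz] : exists z, z * theta z = N v k + N v l.
    by apply: exists_norm; rewrite rmorphD /= !normF_theta.
  have nz : z != 0 by apply: contraNneq nN => z0; rewrite -hz z0 mul0r.
  have [p [q [hpq hk hl hj]]] := emb_collapse nkl (esym hz) nz.
  set w := v *m emb k l p q in hk hl hj.
  have hNw : \sum_k N w k = 1.
    rewrite -hN (bigD1 k) //= (bigD1 l) 1?eq_sym //= addrA.
    rewrite [RHS](bigD1 k) //= [X in _ = _ + X](bigD1 l) 1?eq_sym //= [RHS]addrA.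
    congr (_ + _); last by apply: eq_bigr => i /andP[nik nil]; rewrite /N hj.
    by rewrite {1 2}/N hk hl mul0r add0r hz.
  have [|j hmj|A PA hA] := IH w _ _ hNw.
  - rewrite -ltnS; apply: leq_trans hr; rewrite ltnS; apply: proper_card.
    apply/properP; split; last by exists k; rewrite ?inE ?hk ?eqxx.
    apply/subsetP=> i; rewrite !inE; have [->|nik] := eqVneq i k; first by rewrite nk.
    by have [->|nil] := eqVneq i l; rewrite ?nl // hj.
  - rewrite hj ?hv //; apply: contraTneq hmj => ->; rewrite -leqNgt; exact: hle.
  exists (emb k l p q *m A); last by rewrite mulmxA.
  by apply: PM => //; apply: Pemb => //; exact: hle.
have opp k l : k != l -> v 0 k != 0 -> v 0 l != 0 -> N v k = - N v l.
  move=> nkl nk nl; apply/eqP; rewrite -addr_eq0; apply/negPn/negP=> h.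
  by have := hno (k, l); rewrite /= nkl nk nl h.
have uniq_supp i j : v 0 i != 0 -> v 0 j != 0 -> i = j.
  move=> ni nj; apply/eqP/negPn/negP=> nij.
  have : \sum_k N v k = 0; last by move=> h; move: hN; rewrite [X in X = _]h => /eqP; rewrite eq_sym oner_eq0.
  rewrite (bigD1 i) //= (bigD1 j) 1?eq_sym //= big1 ?addr0 => [|k /andP[nki nkj]].
    by rewrite (opp i j) // addNr.
  have [vk|nk] := eqVneq (v 0 k) 0; first by rewrite /N vk mul0r.
  have e1 := opp k i nki nk ni; have e2 := opp k j nkj nk nj; have e3 := opp i j nij ni nj.
  have e : N v k = - N v k by rewrite {1}e1 e3 opprK e2 opprK.
  have /eqP : N v k + N v k = 0 by rewrite {1}e addNr.
  by rewrite -mulr2n -mulr_natl mulf_eq0 -[2%:R]/(1 + 1) (two_char3 char3) oppr_eq0 oner_eq0 => /eqP.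
have [i ni] : exists i, v 0 i != 0.
  apply/existsP; rewrite -negb_forall; apply/negP=> /forallP h.
  move: hN; rewrite big1 => [/eqP|k _]; first by rewrite eq_sym oner_eq0.
  by rewrite (eqP (h k)) mul0r.
have v0 k : k != i -> v 0 k = 0.
  by move=> nki; apply/eqP/negPn/negP=> nk; rewrite (uniq_supp k i) ?eqxx in nki.
have Ni : N v i = 1 by rewrite -hN (bigD1 i) //= big1 ?addr0 // => k /v0 ->; rewrite mul0r.
(* A partner different from [m]: if the support is already [m], a zero coordinate is used, and the
   collapse only rescales the entry at [m] to 1. *)
pose k := if i == m then ord0 else i.
have nkm : k != m by rewrite /k; case: (eqVneq i m) => // _; rewrite -(inj_eq val_inj) /= eq_sym -lt0n.
have hkm : N v k + N v m = 1 * theta 1.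
  rewrite rmorph1 mulr1 -Ni /k; have [eim|nim] := eqVneq i m; first subst i.
    by rewrite /N (v0 ord0) ?mul0r ?add0r // -(inj_eq val_inj) /= eq_sym -lt0n.
  by rewrite [N v m]/N v0 1?eq_sym // mul0r addr0.
have [p [q [hpq hk hm hj]]] := emb_collapse nkm hkm (oner_neq0 _).
exists (emb k m p q).
  apply: Pemb => //; rewrite /k; case: ifP => // _; exact: hle.
apply/rowP=> j; rewrite [RHS]mxE /=; have [->|njm] := eqVneq j m; first by rewrite hm.
have [->|njk] := eqVneq j k; first by rewrite hk.
have nji : j != i by move: njk; rewrite /k; case: (eqVneq i m) => [->|].
by rewrite hj // v0.
Qed.

End Transitivity.

Section Generation.

Variables (gT : finGroupType) (G : {group gT}) (M : gT -> 'M[F]_5).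
Hypothesis M_mul : {in G &, forall x y, M (x * y)%g = M x *m M y}.
Hypothesis M_inj : {in G &, injective M}.
Hypothesis M_im : forall A, (exists2 x, x \in G & M x = A) <-> unitary A /\ \det A = 1.

Section MatD.
Variable D : {group gT}.
Hypothesis sDG : D \subset G.

Definition matD (A : 'M[F]_5) := exists2 x, x \in D & M x = A.

Lemma M1 : M 1%g = 1%:M.
Proof.
have [x Gx Mx] : exists2 x, x \in G & M x = 1%:M.
  by apply/M_im; rewrite /unitary adj1 mulmx1 det1.
have e : M x *m M 1%g = M x by rewrite -M_mul ?mulg1.
by rewrite -[LHS]mul1mx -Mx e.
Qed.

Lemma matD1 : matD 1%:M.
Proof. by exists 1%g; rewrite ?group1 ?M1. Qed.

Lemma matDM A B : matD A -> matD B -> matD (A *m B).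
Proof.
move=> [x Dx <-] [y Dy <-]; exists (x * y)%g; first exact: groupM.
by rewrite M_mul ?(subsetP sDG).
Qed.

(* The groups SU(2, 3) on pairs of coordinates are transitive on the vectors of
   norm 1, so the rows of a matrix can be cleared one after the other. *)
Lemma su2_generate :
  (forall (k l : 'I_5) p q, k != l -> p * theta p + q * theta q = 1 -> matD (emb k l p q)) ->
  D = G.
Proof.
move=> hemb; apply/group_inj/eqP; rewrite eqEsubset sDG; apply/subsetP=> a Ga.
have step m (A : 'M[F]_5) : (m <= 5)%N -> unitary A -> \det A = 1 ->
    (forall k : 'I_5, (m <= k)%N -> row k A = delta_mx 0 k) -> matD A.
  elim: m A => [|m IH] A hm uA dA hr.
    suff -> : A = 1%:M by exact: matD1.
    by apply/row_matrixP=> k; rewrite hr // row1.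
  have A_ (k j : 'I_5) : (m < k)%N -> A k j = (j == k)%:R.
    by move=> hk; have /rowP/(_ j) := hr k hk; rewrite !mxE /=.
  pose i := Ordinal hm.
  (* The rows beyond m are standard basis vectors, so orthogonality to them clears the part of row m
     beyond the diagonal. *)
  have Ai (k : 'I_5) : (m < k)%N -> A i k = 0.
    move=> hk; have /matrixP/(_ i k) := uA; rewrite !mxE (bigD1 k) //= !mxE (A_ k) // ?eqxx /= rmorph1 mulr1.
    rewrite big1 => [|j njk]; last by rewrite !mxE (A_ k) // (negPf njk) rmorph0 mulr0.
    by rewrite addr0 => ->; rewrite -val_eqE /= ltn_eqF.
  have Nrow : \sum_k row i A 0 k * theta (row i A 0 k) = 1.
    have /matrixP/(_ i i) := uA; rewrite !mxE eqxx /= mulr1n => <-.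
    by apply: eq_bigr => k _; rewrite !mxE.
  (* For the last row there is no second coordinate to collapse with; its diagonal entry is the
     determinant. *)
  have [m0|m0] := posnP m.
    suff -> : A = 1%:M by exact: matD1.
    have Ai0 k : k != i -> A i k = 0.
      by move=> nk; apply: Ai; rewrite m0 lt0n; apply: contraNneq nk => k0; apply/eqP/val_inj; rewrite /= m0.
    have Aii : A i i = 1.
      rewrite -dA (expand_det_row _ i) (bigD1 i) //= big1 => [|k nk]; last by rewrite Ai0 ?mul0r.
      rewrite addr0 /cofactor -signr_odd addnn odd_double expr0 mul1r.
      suff -> : row' i (col' i A) = 1%:M by rewrite det1 mulr1.
      apply/matrixP=> j k; rewrite !mxE A_.
        by rewrite (inj_eq lift_inj) eq_sym.
      by rewrite m0 /= /bump /= m0.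
    apply/matrixP=> j k; rewrite mxE.
    have [->|nji] := eqVneq j i.
      by have [<-//|nik] := eqVneq i k; rewrite Ai0 1?eq_sym.
    rewrite A_ 1?eq_sym // m0 lt0n; apply: contraNneq nji => j0; apply/eqP/val_inj.
    by rewrite /= m0.
  (* Fixing the later basis vectors is part of [P], so that the rows already cleared stay
     cleared. *)
  pose P B := matD B /\ forall k : 'I_5, (m < k)%N -> row k B = delta_mx 0 k.
  have [|k l p q nkl hk hl hpq|k hk|B [DB hB] hv] :=
      @reach_last P i _ _ (row i A) m0 _ Nrow.
  - move=> B C [DB hB] [DC hC]; split; first exact: matDM.
    by move=> k hk; rewrite row_mul hB // -rowE hC.
  - split; first exact: hemb.
    move=> j hj; apply/rowP=> j'; rewrite !mxE /= [j' == j]eq_sym.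
    have /negPf-> : j != k by apply: contraTneq hj => ->; rewrite -leqNgt.
    by have /negPf-> : j != l by apply: contraTneq hj => ->; rewrite -leqNgt.
  - by rewrite mxE Ai.
  have [b Db Mb] := DB; have Gb := subsetP sDG b Db.
  have [a' Ga' Ma'] : exists2 x, x \in G & M x = A by apply/M_im.
  have [uAB dAB] : unitary (A *m B) /\ \det (A *m B) = 1.
    by apply/M_im; exists (a' * b)%g; rewrite ?groupM // M_mul // Ma' Mb.
  have [|c Dc Mc] := IH (A *m B) (ltnW hm) uAB dAB.
    move=> k; rewrite leq_eqVlt row_mul => /orP[/eqP ek|hk]; last by rewrite hr // -rowE hB.
    by have -> : k = i; [exact: val_inj | rewrite hv].
  exists a' => //; have -> : a' = (c * b^-1)%g.
    apply: (mulIg b); rewrite mulgKV; apply: M_inj; rewrite ?groupM ?(subsetP sDG c) //.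
    by rewrite M_mul // Ma' Mb Mc.
  by rewrite groupM ?groupV.
have [uA dA] : unitary (M a) /\ \det (M a) = 1 by apply/M_im; exists a.
have [|b Db Mb] := step 5%N (M a) isT uA dA; first by move=> k; rewrite leqNgt ltn_ord.
by rewrite -(M_inj _ Ga Mb) // (subsetP sDG).
Qed.

End MatD.

Variable s : nat -> gT.
Hypothesis sG : forall k, (k < 3)%N -> s k \in G.
Hypothesis sM : forall k, (k < 3)%N -> M (s k) = evm im (gen9m k).

Definition wordg (w : seq nat) : gT := foldr (fun k x => (s k * x)%g) 1%g w.

Lemma wordg_in w : all (fun k => k < 3)%N w -> wordg w \in G.
Proof. by elim: w => [|k w IH] //= /andP[hk hw]; rewrite groupM ?sG ?IH. Qed.

Lemma wordgM w : all (fun k => k < 3)%N w -> M (wordg w) = evm im (word9m w).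
Proof.
elim: w => [|k w IH] /=; first by rewrite M1 (evm1 im).
by move=> /andP[hk hw]; rewrite M_mul ?wordg_in ?sG // sM // IH // (evm_mul char3 im2).
Qed.

Lemma wordg_cat w w' : wordg (w ++ w') = (wordg w * wordg w')%g.
Proof. by elim: w => [|k w IH] /=; rewrite ?mul1g // IH mulgA. Qed.

Lemma gens_sqr k : (k < 3)%N -> (s k * s k = 1)%g.
Proof.
move=> hk; apply: M_inj; rewrite ?groupM ?sG // M_mul ?sG // sM //.
rewrite -(evm_mul char3 im2) M1 -(evm1 im); congr evm; apply/eqP.
have /and5P[_ /allP h _ _ _] := tau_word_check; apply: h.
by rewrite mem_iota.
Qed.

Lemma wordg_rev w : all (fun k => k < 3)%N w -> wordg (rev w) = (wordg w)^-1%g.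
Proof.
elim: w => [|k w IH] /=; first by rewrite invg1.
move=> /andP[hk hw]; rewrite rev_cons -cats1 wordg_cat IH //= mulg1 invMg; congr (_ * _)%g.
by apply/eqP; rewrite eq_sym eq_invg_mul gens_sqr.
Qed.

Section NormalisedSubgroup.

Variables (D : {group gT}) (tau : gT).
Hypothesis sDG : D \subset G.
Hypothesis Dtau : tau \in D.
Hypothesis Mtau : M tau = evm im taum.
Hypothesis nDs : forall k, (k < 3)%N -> s k \in 'N(D)%g.

Lemma matD_conj w : all (fun k => k < 3)%N w -> matD D (evm im (conj9m w taum)).
Proof.
have gN v : all (fun k => k < 3)%N v -> wordg v \in 'N(D)%g.
  by elim: v => [|k v IH] //= /andP[hk hv]; rewrite groupM ?nDs ?IH.
move=> hw; exists (tau ^ wordg w)%g; first by rewrite memJ_norm // gN.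
have Gt := subsetP sDG _ Dtau.
have hrw : all (fun k => k < 3)%N (rev w) by rewrite all_rev.
rewrite conjgE -wordg_rev // !M_mul ?groupM ?wordg_in // !wordgM // Mtau.
by rewrite /conj9m !(evm_mul char3 im2) mulmxA.
Qed.

(** Applied to the group generated by s0, s1, s2 and to the kernel of a representation. Distinct
    residues modulo 5 differ by 1 or 2 up to sign, so the two values of d in [su2_check] cover every
    pair, [emb_swap] taking care of the order. *)
Lemma transvection_generate : D = G.
Proof.
apply: su2_generate => //.
have gens d k : d \in [:: 1; 2]%N -> (k < 5)%N ->
    forall A, A \in su2_elts d k -> matD D (evm im A).
  move=> hd hk; rewrite /su2_elts /su2_gens.
  have hrot : all (fun k => k < 3)%N (rotword k) by rewrite /rotword; elim: (k).
  have h1 : matD D (evm im (conj9m ((words_su2 d).1 ++ rotword k) taum)).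
    by apply: matD_conj; rewrite all_cat hrot andbT; move: hd; rewrite !inE => /orP[] /eqP->.
  have h2 : matD D (evm im (conj9m ((words_su2 d).2 ++ rotword k) taum)).
    by apply: matD_conj; rewrite all_cat hrot andbT; move: hd; rewrite !inE => /orP[] /eqP->.
  move: (conj9m _ _) (conj9m _ _) h1 h2 => t t' ht ht'.
  elim: 5%N => [|r IH] A; first by rewrite inE => /eqP->; rewrite (evm1 im); exact: matD1.
  rewrite iterS mem_undup !mem_cat => /or3P[|/mapP[B LB ->]|/mapP[B LB ->]]; first exact: IH.
    by rewrite (evm_mul char3 im2); apply: matDM => //; apply: IH.
  by rewrite (evm_mul char3 im2); apply: matDM => //; apply: IH.
have adj_pair d (k l : 'I_5) p q : d \in [:: 1; 2]%N -> ((k + d) %% 5)%N = l ->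
    p * theta p + q * theta q = 1 -> matD D (emb k l p q).
  have [p' <-] := ev9_surj p; have [q' <-] := ev9_surj q => hd hl hpq.
  rewrite -emb_evm; apply: (gens d k hd (ltn_ord k)).
  have /allP/(_ d hd)/allP/(_ k) := su2_check; rewrite mem_iota => /(_ (ltn_ord k)).
  move=> /allP/(_ p' (mem_all9 _))/allP/(_ q' (mem_all9 _)); rewrite hl => /implyP; apply.
  apply/eqP/(ev9_inj char3 im2).
  by rewrite (ev9D char3) /norm9 !(ev9M char3 im2) !(ev9_conj thetaE im2) hpq ev9_1.
move=> k l p q nkl hpq.
have [d [hd [hkl|hlk]]] : exists d, d \in [:: 1; 2]%N /\ (((k + d) %% 5)%N = l \/ ((l + d) %% 5)%N = k).
  move: k l nkl => [[|[|[|[|[|//]]]]] hk] [[|[|[|[|[|//]]]]] hl] //= _;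
  first [exists 1%N; split; [by [] | by [left|right]] | exists 2%N; split; [by [] | by [left|right]]].
  exact: (adj_pair d).
rewrite emb_swap 1?eq_sym //; apply: (adj_pair d) => //.
by rewrite rmorphN /= !thetaK mulrNN ![theta _ * _]mulrC.
Qed.

End NormalisedSubgroup.

End Generation.
End Im.
End F9.

(** * Weights of an elementary abelian subgroup *)

Definition wt : Type := f9 * f9.
HB.instance Definition _ := Finite.on wt.
Definition add_wt (v w : wt) : wt := (add9 v.1 w.1, add9 v.2 w.2).
Definition zero_wt : wt := (zero9, zero9).
Definition opp_wt (v : wt) : wt := (opp9 v.1, opp9 v.2).
Definition dot9 (x y : f9) : f3 := add3 (mul3 x.1 y.1) (mul3 x.2 y.2).
(** Both the elements of the group of order 81 and its linear characters are encoded by [wt]: the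
    weight b takes the value omega^(b . v) at the element with coordinates v. *)
Definition dot_wt (b v : wt) : f3 := add3 (dot9 b.1 v.1) (dot9 b.2 v.2).
Definition all_wt : seq wt := [seq (a, b) | a <- all9, b <- all9].

Definition mx2 : Type := (f9 * f9) * (f9 * f9).
Definition mul2 (A B : mx2) : mx2 :=
  let: ((a, b), (c, d)) := A in let: ((a', b'), (c', d')) := B in
  ((add9 (mul9 a a') (mul9 b c'), add9 (mul9 a b') (mul9 b d')),
   (add9 (mul9 c a') (mul9 d c'), add9 (mul9 c b') (mul9 d d'))).
Definition star2 (A : mx2) : mx2 :=
  let: ((a, b), (c, d)) := A in ((conj9 a, conj9 c), (conj9 b, conj9 d)).
Definition one2 : mx2 := ((one9, zero9), (zero9, one9)).

(* The coordinates (x, y), c parametrise the skew-Hermitian matrix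
   [[x i, c], [- c^3, y i]]. *)
Definition skew_wt (v : wt) : mx2 :=
  (((None, v.1.1), v.2), (opp9 (conj9 v.2), (None, v.1.2))).
Definition wt_skew (A : mx2) : wt := ((A.1.1.2, A.2.2.2), A.1.2).

(* A basis of the totally isotropic plane spanned by eigenvectors of the 5-cycle. *)
Definition isob (k i : nat) : f9 :=
  dec9 (nth 0 (nth [::] [:: [:: 3; 8; 7; 7; 8]; [:: 0; 3; 4; 8; 6]] k) i)%N.

(* The matrix 1 + B^* A B, where the rows of B are the basis vectors isob and A
   is skew-Hermitian; these matrices form an elementary abelian group of order
   81, whose linear characters are the weights. *)
Definition root9m (v : wt) : mat9 :=
  let: ((a, b), (c, d)) := skew_wt v in
  mk9 (fun i j =>
    let x := conj9 (isob 0 i) in let y := conj9 (isob 1 i) in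
    let e := add9 (mul9 (add9 (mul9 x a) (mul9 y c)) (isob 0 j))
                  (mul9 (add9 (mul9 x b) (mul9 y d)) (isob 1 j)) in
    if i == j then add9 one9 e else e).

Definition act_wt (l : mx2) (v : wt) : wt :=
  wt_skew (mul2 (star2 l) (mul2 (skew_wt v) l)).

Definition unit_wts : seq wt :=
  [:: ((Some true, None), zero9); ((None, Some true), zero9);
      (zero9, (Some true, None)); (zero9, (None, Some true))].

(* The weight b' with dot_wt b' (act_wt l v) = dot_wt b v, given the inverse l' of l. *)
Definition dact_wt (l' : mx2) (b : wt) : wt :=
  let e k := dot_wt b (act_wt l' (nth zero_wt unit_wts k)) in
  ((e 0%N, e 1%N), (e 2%N, e 3%N)).

Definition mx2_of (a b c d : nat) : mx2 := ((dec9 a, dec9 b), (dec9 c, dec9 d)).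
(** The matrix l with B g = l B, where B has the rows [isob] and g is s1 or s2. *)
Definition gen2 (k : nat) : mx2 :=
  if k == 1%N then mx2_of 3 0 0 6 else mx2_of 8 4 3 4.
Definition word2 (w : seq nat) : mx2 := foldr (fun k => mul2 (gen2 k)) one2 w.

(* The ten elements of the dihedral group generated by s1 and s2. *)
Definition dwords : seq (seq nat) :=
  [seq w | w <- [seq rotword k | k <- iota 0 5] ++ [seq rotword k ++ [:: 1]%N | k <- iota 0 5]].
Definition dwords1 : seq (seq nat) := behead dwords.

(* It induces on the isotropic plane a Singer cycle of GL(2, 9). *)
Definition singerm : mat9 := mx9
  [:: [:: 5; 2; 3; 7; 6]; [:: 2; 4; 4; 0; 4]; [:: 3; 4; 1; 1; 5];
      [:: 7; 0; 1; 3; 0]; [:: 6; 4; 5; 0; 8]]%N.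
Definition singer2 : mx2 := mx2_of 0 4 3 3.
(** A Singer cycle of GL(2, 9) has order 80, so this power is its inverse. *)
Definition singer2V : mx2 := Eval vm_compute in
  iter 79 (mul2 singer2) one2.

(* Two elements of the unipotent radical of the stabiliser of the isotropic
   plane, whose centre is the group of the matrices root9m. *)
Definition xm : mat9 := mx9
  [:: [:: 3; 6; 8; 4; 3]; [:: 3; 0; 7; 2; 0]; [:: 5; 6; 7; 3; 1];
      [:: 7; 6; 0; 8; 8]; [:: 6; 6; 6; 6; 0]]%N.
Definition ym : mat9 := mx9
  [:: [:: 3; 1; 7; 5; 2]; [:: 1; 2; 4; 7; 3]; [:: 4; 0; 8; 3; 8];
      [:: 8; 2; 0; 7; 5]; [:: 2; 3; 1; 0; 1]]%N.

Definition b1 : wt := ((None, Some true), zero9).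
Definition v1 : wt := ((None, Some false), zero9).
Definition tauv : wt := ((Some false, Some false), (Some false, None)).

Definition acts_ok (g : mat9) (l l' : mx2) : bool :=
  let L := [seq (v, act_wt l v) | v <- all_wt] in
  [&& all (fun p => act_wt l' p.2 == p.1) L,
      all (fun p => mul9m (root9m p.1) g == mul9m g (root9m p.2)) L &
      all (fun b => let b' := dact_wt l' b in
        all (fun p => dot_wt b' p.2 == dot_wt b p.1) L) all_wt].

Lemma acts_dwords : all (fun w => acts_ok (word9m w) (word2 w) (word2 (rev w))) dwords.
Proof. by vm_compute. Qed.

Lemma acts_singer : acts_ok singerm singer2 singer2V.
Proof. by vm_compute. Qed.

Definition regular_wt (b : wt) : bool :=
  all (fun w => dact_wt (word2 (rev w)) b != b) dwords1.

Definition good_wt (b : wt) : bool := regular_wt b || (b == b1).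

(** The twentieth power of the Singer cycle is a scalar of norm 1 and acts trivially on weights, so
    twenty steps exhaust an orbit. *)
Lemma singer_good :
  all (fun b => (b == zero_wt) || has good_wt (traject (dact_wt singer2V) b 20)) all_wt.
Proof. by vm_compute. Qed.

Definition su9m (A : mat9) : bool := (mul9m A (star9m A) == one9m) && (det9 5 (get9 A) == one9).

Lemma root_su : all (fun v => su9m (root9m v)) all_wt.
Proof. by vm_compute. Qed.

Lemma root_add : all (fun v => all (fun w =>
  mul9m (root9m v) (root9m w) == root9m (add_wt v w)) all_wt) all_wt.
Proof. by vm_compute. Qed.

(** The involution t = s1 inverts x, and the commutator of x^2 and y is the root element of [v1],
    where the weight [b1] is nontrivial. The last clause places the transvection in the group of
    order 81. *)
Lemma rank1_check :
  let t := gen9m 1 in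
  [/\ all su9m [:: singerm; xm; ym],
      all (fun v => (mul9m (root9m v) xm == mul9m xm (root9m v)) &&
                    (mul9m (root9m v) ym == mul9m ym (root9m v))) all_wt,
      mul9m t (mul9m xm (mul9m t xm)) == one9m,
      mul9m (mul9m xm xm) ym == mul9m ym (mul9m (mul9m xm xm) (root9m v1)) &
      [&& dact_wt (gen2 1) b1 == b1, dot_wt b1 v1 != None & root9m tauv == taum]].
Proof. by vm_compute. Qed.

Lemma b1_stab : all (fun w => (dact_wt (word2 (rev w)) b1 == b1) == (w == [:: 1]%N)) dwords1.
Proof. by vm_compute. Qed.

Lemma dwords_uniq : uniq [seq word9m w | w <- dwords].
Proof. by vm_compute. Qed.

Lemma dot_wt_separates : all (fun b => all (fun b' =>
  (b == b') || has (fun v => dot_wt b v != dot_wt b' v) unit_wts) all_wt) all_wt.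
Proof. by vm_compute. Qed.

Lemma mem_all_wt v : v \in all_wt.
Proof. by case: v => a b; apply: allpairs_f; exact: mem_all9. Qed.

Lemma dact_one_check : all (fun b => dact_wt (word2 (rev [::])) b == b) all_wt.
Proof. by vm_compute. Qed.

(** * Vanishing of the nontrivial weight spaces *)

Section Weights.

Variables (F : finFieldType) (cardF : #|F| = 9%N) (char3 : 3%N \in [pchar F]).
Variable theta : {rmorphism F -> F}.
Hypothesis thetaE : forall x, theta x = x ^+ 3.
Variable im : F.
Hypothesis im2 : im * im = -1.
Variables (gT : finGroupType) (G : {group gT}) (M : gT -> 'M[F]_5).
Hypothesis M_mul : {in G &, forall x y, M (x * y)%g = M x *m M y}.
Hypothesis M_inj : {in G &, injective M}.
Hypothesis M_im : forall A, (exists2 x, x \in G & M x = A) <-> unitary theta A /\ \det A = 1.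
Variable s : nat -> gT.
Hypothesis sG : forall k, (k < 3)%N -> s k \in G.
Hypothesis sM : forall k, (k < 3)%N -> M (s k) = evm im (gen9m k).

Lemma su9_lift A : su9m A -> exists2 x, x \in G & M x = evm im A.
Proof.
move=> /andP[/eqP uA /eqP dA]; apply/M_im; split.
  by rewrite /unitary /adj -(evm_star thetaE im2) -(evm_mul char3 im2) uA evm1.
by rewrite (evm_det char3 im2) dA ev9_1.
Qed.

Variable root : wt -> gT.
Hypothesis zG : forall v, root v \in G.
Hypothesis zM : forall v, M (root v) = evm im (root9m v).

Lemma rootD v w : root (add_wt v w) = (root v * root w)%g.
Proof.
apply: M_inj; rewrite ?groupM // M_mul // !zM -(evm_mul char3 im2); congr evm.
by apply/esym/eqP; have /allP/(_ v (mem_all_wt v))/allP/(_ w (mem_all_wt w)) := root_add.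
Qed.

Lemma ev3_inj : injective (ev3 F).
Proof.
move=> x y e; have : ev9 im (x, None) = ev9 im (y, None) by rewrite /ev9 e.
by move/(ev9_inj char3 im2) => [].
Qed.

Lemma dot_wtDr b v w : dot_wt b (add_wt v w) = add3 (dot_wt b v) (dot_wt b w).
Proof. by apply: ev3_inj; rewrite /dot_wt /dot9 !(ev3D char3, ev3M) /=; ring. Qed.

Lemma dot_wtC b v : dot_wt b v = dot_wt v b.
Proof. by apply: ev3_inj; rewrite /dot_wt /dot9 !(ev3D char3, ev3M) /=; ring. Qed.

Lemma dot0_wt v : dot_wt zero_wt v = None.
Proof. by []. Qed.

Lemma add_wtK v : cancel (add_wt^~ v) (add_wt^~ (opp_wt v)).
Proof.
move=> [a b]; rewrite /add_wt /=; congr pair; apply: (ev9_inj char3 im2).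
  by rewrite !(ev9D char3) ev9N addrK.
by rewrite !(ev9D char3) ev9N addrK.
Qed.

Variable omega : algC.
Hypothesis omega_prim : 3.-primitive_root omega.

Definition w3 (x : f3) : algC :=
  if x is Some a then (if a then omega else omega ^+ 2) else 1.

Lemma w3D x y : w3 (add3 x y) = w3 x * w3 y.
Proof.
have o3 : omega ^+ 3 = 1 by exact: (prim_expr_order omega_prim).
by move: x y => [[]|] [[]|] /=; rewrite ?mulr1 ?mul1r //= -?exprSr -?exprS -?exprD // exprS o3 mulr1.
Qed.

Lemma w3_eq1 x : (w3 x == 1) = (x == None).
Proof.
have h k : (k < 3)%N -> (omega ^+ k == 1) = (k == 0)%N.
  by move=> hk; rewrite -(prim_order_dvd omega_prim) /dvdn modn_small.
by move: x => [[]|] /=; rewrite ?eqxx // -1?[omega]expr1 h.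
Qed.

(** Translating the sum by a v0 at which b and b' differ multiplies it by a number other than 1. *)
Lemma w3_orth b b' : b != b' ->
  \sum_(v : wt) w3 (add3 (dot_wt b v) (opp3 (dot_wt b' v))) = 0.
Proof.
move=> nb; set S := \sum_v _.
have /hasP[v0 _ hv0] : has (fun v => dot_wt b v != dot_wt b' v) unit_wts.
  have /allP/(_ b (mem_all_wt b))/allP/(_ b' (mem_all_wt b')) := dot_wt_separates.
  by rewrite (negPf nb).
pose c := w3 (add3 (dot_wt b v0) (opp3 (dot_wt b' v0))).
have nc : c != 1.
  rewrite /c w3_eq1; apply: contraNneq hv0 => e; apply/eqP/ev3_inj.
  by apply/eqP; rewrite -subr_eq0 -ev3N -(ev3D char3) e.
have e : S = c * S.
  rewrite {1}/S (reindex_inj (can_inj (add_wtK v0))) /= mulr_sumr.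
  apply: eq_bigr => v _; rewrite /c -w3D; congr w3; apply: ev3_inj.
  by rewrite !dot_wtDr !(ev3D char3, ev3N); ring.
have /eqP : (1 - c) * S = 0 by rewrite mulrBl mul1r -e subrr.
by rewrite mulf_eq0 subr_eq0 eq_sym (negPf nc) => /eqP.
Qed.

Section Representation.

Variables (n : nat) (rG : mx_representation algC G n).

(* 81 times the projector onto the isotypic component of the weight b. *)
Definition wproj (b : wt) : 'M[algC]_n := \sum_(v : wt) w3 (opp3 (dot_wt b v)) *: rG (root v).

Lemma wproj_root b v : wproj b *m rG (root v) = w3 (dot_wt b v) *: wproj b.
Proof.
rewrite /wproj mulmx_suml scaler_sumr [RHS](reindex_inj (can_inj (add_wtK v))) /=.
apply: eq_bigr => u _; rewrite -scalemxAl -repr_mxM // -rootD scalerA -w3D.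
congr (w3 _ *: _); apply: ev3_inj; rewrite dot_wtDr !(ev3N, ev3D char3); ring.
Qed.

Lemma wproj_orth b b' : b != b' -> wproj b *m wproj b' = 0.
Proof.
move=> nb; rewrite {2}/wproj mulmx_sumr.
rewrite -[RHS](scale0r (wproj b)) -(w3_orth nb) scaler_suml; apply: eq_bigr => v _.
by rewrite -scalemxAr wproj_root scalerA w3D mulrC.
Qed.

Lemma wproj_idem b : wproj b *m wproj b = 81%:R *: wproj b.
Proof.
rewrite {2}/wproj mulmx_sumr.
transitivity (\sum_(v : wt) wproj b); last first.
  rewrite sumr_const -scaler_nat; congr (_%:R *: _).
  by rewrite !card_prod !card_option card_bool.
apply: eq_bigr => v _; rewrite -scalemxAr wproj_root scalerA -w3D.
rewrite (_ : add3 _ _ = None) ?scale1r //; apply: ev3_inj.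
by rewrite (ev3D char3) ev3N addNr.
Qed.

Lemma root0 : root zero_wt = 1%g.
Proof. by apply: (mulgI (root zero_wt)); rewrite -rootD mulg1. Qed.

Lemma sum_wproj : \sum_(b : wt) wproj b = 81%:R%:M.
Proof.
rewrite exchange_big /= (bigD1 zero_wt) //= [X in _ + X]big1 ?addr0 => [|v nv].
  rewrite root0 repr_mx1.
  transitivity (\sum_(b : wt) (1%:M : 'M[algC]_n)); first by apply: eq_bigr => b _; rewrite dot_wtC scale1r.
  rewrite sumr_const -scaler_nat scalemx1 //; congr (_%:R%:M).
  by rewrite !card_prod !card_option card_bool.
rewrite -scaler_suml; set S := \sum_b _.
suff -> : S = 0 by rewrite scale0r.
rewrite eq_sym in nv; rewrite -(w3_orth nv).
by apply: eq_bigr => b _; rewrite dot0_wt dot_wtC.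
Qed.

Lemma wproj_act g gm l l' b : g \in G -> M g = evm im gm -> acts_ok gm l l' ->
  wproj b *m rG g = rG g *m wproj (dact_wt l' b).
Proof.
move=> Gg Mg /and3P[/allP hK /allP hc /allP hd].
have hv v : (v, act_wt l v) \in [seq (v, act_wt l v) | v <- all_wt].
  by apply: map_f; apply: mem_all_wt.
have inj_act : injective (act_wt l).
  by apply: (can_inj (g := act_wt l')) => v; apply/eqP; apply: (hK _ (hv v)).
rewrite /wproj mulmx_suml mulmx_sumr [RHS](reindex_inj inj_act) /=.
apply: eq_bigr => v _; rewrite -scalemxAl -scalemxAr -!repr_mxM //.
congr (w3 (opp3 _) *: rG _).
  by have /allP/(_ _ (hv v))/eqP := hd b (mem_all_wt b).
apply: M_inj; rewrite ?groupM // !M_mul // Mg !zM -!(evm_mul char3 im2); congr evm.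
by apply/eqP; apply: (hc _ (hv v)).
Qed.

Hypothesis sum_dihedral : \sum_(w <- dwords) rG (wordg s w) = 0.

Lemma dwords_lt w : w \in dwords -> all (fun k => k < 3)%N w.
Proof. by apply: allP. Qed.

Let wG w : w \in dwords -> wordg s w \in G.
Proof. by move=> /dwords_lt; exact: (wordg_in sG). Qed.
Let wM w : w \in dwords -> M (wordg s w) = evm im (word9m w).
Proof. by move=> /dwords_lt; exact: (wordgM char3 im2 M_mul M_im sG sM). Qed.

Lemma wproj_word b w : w \in dwords ->
  wproj b *m rG (wordg s w) = rG (wordg s w) *m wproj (dact_wt (word2 (rev w)) b).
Proof.
by move=> hw; apply: wproj_act (wG hw) (wM hw) _; apply: (allP acts_dwords).
Qed.

(* Sandwich the sum over the dihedral group between two copies of wproj b. *)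
Lemma sum_stab b : \sum_(w <- dwords | dact_wt (word2 (rev w)) b == b)
  rG (wordg s w) *m wproj b = 0.
Proof.
have h : \sum_(w <- dwords) wproj b *m rG (wordg s w) *m wproj b = 0.
  by rewrite -mulmx_suml -mulmx_sumr sum_dihedral mulmx0 mul0mx.
have : 81%:R *: (\sum_(w <- dwords | dact_wt (word2 (rev w)) b == b)
  rG (wordg s w) *m wproj b) = 0.
  rewrite -[RHS]h scaler_sumr big_mkcond /= [LHS]big_seq [RHS]big_seq.
  apply: eq_bigr => w hw.
  rewrite wproj_word // -mulmxA; case: eqVneq => [->|nb].
    by rewrite wproj_idem scalemxAr.
  by rewrite wproj_orth ?mulmx0.
by move/eqP; rewrite scaler_eq0 pnatr_eq0 => /eqP.
Qed.

Lemma dwordsE : dwords = [::] :: dwords1. Proof. by []. Qed.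

Lemma dact_one b : dact_wt (word2 (rev [::])) b = b.
Proof.
by apply/eqP; have /allP/(_ b (mem_all_wt b)) := dact_one_check.
Qed.

(** Only the identity fixes a regular weight, so a single term of [sum_stab] is left. *)
Lemma regular_wproj0 b : regular_wt b -> wproj b = 0.
Proof.
move=> /allP hb; have := sum_stab b; rewrite dwordsE big_cons dact_one eqxx big1_seq.
  by rewrite addr0 /= repr_mx1 mul1mx.
by move=> w /andP[h1 h2]; have := hb w h2; rewrite h1.
Qed.

(* Write P for wproj b1 and t for s1. Then P t = - P and t x t = x^-1 give
   P x^2 = P, and x^2 y = y x^2 root(v1) gives P y = w P y, where w <> 1 is the
   value of the weight b1 at v1. *)
Lemma b1_wproj0 : wproj b1 = 0.
Proof.
have [/and4P[_ su_x su_y _] /allP hxy hx hxy0 /and3P[/eqP dt hv1 _]] := rank1_check.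
have [x Gx Mx] := su9_lift su_x; have [y Gy My] := su9_lift su_y.
have comm g gm : g \in G -> M g = evm im gm ->
    (forall v, mul9m (root9m v) gm = mul9m gm (root9m v)) ->
    wproj b1 *m rG g = rG g *m wproj b1.
  move=> Gg Mg hg; rewrite /wproj mulmx_suml mulmx_sumr; apply: eq_bigr => v _.
  rewrite -scalemxAl -scalemxAr -(repr_mxM rG (zG v) Gg) -(repr_mxM rG Gg (zG v)).
  have -> // : (root v * g = g * root v)%g.
  apply: M_inj; [exact: groupM | exact: groupM |].
  rewrite (M_mul (zG v) Gg) (M_mul Gg (zG v)) Mg zM -!(evm_mul char3 im2).
  by congr evm; exact: hg.
have cx : wproj b1 *m rG x = rG x *m wproj b1.
  apply: (comm _ _ Gx Mx) => v; apply/eqP.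
  by have /andP[] := hxy v (mem_all_wt v).
have cy : wproj b1 *m rG y = rG y *m wproj b1.
  apply: (comm _ _ Gy My) => v; apply/eqP.
  by have /andP[] := hxy v (mem_all_wt v).
pose t := s 1; have Gt : t \in G by apply: sG.
have t_word : wordg s [:: 1%N] = t by rewrite /= mulg1.
have d1 : [:: 1%N] \in dwords by vm_compute.
have ct : wproj b1 *m rG t = rG t *m wproj b1.
  by rewrite -t_word wproj_word //= dt.
have et : rG t *m wproj b1 = - wproj b1.
  have := sum_stab b1; rewrite dwordsE big_cons dact_one eqxx.
  have hs := allP b1_stab; rewrite -big_filter.
  have -> : [seq w <- dwords1 | dact_wt (word2 (rev w)) b1 == b1] = [:: [:: 1%N]].
    rewrite (eq_in_filter (a2 := pred1 [:: 1%N])) => [|w hw]; last by rewrite (eqP (hs w hw)).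
    by vm_compute.
  rewrite big_seq1 t_word repr_mx1 mul1mx => /eqP.
  by rewrite addrC addr_eq0 => /eqP.
have Et : wproj b1 *m rG t = - wproj b1 by rewrite ct.
have Mt : M t = evm im (gen9m 1) by exact: sM.
have Gtx := groupM Gt Gx; have Gxtx := groupM Gx Gtx; have Gxx := groupM Gx Gx.
have Gxxr := groupM Gxx (zG v1).
have xtx : (t * (x * (t * x)))%g = 1%g.
  apply: M_inj; [exact: (groupM Gt Gxtx) | exact: group1 |].
  rewrite (M_mul Gt Gxtx) (M_mul Gx Gtx) (M_mul Gt Gx) (M1 M_mul M_im) Mx Mt.
  by rewrite -!(evm_mul char3 im2) (eqP hx) evm1.
have Exx : wproj b1 *m rG (x * x)%g = wproj b1.
  rewrite -[RHS]mulmx1 -(repr_mx1 rG) -xtx (repr_mxM rG Gt Gxtx) (repr_mxM rG Gx Gtx).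
  rewrite (repr_mxM rG Gt Gx) (repr_mxM rG Gx Gx).
  rewrite [RHS]mulmxA Et mulNmx [wproj b1 *m (rG x *m (rG t *m rG x))]mulmxA cx.
  rewrite -(mulmxA (rG x)) [wproj b1 *m (rG t *m rG x)]mulmxA Et mulNmx mulmxN opprK.
  by rewrite !mulmxA -cx.
have xxy : (x * x * y = y * (x * x * root v1))%g.
  apply: M_inj; [exact: (groupM Gxx Gy) | exact: (groupM Gy Gxxr) |].
  rewrite (M_mul Gxx Gy) (M_mul Gx Gx) (M_mul Gy Gxxr) (M_mul Gxx (zG v1)) (M_mul Gx Gx).
  by rewrite Mx My zM -!(evm_mul char3 im2) (eqP hxy0).
have EY : wproj b1 *m rG y = w3 (dot_wt b1 v1) *: (wproj b1 *m rG y).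
  rewrite -{1}Exx -mulmxA -(repr_mxM rG Gxx Gy) xxy (repr_mxM rG Gy Gxxr).
  rewrite (repr_mxM rG Gxx (zG v1)) !mulmxA cy.
  rewrite -!mulmxA (mulmxA (wproj b1) (rG (x * x)%g)) Exx.
  by rewrite wproj_root scalemxAr.
have Ey0 : wproj b1 *m rG y = 0.
  have /eqP : (1 - w3 (dot_wt b1 v1)) *: (wproj b1 *m rG y) = 0.
    by rewrite scalerBl scale1r -EY subrr.
  by rewrite scaler_eq0 subr_eq0 eq_sym w3_eq1 (negPf hv1) => /eqP.
by rewrite -[wproj b1](mulmxK (repr_mx_unit rG Gy)) Ey0 mul0mx.
Qed.

Lemma wproj0 b : b != zero_wt -> wproj b = 0.
Proof.
have [/and4P[su_s _ _ _] _ _ _ _] := rank1_check.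
have [g Gg Mg] := su9_lift su_s => nb.
have /orP[/eqP b0|/hasP[c /trajectP[k _ ->] hgood]] := allP singer_good b (mem_all_wt b).
  by rewrite b0 eqxx in nb.
have h0 c' : good_wt c' -> wproj c' = 0.
  by move=> /orP[/regular_wproj0 //|/eqP->]; exact: b1_wproj0.
elim: k b {nb} hgood => [|k IH] b; first exact: h0.
rewrite iterSr => /IH h.
have := wproj_act b Gg Mg acts_singer; rewrite h mulmx0 => e.
by rewrite -[wproj b](mulmxK (repr_mx_unit rG Gg)) e mul0mx.
Qed.

Lemma root_trivial v : rG (root v) = 1%:M.
Proof.
have e : wproj zero_wt = 81%:R%:M.
  by rewrite -sum_wproj (bigD1 zero_wt) //= [X in _ + X]big1 ?addr0 // => b /wproj0.
have := wproj_root zero_wt v; rewrite dot0_wt scale1r e => h.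
apply: (scalerI (a := 81%:R)); first by rewrite pnatr_eq0.
by rewrite -mul_scalar_mx h scalemx1.
Qed.

End Representation.
End Weights.

(** * The string C-group of type {5, 5} *)

Section Idempotent.

Variable F : fieldType.

(** In a rank factorisation e = C R, cancelling C on the left and R on the right in e e = e gives R
    C = 1, of size the rank. *)
Lemma mxtrace_idempotent n (e : 'M[F]_n) : e *m e = e -> \tr e = (\rank e)%:R.
Proof.
move=> ee; rewrite -{1}[e]mulmx_base mxtrace_mulC.
suff -> : row_base e *m col_base e = 1%:M by rewrite mxtrace1.
apply: (row_full_inj (col_base_full e)); apply: (row_free_inj (row_base_free e)).
by rewrite mulmx1 mulmx_base mulmxA mulmx_base -mulmxA mulmx_base.
Qed.

End Idempotent.

Section Involutions.

Variables (gT : finGroupType) (x y : gT).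
Hypotheses (ox : #[x]%g = 2%N) (oy : #[y]%g = 2%N).

(** Oddness of k makes the orders of [<[x * y]>] and [<[x]>] coprime, so their product has order 2
    k. *)
Lemma card_involutions_odd k : #[x * y]%g = k -> odd k ->
  #|<<[set x; y]>>%g| = (2 * k)%N.
Proof.
move=> oxy hk; have xx : (x * x = 1)%g by rewrite -expg2 -ox expg_order.
have yy : (y * y = 1)%g by rewrite -expg2 -oy expg_order.
have nx : <[x]>%g \subset 'N(<[x * y]>)%g.
  rewrite cycle_subG; apply/normP; rewrite -cycleJ.
  have -> : ((x * y) ^ x = (x * y)^-1)%g.
    rewrite conjgE invMg !mulgA (mulVg x) mul1g; congr (_ * _)%g.
      by apply/eqP; rewrite eq_sym eq_invg_mul yy.
    by apply/eqP; rewrite eq_sym eq_invg_mul xx.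
  by rewrite cycleV.
have -> : <<[set x; y]>>%g = (<[x * y]> * <[x]>)%g.
  rewrite -norm_joinEr //; apply/eqP; rewrite eqEsubset; apply/andP; split.
    rewrite gen_subG; apply/subsetP=> z; rewrite !inE => /orP[]/eqP->.
      by rewrite mem_gen // inE cycle_id orbT.
    have {1}-> : (y = x * (x * y))%g by rewrite mulgA xx mul1g.
    by rewrite groupM // mem_gen // inE cycle_id ?orbT.
  rewrite join_subG !cycle_subG groupM ?mem_gen // !inE ?eqxx ?orbT //.
rewrite coprime_cardMg -?orderE ?oxy ?ox ?coprimen2 // mulnC.
by [].
Qed.

Lemma card_involutions_commute : x != y -> ((x * y) ^+ 2 = 1)%g -> #|<<[set x; y]>>%g| = 4%N.
Proof.
move=> nxy xy2.
have xx : (x * x = 1)%g by rewrite -expg2 -ox expg_order.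
have yy : (y * y = 1)%g by rewrite -expg2 -oy expg_order.
have cxy : commute x y.
  have ix : (x^-1 = x)%g by apply/eqP; rewrite eq_invg_mul xx.
  have iy : (y^-1 = y)%g by apply/eqP; rewrite eq_invg_mul yy.
  by have /eqP := xy2; rewrite expg2 -eq_invg_mul invMg ix iy eq_sym => /eqP.
have -> : <<[set x; y]>>%g = (<[x]> * <[y]>)%g.
  rewrite -norm_joinEr; last by rewrite cents_norm // cent_cycle cycle_subG; apply/cent1P/commute_sym.
  apply/eqP; rewrite eqEsubset; apply/andP; split.
    by rewrite gen_subG; apply/subsetP=> z; rewrite !inE => /orP[]/eqP->;
      rewrite mem_gen // inE cycle_id ?orbT.
  by rewrite join_subG !cycle_subG !mem_gen // !inE ?eqxx ?orbT.
rewrite TI_cardMg -?orderE ?ox ?oy //; apply/trivgP/subsetP=> z.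
rewrite !inE => /andP[/cycleP[i ->] /cycleP[j]].
rewrite -(expg_mod i (_ : x ^+ 2 = 1)%g) ?expg2 // -(expg_mod j (_ : y ^+ 2 = 1)%g) ?expg2 //.
have := ltn_pmod i (isT : (0 < 2)%N); have := ltn_pmod j (isT : (0 < 2)%N).
case: (i %% 2)%N => [|[|//]]; case: (j %% 2)%N => [|[|//]] _ _; rewrite ?expg0 ?expg1 //.
  by move=> e; rewrite e.
by move=> e; rewrite e eqxx in nxy.
Qed.

End Involutions.

(** * The intersection condition *)

Section StringGroup.

Variables (gT : finGroupType) (G : {group gT}) (S : {set gT}).
Hypothesis inv_S : {in S, forall x, #[x]%g = 2%N}.
Hypothesis S3 : forall x y z t, x \in S -> y \in S -> z \in S -> t \in S ->
  x != y -> x != z -> y != z -> [|| t == x, t == y | t == z].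
Hypothesis third : forall x y, x \in S -> y \in S -> x != y ->
  exists2 z, z \in S & (x != z) && (y != z).
Hypothesis gen_S : <<S>>%g = G.
Hypothesis card_pair : {in S &, forall x y, x != y -> #|<<[set x; y]>>%g| \in [:: 4; 10]%N}.
Hypothesis three_G : (3 %| #|G|)%N.

Lemma pair_notin x y z : x \in S -> y \in S -> z \in S ->
  x != y -> x != z -> y != z -> x \notin <<[set y; z]>>%g.
Proof.
move=> Sx Sy Sz nxy nxz nyz; apply/negP=> hx.
suff e : G = <<[set y; z]>>%G.
  by have := card_pair Sy Sz nyz; move: three_G; rewrite e /= !inE => h /orP[]/eqP e'; rewrite e' in h.
apply/group_inj/eqP; rewrite eqEsubset /= -gen_S !gen_subG; apply/andP; split; apply/subsetP=> t.
  by move=> St; have /or3P[] := S3 Sx Sy Sz St nxy nxz nyz => /eqP-> //; rewrite mem_gen // !inE eqxx ?orbT.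
by rewrite !inE => /orP[]/eqP->; rewrite mem_gen.
Qed.

(** The order of the intersection is even, as z lies in it, and a proper divisor of 4 or 10, as x
    does not; only 2 remains. *)
Lemma pair_capI x y z : x \in S -> y \in S -> z \in S ->
  x != y -> x != z -> y != z -> (<<[set x; z]>> :&: <<[set y; z]>> = <[z]>)%g.
Proof.
move=> Sx Sy Sz nxy nxz nyz; apply/esym/eqP.
have sz : (<[z]> \subset <<[set x; z]>> :&: <<[set y; z]>>)%g.
  by rewrite cycle_subG !inE !mem_gen ?inE ?eqxx ?orbT.
rewrite eqEcard sz -orderE inv_S //=.
have h2 := cardSg sz; rewrite -orderE inv_S // in h2.
have := cardSg (subsetIl <<[set x; z]>>%G <<[set y; z]>>%G).
have : #|(<<[set x; z]>> :&: <<[set y; z]>>)%g| != #|<<[set x; z]>>%g|.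
  apply: contra (pair_notin Sx Sy Sz nxy nxz nyz) => /eqP e.
  have /eqP e2 : (<<[set x; z]>> :&: <<[set y; z]>> == <<[set x; z]>>)%g.
    by rewrite eqEcard subsetIl e /=.
  have : x \in (<<[set x; z]>> :&: <<[set y; z]>>)%g.
    by rewrite e2 mem_gen // !inE eqxx.
  by rewrite inE => /andP[].
move: h2; set c := #|_ :&: _|.
have := card_pair Sx Sz nxz; rewrite !inE => /orP[]/eqP-> h2 nc hc.
  have := dvdn_leq (isT : (0 < 4)%N) hc; move: h2 nc hc.
  by move: c => [|[|[|[|[|]]]]].
have := dvdn_leq (isT : (0 < 10)%N) hc; move: h2 nc hc.
by move: c => [|[|[|[|[|[|[|[|[|[|[|]]]]]]]]]]].
Qed.

(* Only orders are used: two generators generate a group of order 4 or 10, hence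
   never all of G, whose order is a multiple of 3. *)
Lemma intersection_condition (I J : {set gT}) : I \subset S -> J \subset S ->
  (<<I>> :&: <<J>> = <<I :&: J>>)%g.
Proof.
move=> sI sJ; apply/eqP; rewrite eqEsubset andbC subsetI !genS ?subsetIl ?subsetIr //=.
have [sIJ|/subsetPn[x Ix nJx]] := boolP (I \subset J).
  by rewrite (setIidPl sIJ) subsetIl.
have [sJI|/subsetPn[y Jy nIy]] := boolP (J \subset I).
  by rewrite (setIidPr sJI) subsetIr.
have Sx := subsetP sI _ Ix; have Sy := subsetP sJ _ Jy.
have nxy : x != y by apply: contraNneq nIy => <-.
have [z Sz /andP[nxz nyz]] := third Sx Sy nxy.
have sIz : I \subset [set x; z].
  apply/subsetP=> t It; rewrite !inE.
  have /or3P[-> //|/eqP e|->] := S3 Sx Sy Sz (subsetP sI _ It) nxy nxz nyz; last exact: orbT.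
  by rewrite e (negPf nIy) in It.
have sJz : J \subset [set y; z].
  apply/subsetP=> t Jt; rewrite !inE.
  have /or3P[/eqP e|-> //|->] := S3 Sx Sy Sz (subsetP sJ _ Jt) nxy nxz nyz; last exact: orbT.
  by rewrite e (negPf nJx) in Jt.
have sP : (<<I>> :&: <<J>> \subset <[z]>)%g.
  by rewrite -(pair_capI Sx Sy Sz) // setISS ?genS.
have zz : #[z]%g = 2%N by exact: inv_S.
have cyc1 t u : t \in S -> u \in S -> t != u -> u \notin <[t]>%g.
  move=> St Su ntu; apply/negP=> /cycleP[k ek].
  have : (u == t) || (u == 1)%g.
    rewrite ek -(expg_mod k (_ : t ^+ 2 = 1)%g); last by rewrite -(inv_S St) expg_order.
    by have := ltn_pmod k (isT : (0 < 2)%N); case: (k %% 2)%N => [|[|//]]; rewrite ?expg0 ?expg1 eqxx ?orbT.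
  rewrite eq_sym (negPf ntu) /= => /eqP u1.
  by have := inv_S Su; rewrite u1 order1.
have sub1 t (K : {set gT}) : t \in S -> t != z -> K \subset [set t; z] -> z \notin K ->
    (<<K>> :&: <[z]> = 1)%g.
  move=> St ntz sK nzK; apply/trivgP/subsetP=> g; rewrite !inE => /andP[gK /cycleP[k ek]].
  have : (g == z) || (g == 1)%g.
    rewrite ek -(expg_mod k (_ : z ^+ 2 = 1)%g); last by rewrite -zz expg_order.
    by have := ltn_pmod k (isT : (0 < 2)%N); case: (k %% 2)%N => [|[|//]]; rewrite ?expg0 ?expg1 eqxx ?orbT.
  move=> /orP[/eqP gz|//]; case/negP: (cyc1 t z St Sz ntz); rewrite -gz.
  apply: subsetP gK; rewrite gen_subG; apply/subsetP=> u Ku.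
  have := subsetP sK _ Ku; rewrite !inE => /orP[/eqP->|/eqP e]; first exact: cycle_id.
  by rewrite -e Ku in nzK.
have [zI|nzI] := boolP (z \in I); last first.
  apply: subset_trans (sub1G _); rewrite -(sub1 x I) // subsetI subsetIl.
  exact: subset_trans sP _.
have [zJ|nzJ] := boolP (z \in J); last first.
  apply: subset_trans (sub1G _); rewrite -(sub1 y J) // subsetI subsetIr.
  exact: subset_trans sP _.
by apply: subset_trans sP _; rewrite cycle_subG mem_gen // inE zI.
Qed.

End StringGroup.

(** * The generators and the polytopal characters *)

Section Polytope.

Variables (F : finFieldType) (cardF : #|F| = 9%N) (char3 : 3%N \in [pchar F]).
Variable theta : {rmorphism F -> F}.
Hypothesis thetaE : forall x, theta x = x ^+ 3.
Variables (gT : finGroupType) (G : {group gT}) (M : gT -> 'M[F]_5).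
Hypothesis M_mul : {in G &, forall x y, M (x * y)%g = M x *m M y}.
Hypothesis M_inj : {in G &, injective M}.
Hypothesis M_im : forall A, (exists2 x, x \in G & M x = A) <-> unitary theta A /\ \det A = 1.

Section Generators.
Variable im : F.
Hypothesis im2 : im * im = -1.
Variable s : nat -> gT.
Hypothesis sG : forall k, (k < 3)%N -> s k \in G.
Hypothesis sM : forall k, (k < 3)%N -> M (s k) = evm im (gen9m k).
Local Notation s3 := (fun i : 'I_3 => s i).

Let M1 : M 1%g = 1%:M := M1 M_mul M_im.

Lemma word9m_mk w : mk9 (get9 (word9m w)) = word9m w.
Proof.
case: w => [|k w]; first by [].
rewrite {2}/word9m /=; apply/eq_in_map => i; rewrite mem_iota => hi.
by apply/eq_in_map => j; rewrite mem_iota => hj; rewrite get_mk9.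
Qed.

Let wG w : all (fun k => k < 3)%N w -> wordg s w \in G.
Proof. exact: (wordg_in sG). Qed.
Let wM w : all (fun k => k < 3)%N w -> M (wordg s w) = evm im (word9m w).
Proof. exact: (wordgM char3 im2 M_mul M_im sG sM). Qed.

Lemma wordg_inj w w' : all (fun k => k < 3)%N w -> all (fun k => k < 3)%N w' ->
  wordg s w = wordg s w' -> word9m w = word9m w'.
Proof.
move=> hw hw' e; rewrite -word9m_mk -(word9m_mk w').
by apply: (evm_inj char3 im2); rewrite -!wM // e.
Qed.

Lemma wordg_eq w w' : all (fun k => k < 3)%N w -> all (fun k => k < 3)%N w' ->
  word9m w = word9m w' -> wordg s w = wordg s w'.
Proof. by move=> hw hw' e; apply: M_inj; rewrite ?wG // !wM // e. Qed.

(** For a prime p two matrix tests settle the order; all orders in [order_table] are prime. *)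
Lemma order_word w (p : nat) : prime p -> all (fun k => k < 3)%N w ->
  word9m (flatten (nseq p w)) == one9m -> word9m w != one9m -> #[wordg s w]%g = p.
Proof.
move=> pp hw /eqP e ne; apply: nt_prime_order => //.
  have -> : (wordg s w ^+ p = wordg s (flatten (nseq p w)))%g.
    by elim: p {pp e} => [|p IH] //=; rewrite expgS IH wordg_cat.
  have hf : all (fun k => k < 3)%N (flatten (nseq p w)).
    by elim: p {pp e} => [|p IH] //=; rewrite all_cat hw.
  by rewrite (wordg_eq (w' := [::]) hf).
by apply: contraNneq ne => e1; apply/eqP/(wordg_inj (w' := [::]) hw).
Qed.

Definition order_table : seq (seq nat * nat) :=
  [:: ([:: 0], 2); ([:: 1], 2); ([:: 2], 2); ([:: 0; 1], 5); ([:: 1; 2], 5);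
      ([:: 0; 2], 2); (rev tau_word ++ tau0_word ++ tau_word, 3)]%N.

Lemma order_table_check :
  all (fun wp => [&& prime wp.2, all (fun k => k < 3)%N wp.1,
     word9m (flatten (nseq wp.2 wp.1)) == one9m & word9m wp.1 != one9m]) order_table.
Proof. by vm_compute. Qed.

Lemma order_tableP w p : (w, p) \in order_table -> #[wordg s w]%g = p.
Proof. by move/(allP order_table_check) => /and4P[]; apply: order_word. Qed.

Lemma order_gens k : (k < 3)%N -> #[s k]%g = 2%N.
Proof.
move=> hk; rewrite -[s k]mulg1 -[(_ * _)%g]/(wordg s [:: k]); apply: order_tableP.
by move: k hk => [|[|[|]]].
Qed.

Lemma order_s01 : #[s 0 * s 1]%g = 5%N.
Proof. by rewrite -[s 1]mulg1; apply: (@order_tableP [:: 0; 1]%N). Qed.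

Lemma order_s12 : #[s 1 * s 2]%g = 5%N.
Proof. by rewrite -[s 2]mulg1; apply: (@order_tableP [:: 1; 2]%N). Qed.

Lemma order_s02 : #[s 0 * s 2]%g = 2%N.
Proof. by rewrite -[s 2]mulg1; apply: (@order_tableP [:: 0; 2]%N). Qed.

Lemma s02_sqr : ((s 0 * s 2) ^+ 2 = 1)%g.
Proof. by have := expg_order (s 0 * s 2)%g; rewrite order_s02. Qed.

Definition tauw := (rev tau_word ++ tau0_word ++ tau_word)%SEQ.

Lemma tauw_lt : all (fun k => k < 3)%N tauw. Proof. by []. Qed.

Lemma three_dvd_card : (3 %| #|G|)%N.
Proof.
have <- : #[wordg s tauw]%g = 3%N by apply: order_tableP; rewrite !inE eqxx !orbT.
by rewrite order_dvdG ?wG ?tauw_lt.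
Qed.

Lemma M_tau : M (wordg s tauw) = evm im taum.
Proof.
rewrite wM; last exact: tauw_lt.
have /and5P[/eqP <- _ _ _ _] := tau_word_check; congr evm.
Qed.

Lemma gens_inj i j : (i < 3)%N -> (j < 3)%N -> s i = s j -> i = j.
Proof.
move=> hi hj e.
have : word9m [:: i] = word9m [:: j].
  by apply: wordg_inj; rewrite /= ?hi ?hj // e.
have h : uniq [seq word9m [:: i] | i <- iota 0 3] by vm_compute.
move=> e'; apply/eqP; rewrite -(nth_uniq one9m _ _ h) ?size_map ?size_iota //.
by rewrite !(nth_map 0%N) ?size_iota // !nth_iota // !add0n e'.
Qed.

Lemma generators_generate : <<generators s3>>%g = G.
Proof.
have sS : <<generators s3>>%g \subset G.
  by rewrite gen_subG; apply/subsetP=> x /imsetP[i _ ->]; apply: sG.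
have mS k : (k < 3)%N -> s k \in <<generators s3>>%g.
  by move=> hk; apply: mem_gen; apply/imsetP; exists (Ordinal hk).
have tD : wordg s tauw \in <<generators s3>>%G.
  elim: (tauw) tauw_lt => [|k w IH] //= /andP[hk hw].
  by rewrite groupM ?mS ?IH.
have e := @transvection_generate F cardF char3 theta thetaE im im2 gT G M M_mul M_inj M_im
  s sG sM <<generators s3>>%G (wordg s tauw) sS tD M_tau.
apply: (congr1 (@gval gT)); apply: e => k hk; apply: (subsetP (normG _)); exact: mS.
Qed.

Lemma card_pairs : {in generators s3 &, forall x y, x != y -> #|<<[set x; y]>>%g| \in [:: 4; 10]%N}.
Proof.
have c01 : #|<<[set s 0; s 1]>>%g| = 10%N.
  by rewrite (card_involutions_odd (order_gens (isT : (0 < 3)%N)) (order_gens (isT : (1 < 3)%N)) order_s01).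
have c12 : #|<<[set s 1; s 2]>>%g| = 10%N.
  by rewrite (card_involutions_odd (order_gens (isT : (1 < 3)%N)) (order_gens (isT : (2 < 3)%N)) order_s12).
have c02 : #|<<[set s 0; s 2]>>%g| = 4%N.
  rewrite (card_involutions_commute (order_gens (isT : (0 < 3)%N)) (order_gens (isT : (2 < 3)%N))) //.
    by apply/eqP => /gens_inj; move=> /(_ isT isT).
  exact: s02_sqr.
move=> _ _ /imsetP[[[|[|[|//]]] hi] _ ->] /imsetP[[[|[|[|//]]] hj] _ ->] /=;
  rewrite ?eqxx // => _; rewrite ?(setUC [set s 1] [set s 0]) ?(setUC [set s 2]) ?c01 ?c02 ?c12 //.
Qed.

Lemma string_C_group_gens : string_C_group G s3.
Proof.
have hinj : injective s3 by move=> i j /gens_inj h; apply/val_inj/h.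
split => //.
- by move=> i; apply: order_gens.
- exact: generators_generate.
- move=> [[|[|[|//]]] hi] [[|[|[|//]]] hj] //= _; first exact: s02_sqr.
  have c : commute (s 0) (s 2).
    have s0s := gens_sqr char3 im2 M_mul M_inj M_im sG sM.
    have /eqP := s02_sqr; rewrite expg2 -eq_invg_mul invMg => /eqP.
    have iv k : (k < 3)%N -> ((s k)^-1 = s k)%g by move=> hk; apply/eqP; rewrite eq_invg_mul s0s.
    by rewrite !iv.
  by rewrite -c s02_sqr.
- have gS : <<generators s3>>%g = G by exact: generators_generate.
  apply: (intersection_condition _ _ _ gS card_pairs three_dvd_card).
  + by move=> _ /imsetP[i _ ->]; apply: order_gens.
  + move=> _ _ _ _ /imsetP[i _ ->] /imsetP[j _ ->] /imsetP[k _ ->] /imsetP[t _ ->].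
    rewrite !(inj_eq hinj); clear; move: i j k t.
    by move=> [[|[|[|//]]] hi] [[|[|[|//]]] hj] [[|[|[|//]]] hk] [[|[|[|//]]] ht].
  + move=> _ _ /imsetP[i _ ->] /imsetP[j _ ->]; rewrite (inj_eq hinj) => nij.
    have [k /andP[nik njk]] : exists k : 'I_3, (i != k) && (j != k).
      by move: i j nij => [[|[|[|//]]] hi] [[|[|[|//]]] hj] // _;
        first [by exists (inord 0); rewrite -!val_eqE /= inordK | by exists (inord 1); rewrite -!val_eqE /= inordK
              | by exists (inord 2); rewrite -!val_eqE /= inordK].
    by exists (s k); [apply/imsetP; exists k | rewrite !(inj_eq hinj) nik].
Qed.

Lemma schlafli_gens : schlafli_type s3 = [:: 5; 5]%N.
Proof.
have -> : schlafli_type s3 = [seq #[s i * s i.+1]%g | i <- iota 0 2].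
  rewrite -val_enum_ord -map_comp; apply: eq_map => i /=.
  by rewrite /= /bump leq0n add1n.
by rewrite /= order_s01 order_s12.
Qed.

Lemma mem_dihedral w : w \in dwords -> wordg s w \in <<[set s 1; s 2]>>%g.
Proof.
move=> hw; have : all (fun k => (k == 1) || (k == 2))%N w.
  by move: w hw; apply/allP.
elim: w {hw} => [|k w IH] /=; first by rewrite group1.
move=> /andP[hk hw]; rewrite groupM ?IH // mem_gen // !inE.
by case/orP: hk => /eqP->; rewrite eqxx ?orbT.
Qed.

Lemma big_dihedral (R : Type) (idx : R) (op : Monoid.com_law idx) (f : gT -> R) :
  \big[op/idx]_(h in <<[set s 1; s 2]>>%g) f h = \big[op/idx]_(w <- dwords) f (wordg s w).
Proof.
have uw : uniq [seq wordg s w | w <- dwords].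
  apply: (map_uniq (f := M)); rewrite -map_comp.
  rewrite (eq_in_map _ (evm im \o word9m) _).1 => [|w /dwords_lt hw]; last by rewrite /= wM.
  rewrite map_comp map_inj_in_uniq ?dwords_uniq //.
  move=> _ _ /mapP[w _ ->] /mapP[w' _ ->] e; rewrite -word9m_mk -(word9m_mk w').
  exact: (evm_inj char3 im2).
rewrite -big_enum -(big_map (wordg s) xpredT f); apply: perm_big.
apply: uniq_perm; rewrite ?enum_uniq // => h.
have sub : {subset [seq wordg s w | w <- dwords] <= enum <<[set s 1; s 2]>>%g}.
  by move=> _ /mapP[w hw ->]; rewrite mem_enum mem_dihedral.
have sz : (size (enum <<[set s 1; s 2]>>%g) <= size [seq wordg s w | w <- dwords])%N.
  rewrite -cardE size_map.
  by rewrite (card_involutions_odd (order_gens (isT : (1 < 3)%N)) (order_gens (isT : (2 < 3)%N)) order_s12).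
by have [_ ->] := uniq_min_size uw sub sz.
Qed.

Lemma vertex_stabilizer_gens : vertex_stabilizer s3 = <<[set s 1; s 2]>>%G.
Proof.
apply: val_inj => /=; congr <<_>>%g; apply/setP=> x; rewrite !inE; apply/imsetP/orP.
  by move=> [[[|[|[|//]]] hi]]; rewrite inE //= => _ ->; [left|right].
by case=> /eqP->; [exists (inord 1)|exists (inord 2)]; rewrite ?inE -?val_eqE /= inordK.
Qed.

Lemma fixed_vector n (rG : mx_representation algC G n) : (0 < n)%N ->
  \sum_(w <- dwords) rG (wordg s w) != 0.
Proof.
move=> n0; apply/eqP=> h.
have [omega homega] := C_prim_root_exists (isT : (0 < 3)%N).
have lift v : exists x, (x \in G) && (M x == evm im (root9m v)).
  have /(su9_lift char3 thetaE im2 M_im)[x Gx /eqP Mx] := allP root_su v (mem_all_wt v).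
  by exists x; rewrite Gx.
pose root v := xchoose (lift v).
have rootG v : root v \in G by case/andP: (xchooseP (lift v)).
have rootM v : M (root v) = evm im (root9m v) by apply/eqP; case/andP: (xchooseP (lift v)).
have triv := root_trivial char3 thetaE im2 M_mul M_inj M_im sG sM rootG rootM homega h tauv.
have kerG : rker rG = G.
  apply: (congr1 (@gval gT)).
  apply: (@transvection_generate F cardF char3 theta thetaE im im2 gT G M M_mul M_inj M_im
    s sG sM (rker_group rG) (root tauv)).
  - by apply: normal_sub; exact: rker_normal.
  - by rewrite !inE rootG triv mul1mx eqxx.
  - by have [_ _ _ _ /and3P[_ _ /eqP <-]] := rank1_check.
  - by move=> k hk; apply: (subsetP (normal_norm (rker_normal rG))); exact: sG.
have : \sum_(w <- dwords) rG (wordg s w) = 10%:R%:M.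
  rewrite big_seq (eq_bigr (fun=> 1%:M)) => [|w hw]; last first.
    have : wordg s w \in rker rG by rewrite kerG wG ?dwords_lt.
    by move/rkerP=> [].
  by rewrite -big_seq big_const_seq count_predT iter_addr_0 -[RHS]scalemx1 scaler_nat.
rewrite h => /matrixP/(_ (Ordinal n0) (Ordinal n0)) /eqP.
by rewrite !mxE eqxx eq_sym pnatr_eq0.
Qed.

(** By Frobenius reciprocity the multiplicity is the trace of the idempotent S / |H|, hence its
    rank. If it were 0, then S = 0, contrary to [fixed_vector]. *)
Lemma all_polytopal (i : Iirr G) : i != 0 -> polytopal s3 i.
Proof.
move=> ni; split=> //; rewrite irr_consttE vertex_stabilizer_gens.
set H := <<[set s 1; s 2]>>%G.
have sHG : H \subset G by rewrite gen_subG; apply/subsetP=> x; rewrite !inE => /orP[]/eqP->; exact: sG.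
rewrite -cfdot_Res_r; apply/negP => /eqP h.
pose rG := 'Chi_i; pose S := \sum_(x in H) rG x.
have GH x : x \in H -> x \in G by apply: subsetP.
have trS : \tr S = 0.
  have : \sum_(x in H) 'chi_i x = 0.
    move: h; rewrite cfdotC => /eqP; rewrite conjC_eq0 cfdotE mulf_eq0 invr_eq0.
    rewrite (negPf (neq0CG H)) /= => /eqP h; rewrite -[RHS]h; apply: eq_bigr => x Hx.
    by rewrite cfResE // cfun1E Hx rmorph1 mulr1.
  move=> hs; rewrite -[RHS]hs raddf_sum; apply: eq_bigr => x Hx.
  by rewrite -irrRepr cfunE GH // mulr1n.
have SS : S *m S = #|H|%:R *: S.
  rewrite {1}/S mulmx_suml -[X in _ = _ *: X]/S scaler_nat -sumr_const; apply: eq_bigr => x Hx.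
  rewrite mulmx_sumr [RHS](reindex_inj (mulgI x)) /=.
  by apply: eq_big => y; rewrite ?groupMl // => Hy; rewrite repr_mxM ?GH.
have H0 : #|H|%:R != 0 :> algC by exact: neq0CG.
have e0 : #|H|%:R^-1 *: S = 0.
  have ee : (#|H|%:R^-1 *: S) *m (#|H|%:R^-1 *: S) = #|H|%:R^-1 *: S.
    by rewrite -scalemxAl -scalemxAr SS !scalerA -mulrA mulVf // mulr1.
  apply/eqP; rewrite -mxrank_eq0 -(pnatr_eq0 algC) -(mxtrace_idempotent ee).
  by rewrite mxtraceZ trS mulr0.
have := @fixed_vector _ rG; rewrite -big_dihedral -/H -/S.
move/eqP: e0; rewrite scaler_eq0 invr_eq0 (negPf H0) => /eqP-> /(_ _)/eqP; apply=> //.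
by rewrite -(ltr_nat algC) -irr1_degree irr1_gt0.
Qed.

End Generators.
End Polytope.

(** * Parity of Mackey sums *)

Section DegreeTwo.

Variables (gT : finGroupType) (G : {group gT}).

Lemma degree2_split (psi : 'CF(G)) : psi \is a character -> psi 1%g = 2%:R ->
  psi \in irr G \/
  exists mu nu : 'CF(G), [/\ mu \is a linear_char, nu \is a linear_char & psi = mu + nu].
Proof.
move=> Npsi psi1; have nz : psi != 0 by apply: contra_eq_neq psi1 => ->; rewrite cfunE eq_sym pnatr_eq0.
have [i hi] := neq0_has_constt nz.
have [nu Nnu e] := constt_charP i Npsi hi.
have [d hd] := natrP (Cnat_irr1 i); have [k hk] := natrP (Cnat_char1 Nnu).
have d0 : (0 < d)%N by rewrite -(ltr_nat algC) -hd irr1_gt0.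
have dk : (d + k = 2)%N.
  by apply/eqP; rewrite -(eqr_nat algC) natrD -hd -hk -psi1 e cfunE.
have [k0|k0] := posnP k.
  left; rewrite e; have /eqP-> : nu == 0 by rewrite -char1_eq0 // hk k0.
  by rewrite addr0 mem_irr.
have d1 : d = 1%N.
  by apply/eqP; rewrite eqn_leq d0 andbT -ltnS -dk -[X in (X < _)%N]addn0 ltn_add2l.
have k1 : k = 1%N by move: dk; rewrite d1 => -[].
right; exists 'chi_i, nu; split=> //; rewrite qualifE /= ?irr_char ?Nnu ?hd ?hk.
  by rewrite d1 eqxx.
by rewrite k1 eqxx.
Qed.

(* A character with values psi(x)^2 - psi(x^2) = 2 has trivial determinant. *)
Lemma even_cfdot_abelian (phi psi : 'CF(G)) : abelian G ->
  phi \is a character -> cfReal phi -> psi \is a character -> psi 1%g = 2%:R ->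
  (forall x, x \in G -> psi x ^+ 2 - psi (x ^+ 2)%g = 2%:R) ->
  (2 %| '[phi, psi])%C.
Proof.
move=> abG Nphi Rphi Npsi psi1 det1.
have [/irrP[i psi_i]|[mu [nu [Lmu Lnu e]]]] := degree2_split Npsi psi1.
  have := char_abelianP _ abG i; rewrite qualifE /= -psi_i psi1 => /andP[_].
  by rewrite -[1]/(1%:R) eqr_nat.
have nuE : nu = (mu^*)%CF.
  apply/cfun_inP=> x Gx; rewrite cfConjCE -lin_charV_conj // lin_charV //.
  have := det1 x Gx; rewrite e !cfunE (lin_charX Lmu) // (lin_charX Lnu) //.
  have -> : (mu x + nu x) ^+ 2 - (mu x ^+ 2 + nu x ^+ 2) = 2%:R * (mu x * nu x).
    by ring.
  move=> h; have h1 : mu x * nu x = 1.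
    by apply: (mulfI (_ : 2%:R != 0 :> algC)); rewrite ?pnatr_eq0 // h mulr1.
  by rewrite -[nu x]mul1r -(mulVf (lin_char_neq0 Lmu Gx)) -mulrA h1 mulr1.
rewrite e nuE cfdotDr cfdot_real_conjC //.
have Nm : '[phi, mu] \is a Num.nat by apply: Cnat_cfdot_char => //; exact: lin_charW.
rewrite (conj_natr Nm) -mulr2n; apply/dvdCP; exists '[phi, mu]; first exact: intr_nat.
by rewrite mulr_natr.
Qed.

End DegreeTwo.

Section Mackey.

Variables (gT : finGroupType) (G K B : {group gT}).
Hypotheses (sBK : B \subset K) (sKG : K \subset G).
Variables (phi : 'CF(K)) (psi : 'CF(B)).

Let h y := \sum_(b in B) phi (b ^ y)%g * (psi b)^*.

Lemma cfdot_Res_Ind : '['Res[B] ('Ind[G] phi), psi] = (#|B|%:R * #|K|%:R)^-1 * \sum_(y in G) h y.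
Proof.
rewrite cfdotE invfM -mulrA; congr (_ * _).
rewrite exchange_big mulr_sumr; apply: eq_bigr => b Bb.
have Gb : b \in G by rewrite (subsetP sKG) ?(subsetP sBK).
rewrite cfResE ?(subset_trans sBK) // cfIndE // -mulrA mulr_suml.
by [].
Qed.

Lemma h_dcoset b0 y k0 : b0 \in B -> k0 \in K -> h (b0 * y * k0)%g = h y.
Proof.
move=> Bb Kk; rewrite /h (reindex_inj (conjg_inj b0^-1%g)) /=.
apply: eq_big => b; first by rewrite groupJr ?groupV.
move=> Bb'; rewrite -conjgM -(mulgA b0) mulKg conjgM (cfunJ _ _ Kk) (cfunJ _ _ (groupVr Bb)) //.
Qed.

(** The summand is constant on the double coset, whose size is |B| |K| divided by the order of the
    intersection of B with the conjugate of K. *)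
Lemma sum_dcoset y0 : y0 \in G ->
  \sum_(y in G | (B :* y * K)%g == (B :* y0 * K)%g) h y =
  (#|B|%:R * #|K|%:R) * (h y0 / #|B :&: (K :^ y0^-1)|%:R).
Proof.
move=> Gy0; set D := (B :* y0 * K)%g.
have cD : (#|D| * #|B :&: (K :^ y0^-1)| = #|B| * #|K|)%N.
  have -> : D = ((B * (K :^ y0^-1)) :* y0)%g.
    by rewrite /D conjsgE invgK -!mulgA mulg_set1 mulVg mulg1.
  by rewrite card_rcoset -(mul_cardG B (K :^ y0^-1)%G) cardJg.
have memD y : (y \in G) && ((B :* y * K)%g == D) = (y \in D).
  apply/andP/idP => [[_ /eqP <-]|].
    by apply/mulsgP; exists y 1%g; rewrite ?rcoset_refl ?group1 ?mulg1.
  case/mulsgP=> _ k /rcosetP[b Bb ->] Kk ->; split.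
    exact: groupM (groupM (subsetP sKG _ (subsetP sBK _ Bb)) Gy0) (subsetP sKG _ Kk).
  by rewrite /D !rcosetM (rcoset_id Bb) -!mulgA (lcoset_id Kk).
rewrite (eq_bigl _ _ memD) (eq_bigr (fun=> h y0)).
  rewrite sumr_const -natrM -cD natrM -[h y0 *+ _]mulr_natl -mulrA; congr (_ * _).
  by rewrite mulrCA divff ?mulr1 // pnatr_eq0 -lt0n cardG_gt0.
by move=> y /mulsgP[_ k /rcosetP[b Bb ->] Kk ->]; exact: h_dcoset.
Qed.

Hypothesis h_diag : h 1%g = #|B|%:R.
Hypothesis h_even : forall y, y \in G -> y \notin K ->
  (2 %| h y / #|B :&: (K :^ y^-1)|%:R)%C.

(** The double coset of 1 is K and contributes 1; representatives of the others lie outside K, where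
    [h_even] applies. *)
Lemma odd_cfdot_Res_Ind : (2 %| '['Res[B] ('Ind[G] phi), psi] - 1)%C.
Proof.
have n0 : #|B|%:R * #|K|%:R != 0 :> algC by rewrite mulf_neq0 ?neq0CG.
pose f y := (B :* y * K)%g.
rewrite cfdot_Res_Ind (partition_big_imset f) /= (bigD1 (f 1%g)) ?imset_f ?group1 //=.
rewrite sum_dcoset // h_diag invg1 conjsg1 (setIidPl sBK) divff ?neq0CG // mulr1.
rewrite mulrDr mulVf // addrC addKr mulr_sumr rpred_sum // => _ /andP[/imsetP[y Gy ->] nD].
rewrite sum_dcoset // mulKf // h_even //.
by apply: contra nD => Ky; apply/eqP; rewrite /f -!mulgA (lcoset_id Ky) mul1g.
Qed.

End Mackey.

(** * Real representations and quaternions *)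

Section Quaternion.

Variables (R : realFieldType) (n : nat) (W I J : 'M[R]_n).
Hypotheses (WI : (W *m I <= W)%MS) (WJ : (W *m J <= W)%MS).
Hypothesis II : forall w : 'rV_n, (w <= W)%MS -> w *m I *m I = - w.
Hypothesis JJ : forall w : 'rV_n, (w <= W)%MS -> w *m J *m J = - w.
Hypothesis IJ : forall w : 'rV_n, (w <= W)%MS -> w *m J *m I = - (w *m I *m J).

(* W is a left vector space over the real quaternions, with i acting by I and j
   by J. *)
Lemma quaternion_rank : (4 %| \rank W)%N.
Proof.
have sI m (U : 'M_(m, n)) : (U <= W)%MS -> (U *m I <= W)%MS.
  by move=> sU; apply: submx_trans WI; apply: submxMr.
have sJ m (U : 'M_(m, n)) : (U <= W)%MS -> (U *m J <= W)%MS.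
  by move=> sU; apply: submx_trans WJ; apply: submxMr.
(* A subspace U stable under I and J grows by one quaternionic line, of real dimension 4, until it
   fills W. *)
suff main k (U : 'M[R]_n) : (U <= W)%MS -> (U *m I <= U)%MS -> (U *m J <= U)%MS ->
    (4 %| \rank U)%N -> (\rank W - \rank U < k)%N -> (4 %| \rank W)%N.
  apply: (main (\rank W).+1 0); rewrite ?sub0mx ?mul0mx ?sub0mx ?mxrank0 ?dvdn0 //.
  by rewrite subn0.
elim: k U => // k IH U sUW sUI sUJ h4 hk.
have [sWU|] := boolP (W <= U)%MS.
  have e : (U == W)%MS by rewrite sUW.
  by rewrite -(eqmx_rank e).
move=> /row_subPn[i nwU]; set w := row i W in nwU.
have wW : (w <= W)%MS by apply: row_sub.
pose wI := w *m I; pose wJ := w *m J; pose wK := w *m I *m J.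
have wIW : (wI <= W)%MS by apply: sI.
have wJW : (wJ <= W)%MS by apply: sJ.
have wKW : (wK <= W)%MS by apply: sJ.
have eI : w *m I = wI by [].
have eJ : w *m J = wJ by [].
have eII : wI *m I = - w by apply: II.
have eJI : wJ *m I = - wK by apply: IJ.
have eKI : wK *m I = wJ by rewrite /wK IJ // -/wI eII mulNmx opprK.
have eIJ : wI *m J = wK by [].
have eJJ : wJ *m J = - w by apply: JJ.
have eKJ : wK *m J = - wI by apply: JJ.
clearbody wK wJ wI w.
pose q a b c d := a *: w + b *: wI + c *: wJ + d *: wK.
have qI a b c d : q a b c d *m I = q (- b) a d (- c).
  by rewrite /q !mulmxDl -!scalemxAl eI eII eJI eKI; apply/rowP=> j; rewrite !mxE; ring.
have qJ a b c d : q a b c d *m J = q (- c) (- d) a b.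
  by rewrite /q !mulmxDl -!scalemxAl eJ eIJ eJJ eKJ; apply/rowP=> j; rewrite !mxE; ring.
have qU a b c d : (q a b c d <= U)%MS -> [/\ a = 0, b = 0, c = 0 & d = 0].
  move=> hq.
  have hI : (q a b c d *m I <= U)%MS by apply: submx_trans sUI; apply: submxMr.
  have hJ : (q a b c d *m J <= U)%MS by apply: submx_trans sUJ; apply: submxMr.
  have hIJ : (q a b c d *m I *m J <= U)%MS by apply: submx_trans sUJ; apply: submxMr.
  (* Applying the conjugate quaternion turns [q a b c d] into its norm times w; as w is not in U,
     the norm, a sum of squares, must vanish. *)
  have hN : ((a ^+ 2 + b ^+ 2 + c ^+ 2 + d ^+ 2) *: w <= U)%MS.
    have -> : (a ^+ 2 + b ^+ 2 + c ^+ 2 + d ^+ 2) *: w = a *: q a b c d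
       - b *: (q a b c d *m I) - c *: (q a b c d *m J) - d *: (q a b c d *m I *m J).
      rewrite !(qI, qJ) /q.
      by apply/rowP=> j; rewrite !mxE; ring.
    by do ![apply: addmx_sub]; rewrite ?eqmx_opp; apply: scalemx_sub.
  have N0 : a ^+ 2 + b ^+ 2 + c ^+ 2 + d ^+ 2 = 0.
    apply/eqP/negPn/negP=> nN; case/negP: nwU.
    by rewrite -[w](scalerK nN) scalemx_sub.
  have a0 := sqr_ge0 a; have b0 := sqr_ge0 b; have c0 := sqr_ge0 c; have d0 := sqr_ge0 d.
  by split; apply/eqP; rewrite -sqrf_eq0; apply/eqP; lra.
pose Q : 'M[R]_(1 + 1 + (1 + 1), n) := col_mx (col_mx w wI) (col_mx wJ wK).
have Qrow (x : 'rV_(1 + 1 + (1 + 1))) : exists a b c d,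
    x *m Q = q a b c d /\ (a = 0 -> b = 0 -> c = 0 -> d = 0 -> x = 0).
  exists (lsubmx (lsubmx x) 0 0), (rsubmx (lsubmx x) 0 0),
    (lsubmx (rsubmx x) 0 0), (rsubmx (rsubmx x) 0 0); split.
    rewrite -{1}[x]hsubmxK -{1}[lsubmx x]hsubmxK -{1}[rsubmx x]hsubmxK !mul_row_col.
    rewrite [lsubmx (lsubmx x)]mx11_scalar [rsubmx (lsubmx x)]mx11_scalar.
    rewrite [lsubmx (rsubmx x)]mx11_scalar [rsubmx (rsubmx x)]mx11_scalar.
    by rewrite !mul_scalar_mx addrA /q !mxE.
  move=> h1 h2 h3 h4'; rewrite -[x]hsubmxK -[lsubmx x]hsubmxK -[rsubmx x]hsubmxK.
  rewrite [lsubmx (lsubmx x)]mx11_scalar [rsubmx (lsubmx x)]mx11_scalar.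
  rewrite [lsubmx (rsubmx x)]mx11_scalar [rsubmx (rsubmx x)]mx11_scalar h1 h2 h3 h4'.
  by rewrite !raddf0 !row_mx0.
have rQ : \rank Q = 4.
  apply/eqP; rewrite -[_ == _]/(row_free Q) -kermx_eq0; apply/eqP/row_matrixP=> j.
  rewrite row0; have [a [b [c [d [e h]]]]] := Qrow (row j (kermx Q)).
  have [|a0 b0 c0 d0] := qU a b c d; last exact: h.
  by rewrite -e -row_mul mulmx_ker row0 sub0mx.
have capUQ : (U :&: Q = 0)%MS.
  apply/row_matrixP=> j; rewrite row0.
  have /submxP[x ex] : (row j (U :&: Q)%MS <= Q)%MS by rewrite (submx_trans (row_sub _ _)) ?capmxSr.
  have [a [b [c [d [e h]]]]] := Qrow x.
  have [|a0 b0 c0 d0] := qU a b c d.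
    by rewrite -e -ex (submx_trans (row_sub _ _)) ?capmxSl.
  by rewrite ex h // mul0mx.
have rU : \rank (U + Q)%MS = (\rank U + 4)%N by rewrite mxrank_disjoint_sum // rQ.
have sQ (A : 'M_n) : (w *m A <= Q)%MS -> (wI *m A <= Q)%MS -> (wJ *m A <= Q)%MS ->
    (wK *m A <= Q)%MS -> (Q *m A <= Q)%MS.
  by move=> h1 h2 h3 h4'; rewrite !mul_col_mx !col_mx_sub h1 h2 h3 h4'.
have [q1 q2 q3 q4] : [/\ (w <= Q)%MS, (wI <= Q)%MS, (wJ <= Q)%MS & (wK <= Q)%MS].
  have := submx_refl Q; rewrite {1}/Q !col_mx_sub => /andP[/andP[? ?] /andP[? ?]].
  by split.
apply: (IH (U + Q)%MS).
- by rewrite addsmx_sub sUW !col_mx_sub wW wIW wJW wKW.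
- rewrite addsmxMr addsmxS //; apply: sQ; rewrite ?eI ?eII ?eJI ?eKI ?eqmx_opp //.
- rewrite addsmxMr addsmxS //; apply: sQ; rewrite ?eJ ?eIJ ?eJJ ?eKJ ?eqmx_opp //.
- by rewrite rU dvdn_addl.
rewrite rU; have : (\rank (U + Q)%MS <= \rank W)%N.
  by apply: mxrankS; rewrite addsmx_sub sUW !col_mx_sub wW wIW wJW wKW.
rewrite rU => h; rewrite -ltnS (leq_trans _ hk) // ltnS subnDA ltn_subrL /=.
by rewrite subn_gt0 (leq_trans _ h) // addnS ltnS leq_addr.
Qed.

End Quaternion.

(** * Real numbers and real algebraic numbers with the same rational cut *)

Section SameReal.

Variable R : realType.
Implicit Types (r : R) (a : algC) (q : rat).

Lemma rat_between_C a b : a \is Num.real -> b \is Num.real -> a < b ->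
  exists q : rat, a < ratr q < b.
Proof.
move=> Ra Rb ab; have d0 : 0 < b - a by rewrite subr_gt0.
pose N := (Num.truncn (b - a)^-1).+1.
have N0 : 0 < N%:R :> algC by rewrite ltr0n.
have hN : (b - a)^-1 < N%:R by apply: real_truncnS_gt; rewrite realV ger0_real // ltW.
have hNab : 1 < N%:R * (b - a).
  by rewrite -[X in X < _](mulVf (lt0r_neq0 d0)) ltr_pM2r.
have RNa : N%:R * a \is Num.real by rewrite realM ?realn.
pose k := Num.floor (N%:R * a) + 1.
exists (k%:~R / N%:R); rewrite rmorphM /= fmorphV /= ratr_int ratr_nat.
have /andP[h1 h2] := real_floor_itv RNa.
rewrite ltr_pdivlMr // ltr_pdivrMr // mulrC h2 /= mulrC.
apply: le_lt_trans (_ : N%:R * a + 1 < _); first by rewrite /k intrD lerD2r.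
by rewrite -ltrBrDl -mulrBr.
Qed.

Lemma rat_between r r' : r < r' -> exists q : rat, r < ratr q < r'.
Proof. by move/rat_in_itvoo => [q]; rewrite in_itv /=; exists q. Qed.

Lemma same_real_lt r a q : same_real r a -> a \is Num.real -> (r < ratr q) = (a < ratr q).
Proof.
by move=> h Ra; rewrite ltNge h real_ltNge //; apply/Creal_Crat/Crat_rat.
Qed.

(** If q separated the sums, say a1 + a2 < q <= r1 + r2, a rational p strictly between a1 and q - a2
    would give r1 < p and r2 < q - p, a contradiction. *)
Lemma same_realD r1 r2 a1 a2 : a1 \is Num.real -> a2 \is Num.real ->
  same_real r1 a1 -> same_real r2 a2 -> same_real (r1 + r2) (a1 + a2).
Proof.
move=> Ra1 Ra2 h1 h2 q.
have Rq (p : rat) : (ratr p : algC) \is Num.real by apply/Creal_Crat/Crat_rat.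
have Ra12 : a1 + a2 \is Num.real by rewrite realD.
apply/idP/idP => hq; rewrite ?leNgt ?real_leNgt //; apply/negP=> hlt.
- have [p /andP[p1 p2]] : exists p, a1 < ratr p < ratr q - a2.
    by apply: rat_between_C; rewrite ?realB // ltrBrDr.
  have e1 : r1 < ratr p by rewrite (same_real_lt p h1).
  have e2 : r2 < ratr (q - p) by rewrite (same_real_lt _ h2) // rmorphB /= ltrBrDr -ltrBrDl.
  by have := ltrD e1 e2; rewrite rmorphB /= (addrC (ratr p)) subrK ltNge hq.
have [p /andP[p1 p2]] : exists p, r1 < ratr p < ratr q - r2.
  by apply: rat_between; rewrite ltrBrDr.
have e1 : a1 < ratr p by rewrite -(same_real_lt p h1).
have e2 : a2 < ratr (q - p) by rewrite -(same_real_lt _ h2) // rmorphB /= ltrBrDr -ltrBrDl.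
by have := ltrD e1 e2; rewrite rmorphB /= (addrC (ratr p)) subrK real_ltNge // hq.
Qed.

Lemma same_realN r a : a \is Num.real -> same_real r a -> same_real (- r) (- a).
Proof.
move=> Ra h q.
have Rq (p : rat) : (ratr p : algC) \is Num.real by apply/Creal_Crat/Crat_rat.
rewrite lerNr -rmorphN [RHS]lerNr -rmorphN /=.
apply/idP/idP => hq; rewrite ?leNgt ?real_leNgt //; apply/negP=> hlt.
  have [p /andP[p1 p2]] := rat_between_C (Rq _) Ra hlt.
  have := ltW p2; rewrite -h => hp; have := le_trans hp hq.
  by rewrite ler_rat leNgt -(ltr_rat algC) p1.
have [p /andP[p1 p2]] := rat_between hlt.
have := ltW p2; rewrite h => hp; have := le_trans hp hq.
by rewrite ler_rat leNgt -(ltr_rat R) p1.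
Qed.

Lemma same_real_int r a (c : int) : a \is Num.real -> same_real r a ->
  same_real (c%:~R * r) (c%:~R * a).
Proof.
move=> Ra h; have hn (k : nat) : same_real (k%:R * r) (k%:R * a).
  elim: k => [|k IH]; first by rewrite !mul0r => q; rewrite !lerq0.
  by rewrite -addn1 !natrD !mulrDl !mul1r; apply: same_realD => //; rewrite realM ?realn.
case: c => k; first exact: hn.
by rewrite NegzE !intrN !mulNr; apply: same_realN; rewrite ?realM ?realn //; exact: hn.
Qed.

Lemma same_real_sum (I : Type) (s : seq I) (c : I -> R) (d : I -> algC) :
  (forall i, d i \is Num.real) -> (forall i, same_real (c i) (d i)) ->
  same_real (\sum_(i <- s) c i) (\sum_(i <- s) d i).
Proof.
move=> Rd h; elim: s => [|i s IH]; first by rewrite !big_nil => q; rewrite lerq0 lerq0.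
by rewrite !big_cons; apply: same_realD => //; apply: rpred_sum.
Qed.

Lemma same_real_nat r (k : nat) : same_real r k%:R -> r = k%:R.
Proof.
move=> h; apply/eqP; rewrite eq_le; apply/andP; split; last first.
  by have := h k%:R; rewrite !ratr_nat lexx.
rewrite leNgt; apply/negP=> /rat_between[q /andP[h1 h2]].
have := ltW h2; rewrite h -(ratr_nat algC) ler_rat -(ler_rat R) ratr_nat.
by rewrite leNgt h1.
Qed.

End SameReal.

Section QuaternionTrace.

Variables (R : rcfType) (n : nat) (U V C : 'M[R]_n).
Local Notation "x ** y" := (x *m y) (at level 40, left associativity).
Hypothesis U3 : U ** U ** U = 1%:M.
Hypothesis VV : V ** V = C.
Hypothesis C4 : C ** C ** C ** C = 1%:M.
Hypothesis UV : U ** V = V ** U ** U.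

Let S := 1%:M + U + U ** U.
Let E := 3%:R%:M - S.
Let T := 1%:M - C + C ** C - C ** C ** C.

(* E T / 12 projects onto the space where U has no nonzero fixed vector and
   C = -1; there V and (U - U^2) / sqrt 3 are anticommuting square roots of -1. *)
Lemma quaternion_trace : exists k : nat, \tr (E ** T) = 12%:R * (4 * k)%:R.
Proof.
have SU : S ** U = S by rewrite /S !mulmxDl mul1mx U3 addrC addrA.
have US : U ** S = S by rewrite -[RHS]SU /S !mulmxDl !mulmxDr mulmx1 mul1mx mulmxA.
have SS : S ** S = 3%:R *: S.
  by rewrite {2}/S !mulmxDr mulmx1 mulmxA SU SU scaler_nat !mulrS mulr0n addr0 addrA.
have ES : E ** S = 0 by rewrite /E mulmxBl SS mul_scalar_mx subrr.
have SE : S ** E = 0 by rewrite /E mulmxBr SS mul_mx_scalar subrr.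
have EE : E ** E = 3%:R *: E by rewrite {1}/E mulmxBl SE subr0 mul_scalar_mx.
have UE : U ** E = E ** U by rewrite /E mulmxBr mulmxBl US SU mul_scalar_mx mul_mx_scalar.
have TC : T ** C = - T.
  rewrite /T mulmxBl mulmxDl mulmxBl mul1mx C4.
  by rewrite !opprB !opprD opprK; apply/matrixP=> i j; rewrite !mxE; ring.
have TT : T ** T = 4%:R *: T.
  rewrite {2}/T mulmxBr mulmxDr mulmxBr mulmx1 !(mulmxA T) TC mulNmx TC opprK TC opprK.
  by rewrite scaler_nat !mulrS mulr0n addr0 !addrA.
have UUV : U ** U ** V = V ** U.
  have e : V ** U ** U ** U ** U = V ** (U ** U ** U) ** U by rewrite !mulmxA.
  by rewrite -mulmxA UV !mulmxA UV e U3 mulmx1.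
have UC : U ** C = C ** U.
  rewrite -VV mulmxA UV.
  have -> : V ** U ** U ** V = V ** (U ** U ** V) by rewrite !mulmxA.
  by rewrite UUV mulmxA.
have VC : V ** C = C ** V by rewrite -VV mulmxA.
have EV : E ** V = V ** E.
  rewrite /E mulmxBl mulmxBr mul_scalar_mx mul_mx_scalar; congr (_ - _).
  by rewrite /S !mulmxDl !mulmxDr mul1mx mulmx1 UV UUV mulmxA addrAC.
have EC : E ** C = C ** E by rewrite -VV (mulmxA E) EV -(mulmxA V E) EV mulmxA.
have commT (A : 'M_n) : A ** C = C ** A -> A ** T = T ** A.
  move=> h; have h2 : A ** (C ** C) = C ** C ** A by rewrite mulmxA h -mulmxA h mulmxA.
  have h3 : A ** (C ** C ** C) = C ** C ** C ** A by rewrite mulmxA h2 -mulmxA h mulmxA.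
  by rewrite /T !(mulmxDl, mulmxDr) mulmx1 mul1mx !(mulNmx, mulmxN) h h2 h3.
have ET := commT E EC; have VT := commT V VC; have UT := commT U UC.
pose P := 12%:R^-1 *: (E ** T).
have n12 : 12%:R != 0 :> R by rewrite pnatr_eq0.
have PP : P ** P = P.
  rewrite /P -scalemxAl -scalemxAr mulmxA -(mulmxA E) -ET mulmxA EE -mulmxA TT.
  rewrite -scalemxAl -scalemxAr !scalerA; congr (_ *: _); rewrite -mulrA -[RHS]mulr1; congr (_ * _).
  by rewrite -natrM mulVf.
have rP := mxtrace_idempotent PP.
pose r3 : R := Num.sqrt 3%:R.
have r3r3 : r3 * r3 = 3%:R by rewrite -expr2 sqr_sqrtr ?ler0n.
have nr3 : r3 != 0 by rewrite sqrtr_eq0 -ltNge ltr0n.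
pose I := r3^-1 *: (U - U ** U).
have PU : P ** U = U ** P by rewrite /P -scalemxAl -scalemxAr -mulmxA -UT mulmxA -UE mulmxA.
have PV : P ** V = V ** P by rewrite /P -scalemxAl -scalemxAr -mulmxA -VT mulmxA EV mulmxA.
have PI : P ** I = I ** P.
  by rewrite /I -scalemxAl -scalemxAr mulmxBr mulmxBl mulmxA PU -!mulmxA PU.
have PS : P ** S = 0 by rewrite /P -scalemxAl ET -mulmxA ES mulmx0 scaler0.
have PC : P ** C = - P by rewrite /P -scalemxAl -mulmxA TC mulmxN scalerN.
have wP (w : 'rV_n) : (w <= P)%MS -> w ** P = w.
  by move=> /submxP[x ->]; rewrite -mulmxA PP.
have /dvdnP[k hk] : (4 %| \rank P)%N.
  apply: (@quaternion_rank R n P I V).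
  - by rewrite PI submxMl.
  - by rewrite PV submxMl.
  - move=> w /wP hw.
    have wS : w ** S = 0 by rewrite -hw -mulmxA PS mulmx0.
    rewrite /I -!scalemxAr -!scalemxAl scalerA -invfM r3r3.
    have XX : (U - U ** U) ** (U - U ** U) = S - 3%:R%:M.
      rewrite mulmxBl !mulmxBr !mulmxA U3 mul1mx /S -[3%:R%:M]scalemx1.
      by apply/matrixP=> i j; rewrite !mxE; ring.
    have -> : w ** (U - U ** U) ** (U - U ** U) = - (3%:R *: w) + w ** S.
      by rewrite -mulmxA XX mulmxBr mul_mx_scalar addrC.
    by rewrite wS addr0 scalerN scalerK // pnatr_eq0.
  - by move=> w /wP hw; rewrite -mulmxA VV -{1}hw -mulmxA PC mulmxN hw.
  - move=> w /wP hw; rewrite /I -!scalemxAr -!scalemxAl -scalerN; congr (_ *: _).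
    have VX : V ** (U - U ** U) = - ((U - U ** U) ** V).
      by rewrite mulmxBl mulmxBr UV UUV mulmxA opprB.
    by rewrite -mulmxA VX mulmxN mulmxA.
exists k; have : \tr P = (\rank P)%:R by [].
by rewrite hk mulnC mxtraceZ => <-; rewrite mulVKf.
Qed.

End QuaternionTrace.

Section NotAfforded.

Variables (R : realType) (gT : finGroupType) (G : {group gT}) (u g : gT).
Hypotheses (Gu : u \in G) (Gg : g \in G).
Hypothesis u3 : (u * u * u = 1)%g.
Hypothesis g8 : (g * g * (g * g) * (g * g) * (g * g) = 1)%g.
Hypothesis ug : (u * g = g * u * u)%g.

(** The coefficient of u^i c^j in (2 - u - u^2)(1 - c + c^2 - c^3), where c = g^2; it is also the
    value of the quaternionic character of B at u^i g^(2j). *)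
Definition quat_coef (i j : nat) : int := (if i == 0%N then 2 else -1) * (-1) ^+ j.

(** If chi is afforded over the reals, [quaternion_trace] gives the sum the form 12 * 4 k, so 24 m =
    48 k. *)
Lemma afforded_even (chi : 'CF(G)) (m : nat) : cfReal chi -> afforded_over_reals R chi ->
  \sum_(i < 3) \sum_(j < 4) (quat_coef i j)%:~R * chi (u ^+ i * (g * g) ^+ j)%g = (24 * m)%:R ->
  ~~ odd m.
Proof.
move=> Rchi [n [rG hG]] hm.
have chiR x : chi x \is Num.real by rewrite CrealE -{1}(eqP Rchi) cfConjCE conjCK.
have GU i : (u ^+ i)%g \in G by rewrite groupX.
have GC j : ((g * g) ^+ j)%g \in G by rewrite groupX ?groupM.
have U3 : rG u *m rG u *m rG u = 1%:M by rewrite -!repr_mxM ?groupM // u3 repr_mx1.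
have CC : rG g *m rG g = rG (g * g)%g by rewrite repr_mxM.
have C4 : rG (g * g)%g *m rG (g * g)%g *m rG (g * g)%g *m rG (g * g)%g = 1%:M.
  by rewrite -!repr_mxM ?groupM // g8 repr_mx1.
have UV : rG u *m rG g = rG g *m rG u *m rG u by rewrite -!repr_mxM ?groupM // ug.
have [k hk] := quaternion_trace U3 CC C4 UV.
set U := rG u in U3 UV hk; set V := rG g in CC UV; set C := rG (g * g)%g in CC C4 hk.
pose r i j := \tr (rG (u ^+ i * (g * g) ^+ j)%g).
have traceE : \tr ((3%:R%:M - (1%:M + U + U *m U)) *m (1%:M - C + C *m C - C *m C *m C))
    = \sum_(i < 3) \sum_(j < 4) (quat_coef i j)%:~R * r i j.
  have rE i j : rG (u ^+ i * (g * g) ^+ j)%g = rG (u ^+ i)%g *m rG ((g * g) ^+ j)%g.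
    by rewrite repr_mxM.
  have rX x e : x \in G -> rG (x ^+ e.+1)%g = rG (x ^+ e)%g *m rG x.
    by move=> Gx; rewrite expgSr repr_mxM ?groupX.
  transitivity (\tr (\sum_(i < 3) \sum_(j < 4) (quat_coef i j)%:~R *: (rG (u ^+ i)%g *m rG ((g * g) ^+ j)%g))).
    congr (\tr _); rewrite !big_ord_recl !big_ord0 /= /bump /= !addr0 !rX ?groupM //.
    rewrite !expg0 !repr_mx1 -/U -/C !mul1mx !mulmx1 -[3%:R%:M]scalemx1.
    rewrite !(mulmxDl, mulmxDr, mulNmx, mulmxN, mul1mx, mulmx1) -!scalemxAl !mul1mx /quat_coef /=.
    move: (U *m U) (C *m C) => U2 C2.
    move: (U2 *m (C2 *m C)) (U2 *m C2) (U2 *m C) (U *m (C2 *m C)) (U *m C2) (U *m C) (C2 *m C).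
    by move=> X1 X2 X3 X4 X5 X6 X7; apply/matrixP=> i j; rewrite !mxE; ring.
  rewrite raddf_sum; apply: eq_bigr => i _; rewrite raddf_sum; apply: eq_bigr => j _.
  by rewrite /= mxtraceZ /r rE.
have : same_real (\sum_(i < 3) \sum_(j < 4) (quat_coef i j)%:~R * r i j) ((24 * m)%:R : algC).
  rewrite -hm; apply: same_real_sum => i.
    by apply: rpred_sum => j _; rewrite realM ?realz.
  apply: same_real_sum => j; first by rewrite realM ?realz.
  apply: same_real_int; first exact: chiR.
  by apply: hG; rewrite groupM.
rewrite -traceE hk => /same_real_nat /eqP.
rewrite -natrM eqr_nat mulnA -[(12 * 4)%N]/(24 * 2)%N -mulnA eqn_pmul2l // => /eqP <-.
by rewrite oddM.
Qed.

End NotAfforded.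

(** * A quaternionic representation of the stabiliser of an isotropic line *)

Section Metacyclic24.

Local Close Scope ring_scope.
Local Open Scope group_scope.

Variables (gT : finGroupType) (u g : gT).
Hypotheses (u1 : u != 1) (u3 : u ^+ 3 = 1) (g4 : g ^+ 4 != 1) (g8 : g ^+ 8 = 1).
Hypothesis ug : u ^ g = u^-1.

Lemma order_u : #[u] = 3%N.
Proof. exact: nt_prime_order. Qed.

Lemma order_g : #[g] = 8%N.
Proof.
have : #[g] %| (2 ^ 3)%N by rewrite order_dvdn g8.
case/dvdn_pfactor => // e he ee; have := he; rewrite leq_eqVlt => /orP[/eqP e3|h2].
  by rewrite ee e3.
by case/negP: g4; rewrite -order_dvdn ee (dvdn_exp2l 2 (n := 2)).
Qed.

Lemma norm_u : <[g]> \subset 'N(<[u]>).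
Proof. by rewrite cycle_subG; apply/normP; rewrite -cycleJ ug cycleV. Qed.

Lemma gen_ugE : <<[set u; g]>> = <[u]> * <[g]>.
Proof.
rewrite -norm_joinEr ?norm_u //; apply/eqP; rewrite eqEsubset; apply/andP; split.
  by rewrite gen_subG; apply/subsetP=> z; rewrite !inE => /orP[]/eqP->;
    rewrite mem_gen // inE cycle_id ?orbT.
by rewrite join_subG !cycle_subG !mem_gen // !inE ?eqxx ?orbT.
Qed.

Lemma card_ug : #|<<[set u; g]>>| = 24%N.
Proof. by rewrite gen_ugE coprime_cardMg -!orderE order_u order_g. Qed.

Lemma big_ug (R : Type) (idx : R) (op : Monoid.com_law idx) (F : gT -> R) :
  \big[op/idx]_(b in <<[set u; g]>>) F b =
  \big[op/idx]_(i < 3) \big[op/idx]_(k < 8) F (u ^+ i * g ^+ k).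
Proof.
pose s := [seq u ^+ i * g ^+ k | i <- iota 0 3, k <- iota 0 8].
have sub : {subset enum <<[set u; g]>> <= s}.
  move=> b; rewrite mem_enum gen_ugE => /mulsgP[_ _ /cycleP[i ->] /cycleP[k ->] ->].
  rewrite -(expg_mod_order u i) -(expg_mod_order g k) order_u order_g.
  apply/allpairsP; exists (i %% 3, k %% 8)%N.
  by rewrite !mem_iota !add0n !ltn_mod.
have sz : (size s <= size (enum <<[set u; g]>>))%N by rewrite -cardE card_ug size_allpairs !size_iota.
have us : uniq s by apply: (leq_size_uniq (enum_uniq _) sub sz).
rewrite -big_enum.
have pe : perm_eq (enum <<[set u; g]>>) s.
  apply: uniq_perm; rewrite ?enum_uniq // => b.
  by have [_ ->] := uniq_min_size (enum_uniq _) sub sz.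
rewrite (perm_big _ pe) big_allpairs_dep -(big_mkord xpredT (fun i => \big[op/idx]_(k < 8) F (u ^+ i * g ^+ k))).
rewrite /index_iota subn0; apply: eq_bigr => i _.
by rewrite -(big_mkord xpredT (fun k => F (u ^+ i * g ^+ k))).
Qed.

(** The derived subgroup of S is a nontrivial subgroup of <u>, of order 3, so u is in S. As S is not
    contained in the abelian group <u> <g^2>, it has an element u^i g^k with k odd, and g^k
    generates <g>. *)
Lemma nonabelian_sub_ug (S : {group gT}) : S \subset <<[set u; g]>> ->
  ~~ abelian S -> u \in S /\ g \in S.
Proof.
move=> sSB nS; pose A := <[u]> * <[g ^+ 2]>.
have ug2 : commute u (g ^+ 2).
  by apply/commgP/conjg_fixP; rewrite expgSr expg1 conjgM ug conjVg ug invgK.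
have cA : <[g ^+ 2]> \subset 'C(<[u]>).
  by rewrite cent_cycle cycle_subG; apply/cent1P/commute_sym.
have [/subsetPn[x Sx nAx]|/negPn sSA] := boolP (~~ (S \subset A)); last first.
  case/negP: nS; apply: abelianS sSA _.
  by rewrite /A -(cent_joinEr cA) abelianY !cycle_abelian cA.
have uS : u \in S.
  have nuB : <[u]> <| <<[set u; g]>>.
    rewrite /normal cycle_subG mem_gen ?inE ?eqxx //= gen_subG.
    apply/subsetP=> z /set2P[]->; first exact: (subsetP (normG _) _ (cycle_id u)).
    exact: (subsetP norm_u _ (cycle_id g)).
  have dS : S^`(1) \subset <[u]>.
    apply: subset_trans (dergS 1 sSB) _; apply: der1_min; first by case/andP: nuB.
    by rewrite /= gen_ugE quotientMidl quotient_abelian ?cycle_abelian.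
  have pu : prime #|<[u]>| by rewrite -orderE order_u.
  have [h|h] := prime_subgroupVti S^`(1)%G pu.
    by rewrite (subsetP (der_sub 1 S)) // (subsetP h) ?cycle_id.
  by case/negP: nS; apply/derG1P; rewrite -h; apply/esym/setIidPl.
have [i [k [ex]]] : exists i k, x = u ^+ i * g ^+ k /\ odd k.
  have := subsetP sSB x Sx; rewrite gen_ugE => /mulsgP[_ _ /cycleP[i ->] /cycleP[k ->] ex].
  exists i, k; split=> //; apply: contraR nAx => nk; rewrite ex /A mem_mulg ?mem_cycle //.
  by rewrite -(odd_double_half k) (negPf nk) add0n -muln2 mulnC expgM mem_cycle.
move=> ok; split=> //.
have gk : g ^+ k \in S by rewrite -(mulKg (u ^+ i) (g ^+ k)) -ex groupM ?groupV ?groupX.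
have : generator <[g]> (g ^+ k) by rewrite generator_coprime order_g (coprimeXl 3 (m := 2)) // coprime2n.
by move/eqP=> e; rewrite -cycle_subG e cycle_subG.
Qed.

End Metacyclic24.

(** Orbits of size 2 contribute twice a value, fixed points an even one; comparing ranks selects one
    representative per orbit. *)
Lemma sum_involution (T : finType) (c : T -> T) (f : T -> nat) : involutive c ->
  (forall i, f (c i) = f i) -> (forall i, c i = i -> ~~ odd (f i)) ->
  ~~ odd (\sum_i f i)%N.
Proof.
move=> cK fc hf; pose r (i : T) : nat := enum_rank i.
rewrite (bigID (fun i => c i == i)) (bigID (fun i => r i < r (c i))%N (fun i => c i != i)) /=.
rewrite [X in (_ + (_ + X))%N](reindex_inj (inv_inj cK)) /=.
rewrite [X in (_ + (_ + X))%N](eq_big (fun i => (c i != i) && (r i < r (c i))%N) f) => [|i|i _]; last 2 first.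
- rewrite cK -leqNgt leq_eqVlt eq_sym.
  have [->|ni] := eqVneq (c i) i; first by [].
  by rewrite /r (inj_eq val_inj) (inj_eq enum_rank_inj) eq_sym (negPf ni).
- exact: fc.
rewrite addnn oddD odd_double addbF; elim/big_ind: _ => // [x y|i /eqP /hf //].
by rewrite oddD => /negPf-> /negPf->.
Qed.

Section QuaternionicPlane.

Variable omega : algC.
Hypothesis omega_prim : 3.-primitive_root omega.

Local Notation e := (ev3 algC).
Local Notation w := (w3 omega).

(** The square of a nonzero element of F_9 is 1, -1, i or -i. It lifts to a Gaussian unit, and this
    is multiplication by that unit as a real 2 x 2 matrix. *)
Definition matW (a : f9) : 'M[algC]_2 :=
  let c := mul9 a a in
  \matrix_(i, j) (if i == 0 then if j == 0 then e c.1 else e c.2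
                  else if j == 0 then - e c.2 else e c.1).
Definition matD3 (t : f3) : 'M[algC]_2 :=
  \matrix_(i, j) (if i == 0 then if j == 0 then w t else 0
                  else if j == 0 then 0 else w (opp3 t)).

Lemma matW_mul a b : a != zero9 -> b != zero9 -> matW (mul9 a b) = matW a *m matW b.
Proof.
move=> na nb; apply/matrixP=> i j; rewrite !mxE !big_ord_recl big_ord0 !mxE /=.
move: i j => [[|[|//]] ?] [[|[|//]] ?] /=;
by move: a b na nb => [[[]|] [[]|]] [[[]|] [[]|]] // _ _ /=; ring.
Qed.

Lemma matD3_mul t t' : matD3 (add3 t t') = matD3 t *m matD3 t'.
Proof.
apply/matrixP=> i j; rewrite !mxE !big_ord_recl big_ord0 !mxE /=.
have h : opp3 (add3 t t') = add3 (opp3 t) (opp3 t') by move: t t' => [[]|] [[]|].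
by move: i j => [[|[|//]] ?] [[|[|//]] ?] /=; rewrite ?h ?(w3D omega_prim); ring.
Qed.

(** If a^2 is i or -i, then a has norm -1 and [matW a] swaps the axes, exchanging omega^t and
    omega^(-t); otherwise a has norm 1 and [matW a] is scalar. *)
Lemma matDW t a : a != zero9 -> matD3 t *m matW a = matW a *m matD3 (mul3 t (norm9 a).1).
Proof.
move=> na; apply/matrixP=> i j; rewrite !mxE !big_ord_recl !big_ord0 !mxE /=.
move: i j => [[|[|//]] ?] [[|[|//]] ?] /=;
by move: a na t => [[[]|] [[]|]] //= _ [[]|] /=; ring.
Qed.

Lemma w3_sum t : w t + w (opp3 t) = if t is Some _ then -1 else 2%:R.
Proof.
have h : omega + omega ^+ 2 = -1.
  have := prim_expr_order omega_prim => /eqP; rewrite -subr_eq0.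
  have -> : omega ^+ 3 - 1 = (omega - 1) * (1 + omega + omega ^+ 2) by ring.
  rewrite mulf_eq0 subr_eq0 => /orP[/eqP o1|/eqP]; last by rewrite -addrA addrC => /eqP; rewrite addr_eq0 => /eqP.
  by have := eq_prim_root_expr omega_prim 1 0; rewrite o1 !expr1n eqxx.
by case: t => [[]|] //=; rewrite addrC.
Qed.

Lemma matWD_trace a t :
  \tr (matW a *m matD3 t) = e (mul9 a a).1 * (if t is Some _ then -1 else 2%:R).
Proof. 
rewrite -w3_sum /mxtrace !big_ord_recl big_ord0 !mxE !big_ord_recl !big_ord0 !mxE /=; ring.
Qed.

End QuaternionicPlane.

(** Two isotropic vectors e_0, e_1 with product 1, and three orthonormal vectors orthogonal to
    them. *)
Definition gram9m : mat9 := mx9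
  [:: [:: 0; 3; 0; 0; 0]; [:: 3; 0; 0; 0; 0]; [:: 0; 0; 3; 0; 0];
      [:: 0; 0; 0; 3; 0]; [:: 0; 0; 0; 0; 3]]%N.
Definition unip9m : mat9 := mx9
  [:: [:: 3; 0; 0; 0; 0]; [:: 1; 3; 0; 0; 0]; [:: 0; 0; 3; 0; 0];
      [:: 0; 0; 0; 3; 0]; [:: 0; 0; 0; 0; 3]]%N.
(** The scalar -i on the complement of the hyperbolic plane makes the determinant 1 and differs from
    the eigenvalue -1 + i of e_1, a fact used in [mackey_even]. *)
Definition diag9m : mat9 := mx9
  [:: [:: 5; 0; 0; 0; 0]; [:: 0; 7; 0; 0; 0]; [:: 0; 0; 2; 0; 0];
      [:: 0; 0; 0; 2; 0]; [:: 0; 0; 0; 0; 2]]%N.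

Definition isom9m A := (mul9m (mul9m A gram9m) (star9m A) == gram9m) && (det9 5 (get9 A) == one9).

Lemma unip_diag_check :
  [&& isom9m unip9m, isom9m diag9m, mk9 (get9 unip9m) != one9m,
      mul9m (mul9m unip9m unip9m) unip9m == one9m,
      mul9m (mul9m diag9m diag9m) (mul9m diag9m diag9m) != one9m,
      mul9m (mul9m (mul9m diag9m diag9m) (mul9m diag9m diag9m)) (mul9m (mul9m diag9m diag9m) (mul9m diag9m diag9m)) == one9m &
      mul9m unip9m diag9m == mul9m diag9m (mul9m unip9m unip9m)].
Proof. by vm_compute. Qed.

(** * The group K and its representation of degree 2 *)

Section Hyperbolic.

Variables (F : finFieldType) (cardF : #|F| = 9%N) (char3 : 3%N \in [pchar F]).
Variable theta : {rmorphism F -> F}.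
Hypothesis thetaE : forall x, theta x = x ^+ 3.
Variable im : F.
Hypothesis im2 : im * im = -1.
Variables (gT : finGroupType) (G : {group gT}) (M : gT -> 'M[F]_5).
Hypothesis M_mul : {in G &, forall x y, M (x * y)%g = M x *m M y}.
Hypothesis M_inj : {in G &, injective M}.
Hypothesis M_im : forall A, (exists2 x, x \in G & M x = A) <->
  A *m evm im gram9m *m adj theta A = evm im gram9m /\ \det A = 1.

Local Notation ev := (ev9 im).

Lemma isom9m_lift A : isom9m A -> exists2 x, x \in G & M x = evm im A.
Proof.
move=> /andP[/eqP uA /eqP dA]; apply/M_im; split.
  by rewrite /adj -(evm_star thetaE im2) -!(evm_mul char3 im2) uA.
by rewrite (evm_det char3 im2) dA ev9_1.
Qed.

Lemma gram_M1 : M 1%g = 1%:M.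
Proof.
have [x Gx Mx] : exists2 x, x \in G & M x = 1%:M.
  by apply/M_im; rewrite /adj trmx1 map_mx1 mulmx1 mul1mx det1.
have e : M x *m M 1%g = M x by rewrite -M_mul ?mulg1.
by rewrite -[LHS]mul1mx -Mx e.
Qed.

Definition f9_of (x : F) : f9 := odflt zero9 [pick a | ev a == x].

Lemma f9_ofK x : ev (f9_of x) = x.
Proof.
rewrite /f9_of; case: pickP => [a /eqP //|h].
by have [a ea] := ev9_surj cardF char3 im2 x; have := h a; rewrite ea eqxx.
Qed.

Lemma ev9K : cancel ev f9_of.
Proof. by move=> a; apply: (ev9_inj char3 im2); rewrite f9_ofK. Qed.

(* The stabiliser of the isotropic line spanned by e_0 that also preserves the
   plane spanned by e_0 and e_1. *)
Definition line_set : {set gT} :=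
  [set x in G | [forall j : 'I_5, (0 < j)%N ==> (M x 0 j == 0)] &&
                [forall j : 'I_5, (1 < j)%N ==> (M x 1 j == 0)]].

Lemma line_setP x : reflect [/\ x \in G, forall j : 'I_5, (0 < j)%N -> M x 0 j = 0 &
  forall j : 'I_5, (1 < j)%N -> M x 1 j = 0] (x \in line_set).
Proof.
rewrite inE; apply: (iffP and3P) => [[Gx /forallP h0 /forallP h1]|[Gx h0 h1]]; split=> //.
- by move=> j hj; apply/eqP; apply: (implyP (h0 j)).
- by move=> j hj; apply/eqP; apply: (implyP (h1 j)).
- by apply/forallP=> j; apply/implyP=> hj; rewrite h0.
by apply/forallP=> j; apply/implyP=> hj; rewrite h1.
Qed.

Lemma row0_mul x y j : x \in line_set -> y \in G -> M (x * y)%g 0 j = M x 0 0 * M y 0 j.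
Proof.
case/line_setP=> Gx h0 h1 Gy; rewrite M_mul // mxE big_ord_recl big1 ?addr0 // => k _.
by rewrite h0 ?mul0r.
Qed.

Lemma row1_mul x y j : x \in line_set -> y \in G ->
  M (x * y)%g 1 j = M x 1 0 * M y 0 j + M x 1 1 * M y 1 j.
Proof.
case/line_setP=> Gx h0 h1 Gy; rewrite M_mul // mxE (bigD1 0) //= (bigD1 1) //= addrA.
rewrite big1 ?addr0 // => -[[|[|k]] hk] /andP[n0 n1]; last by rewrite h1 ?mul0r.
  by case/eqP: n0; apply: val_inj.
by case/eqP: n1; apply: val_inj.
Qed.

Lemma line_group_set : group_set line_set.
Proof.
apply/group_setP; split.
  apply/line_setP; rewrite gram_M1 group1; split=> // j hj; rewrite mxE; case: eqP => // e.
    by rewrite -e in hj.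
  by rewrite -e in hj.
move=> x y Kx Ky; have /line_setP[Gx x0 x1] := Kx; have /line_setP[Gy y0 y1] := Ky.
apply/line_setP; split; first exact: groupM.
  by move=> j hj; rewrite row0_mul // y0 ?mulr0.
by move=> j hj; rewrite row1_mul // y0 ?(ltnW hj) // y1 // !mulr0 addr0.
Qed.

Definition line_group := Group line_group_set.
Local Notation K := line_group.

Lemma line_sub : K \subset G.
Proof. by apply/subsetP=> x /line_setP[]. Qed.

Lemma line_form x : x \in K -> [/\ M x 0 0 * theta (M x 1 1) = 1 &
  M x 1 0 * theta (M x 1 1) + M x 1 1 * theta (M x 1 0) = 0].
Proof.
case/line_setP=> Gx x0 x1.
have [/matrixP h _] : M x *m evm im gram9m *m adj theta (M x) = evm im gram9m /\ \det (M x) = 1.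
  by apply/M_im; exists x.
have ev1 : ev (dec9 3) = 1 by rewrite (_ : dec9 3 = one9) ?ev9_1.
have ev0 : ev (dec9 0) = 0 by rewrite (_ : dec9 0 = zero9) ?ev9_0.
split.
  have := h 0 1; rewrite !mxE !big_ord_recl !big_ord0 !mxE !big_ord_recl !big_ord0 !mxE /=.
  rewrite /get9 /gram9m /mx9 /= !ev1 !ev0 !(x0 (lift _ _)) //.
  rewrite !mul0r !mulr0 !mulr1 !add0r !addr0 !mul0r !addr0 => <-.
  by rewrite add0r; congr (_ * theta (M x _ _)); apply: val_inj.
have := h 1 1; rewrite !mxE !big_ord_recl !big_ord0 !mxE !big_ord_recl !big_ord0 !mxE /=.
rewrite /get9 /gram9m /mx9 /= !ev1 !ev0 !(x1 (lift _ (lift _ _))) //.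
rewrite !mul0r !mulr0 !mulr1 !add0r !addr0 !mul0r !addr0 => <-.
rewrite addrC; congr (M x _ _ * theta (M x _ _) + M x _ _ * theta (M x _ _)); exact: val_inj.
Qed.

Definition scale0 x : f9 := f9_of (M x 0 0).
Definition slope x : F := M x 1 0 / M x 1 1.
Definition shear x : f3 := (f9_of (slope x)).2.

Lemma diag_neq0 x : x \in K -> M x 0 0 != 0 /\ M x 1 1 != 0.
Proof.
move=> /line_form[h _]; split; apply: contra_eq_neq h => ->.
  by rewrite mul0r eq_sym oner_eq0.
by rewrite rmorph0 mulr0 eq_sym oner_eq0.
Qed.

Lemma scale0_neq0 x : x \in K -> scale0 x != zero9.
Proof.
move=> Kx; have [h _] := diag_neq0 Kx; apply: contraNneq h => h.
by rewrite -[M x 0 0]f9_ofK -/(scale0 x) h ev9_0.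
Qed.

Lemma scale0_mul x y : x \in K -> y \in K -> scale0 (x * y)%g = mul9 (scale0 x) (scale0 y).
Proof.
move=> Kx Ky; apply: (ev9_inj char3 im2).
by rewrite (ev9M char3 im2) !f9_ofK row0_mul // (subsetP line_sub).
Qed.

(** Dividing the second relation of [line_form] by the norm of the (1, 1) entry shows that [theta]
    negates the slope, which is therefore an F_3-multiple of i. *)
Lemma shearE x : x \in K -> slope x = ev3 F (shear x) * im.
Proof.
move=> Kx; have [_ h] := line_form Kx; have [_ n1] := diag_neq0 Kx.
have nt : theta (M x 1 1) != 0 by rewrite fmorph_eq0.
have hs : theta (slope x) = - slope x.
  apply/eqP; rewrite -addr_eq0 /slope rmorphM fmorphV; apply/eqP.
  transitivity ((M x 1 0 * theta (M x 1 1) + M x 1 1 * theta (M x 1 0)) / (M x 1 1 * theta (M x 1 1))).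
    by rewrite /=; field; rewrite n1 nt.
  by rewrite h mul0r.
have : conj9 (f9_of (slope x)) = opp9 (f9_of (slope x)).
  by apply: (ev9_inj char3 im2); rewrite (ev9_conj thetaE im2) ev9N !f9_ofK.
have := f9_ofK (slope x); rewrite /shear; case: (f9_of (slope x)) => [[[]|] b] //= <- _.
by rewrite /ev9 /= add0r.
Qed.

Lemma ev3_norm a : ev3 F (norm9 a).1 = ev a * theta (ev a).
Proof.
rewrite -(ev9_conj thetaE im2) -(ev9M char3 im2) -/(norm9 a).
by move: a => [[[]|] [[]|]]; rewrite /ev9 /= ?mul0r ?addr0.
Qed.

(** By [line_form] the ratio of the first two diagonal entries of y is the norm of its scale, and
    the slope of x is multiplied by this ratio. *)
Lemma shear_mul x y : x \in K -> y \in K ->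
  shear (x * y)%g = add3 (mul3 (shear x) (norm9 (scale0 y)).1) (shear y).
Proof.
move=> Kx Ky; have [y0 y1] := diag_neq0 Ky; have [x0 x1] := diag_neq0 Kx.
have /line_setP[_ Y0 _] := Ky.
have : slope (x * y)%g = slope x * (M y 0 0 * theta (M y 0 0)) + slope y.
  rewrite /slope !row1_mul ?(subsetP line_sub y) // (Y0 1) // mulr0 add0r.
  have [/(congr1 theta) hy _] := line_form Ky.
  have -> : theta (M y 0 0) = (M y 1 1)^-1.
    move: hy; rewrite rmorphM rmorph1 /= (thetaK cardF thetaE) => hy.
    by rewrite -[LHS](mulfK y1) hy mul1r.
  by field; rewrite y1 x1.
rewrite (shearE Kx) (shearE Ky) (shearE (groupM Kx Ky)) -[M y 0 0]f9_ofK -ev3_norm -/(scale0 y).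
move=> h; apply: (@ev3_inj F char3 im im2); apply: (mulIf (im_neq0 im2)).
by rewrite h ev3D // ev3M; ring.
Qed.

Variable omega : algC.
Hypothesis omega_prim : 3.-primitive_root omega.

(* The restriction of this representation to <<[set u; g]>>, a group of order
   24, has quaternionic type. *)
Definition rho x : 'M[algC]_2 := matW (scale0 x) *m matD3 omega (shear x).

Lemma scale01 : scale0 1%g = one9.
Proof. by rewrite /scale0 gram_M1 mxE -(ev9_1 im) ev9K. Qed.

Lemma shear1 : shear 1%g = None.
Proof. by rewrite /shear /slope gram_M1 !mxE mul0r -(ev9_0 im) ev9K. Qed.

Lemma rho_repr : mx_repr K rho.
Proof.
split.
  rewrite /rho scale01 shear1; apply/matrixP=> i j; rewrite !mxE !big_ord_recl big_ord0 !mxE.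
  by move: i j => [[|[|//]] ?] [[|[|//]] ?] /=; ring.
move=> x y Kx Ky; rewrite /rho scale0_mul // shear_mul // matW_mul ?scale0_neq0 // matD3_mul //.
by rewrite mulmxA -(mulmxA (matW (scale0 x)) (matW (scale0 y))) -matDW ?scale0_neq0 // !mulmxA.
Qed.
Canonical rhoK := MxRepresentation rho_repr.

Definition phi : 'CF(K) := cfRepr rhoK.

Definition phival (a : f9) (t : f3) : algC :=
  ev3 algC (mul9 a a).1 * (if t is Some _ then -1 else 2%:R).

Lemma phiE x : x \in K -> phi x = phival (scale0 x) (shear x).
Proof. by move=> Kx; rewrite cfunE Kx mulr1n matWD_trace. Qed.

Lemma phival_real a t : (phival a t)^* = phival a t.
Proof.
rewrite /phival rmorphM; congr (_ * _).
  by case: (mul9 a a).1 => [[]|] /=; rewrite ?rmorphN ?rmorph1 ?rmorph0.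
by case: t => [_|]; rewrite ?rmorphN ?rmorph1 ?rmorph_nat.
Qed.

Lemma phi_real x : x \in K -> (phi x)^* = phi x.
Proof. by move=> Kx; rewrite phiE // phival_real. Qed.

(** The left-hand side is twice the determinant of [rho x]. *)
Lemma phi_det x : x \in K -> phi x ^+ 2 - phi (x ^+ 2)%g = 2%:R.
Proof.
move=> Kx; rewrite expgS expg1 !phiE ?groupM // scale0_mul // shear_mul //.
move: (scale0 x) (shear x) (scale0_neq0 Kx) => a t.
by move: a t => [[[]|] [[]|]] [[]|] //= _; rewrite /phival /=; ring.
Qed.

Lemma phi1 : phi 1%g = 2%:R.
Proof. by rewrite cfRepr1. Qed.

Section Elements.

Variables u g : gT.
Hypotheses (Gu : u \in G) (Gg : g \in G) (Mu : M u = evm im unip9m) (Mg : M g = evm im diag9m).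

Lemma u_line : u \in K.
Proof.
by apply/line_setP; split=> // -[[|[|[|[|[|//]]]]] hj] // _; rewrite Mu mxE -(ev9_0 im); congr ev9.
Qed.

Lemma g_line : g \in K.
Proof.
by apply/line_setP; split=> // -[[|[|[|[|[|//]]]]] hj] // _; rewrite Mg mxE -(ev9_0 im); congr ev9.
Qed.

Lemma scale0_u : scale0 u = one9.
Proof. by rewrite /scale0 Mu mxE ev9K. Qed.

Lemma scale0_g : scale0 g = dec9 5.
Proof. by rewrite /scale0 Mg mxE ev9K. Qed.

Lemma shear_u : shear u = Some true.
Proof.
apply: (@ev3_inj F char3 im im2); apply: (mulIf (im_neq0 im2)).
rewrite -(shearE u_line) /slope Mu !mxE -[get9 _ _ _]/(None, Some true) -[get9 _ 1%R 1%R]/one9.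
by rewrite ev9_1 divr1 /ev9 /= add0r.
Qed.

Lemma shear_g : shear g = None.
Proof. by rewrite /shear /slope Mg !mxE -[get9 _ 1%R 0%R]/zero9 ev9_0 mul0r -(ev9_0 im) ev9K. Qed.

Lemma ug_rels : [/\ u != 1, u * u * u = 1, (g * g) * (g * g) != 1,
  (g * g) * (g * g) * ((g * g) * (g * g)) = 1 & u * g = g * (u * u)]%g.
Proof.
have h x y A B : x \in G -> y \in G -> M x = evm im A -> M y = evm im B ->
    M (x * y)%g = evm im (mul9m A B).
  by move=> Gx Gy Ax By; rewrite M_mul // Ax By (evm_mul char3 im2).
have M1 : M 1%g = evm im one9m by rewrite gram_M1 evm1.
have /and5P[_ _ hu /eqP hu3 /and3P[hg4 /eqP hg8 /eqP hug]] := unip_diag_check.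
have Muu := h _ _ _ _ Gu Gu Mu Mu; have Gu2 := groupM Gu Gu.
have Mgg := h _ _ _ _ Gg Gg Mg Mg; have Gg2 := groupM Gg Gg.
have Mg4 := h _ _ _ _ Gg2 Gg2 Mgg Mgg; have Gg4 := groupM Gg2 Gg2.
split.
- apply: contraNneq hu => e.
  by have := evm_inj char3 im2 (etrans (esym Mu) (etrans (congr1 M e) M1)) => /eqP.
- by apply: M_inj; rewrite ?groupM // (h _ _ _ _ Gu2 Gu Muu Mu) hu3 -M1.
- apply: contraNneq hg4 => e.
  by have := evm_inj char3 im2 (etrans (esym Mg4) (etrans (congr1 M e) M1)) => /eqP.
- by apply: M_inj; rewrite ?groupM // (h _ _ _ _ Gg4 Gg4 Mg4 Mg4) hg8 -M1.
apply: M_inj; rewrite ?groupM // (h _ _ _ _ Gu Gg Mu Mg) (h _ _ _ _ Gg Gu2 Mg Muu).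
by rewrite hug.
Qed.

Lemma u_expg3 : (u ^+ 3 = 1)%g.
Proof. by case: ug_rels => _ h _ _ _; rewrite !expgS expg0 mulg1 mulgA. Qed.

Lemma g_expg4 : (g ^+ 4 != 1)%g.
Proof. by case: ug_rels => _ _ h _ _; rewrite (expgM g 2 2) !expg2. Qed.

Lemma g_expg8 : (g ^+ 8 = 1)%g.
Proof. by case: ug_rels => _ _ _ h _; rewrite (expgM g 4 2) (expgM g 2 2) !expg2. Qed.

Lemma u_conjg : (u ^ g = u^-1)%g.
Proof.
case: ug_rels => _ h _ _ hug; rewrite conjgE hug mulKg; apply/eqP.
by rewrite eq_sym eq_invg_mul mulgA h.
Qed.

Let B := <<[set u; g]>>%G.

Lemma ug_sub_line : B \subset K.
Proof. by rewrite gen_subG; apply/subsetP=> z /set2P[]->; [exact: u_line | exact: g_line]. Qed.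

Let psi : 'CF(B) := 'Res[B] phi.

Lemma psiE b : b \in B -> psi b = phival (scale0 b) (shear b).
Proof. by move=> Bb; rewrite cfResE ?ug_sub_line // phiE // (subsetP ug_sub_line). Qed.

Lemma psi_char : psi \is a character.
Proof. by rewrite cfRes_char ?cfRepr_char. Qed.

Lemma psi1 : psi 1%g = 2%:R.
Proof. by rewrite cfRes1 phi1. Qed.

(** The relation u g = g u^2 forces a linear character to be 1 at u, so a reducible psi would be 2
    at u, while its value there is -1. *)
Lemma psi_irr : psi \in irr B.
Proof.
have [//|[mu [nu [Lmu Lnu e]]]] := degree2_split psi_char psi1.
have Bu : u \in B by rewrite mem_gen // set21.
have Bg : g \in B by rewrite mem_gen // set22.
have [_ _ _ _ hug] := ug_rels.
have h (xi : 'CF(B)) : xi \is a linear_char -> xi u = 1.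
  move=> Lx; have nx x Bx := lin_char_neq0 Lx (x := x) Bx.
  have := congr1 xi hug; rewrite !(lin_charM Lx) ?groupM // mulrC => /(mulfI (nx g Bg)) h.
  by apply: (mulfI (nx u Bu)); rewrite -h mulr1.
have := psiE Bu; rewrite e cfunE !h // scale0_u shear_u /phival /= mul1r => /eqP.
by rewrite -subr_eq0 opprK (_ : 1 + 1 + 1 = 3%:R) ?pnatr_eq0 //; ring.
Qed.

Definition mackey_sum y := \sum_(b in B) phi (b ^ y)%g * (psi b)^*.

Lemma mackey_diag : mackey_sum 1%g = #|B|%:R.
Proof.
have := cfnorm_irr; have /irrP[i ei] := psi_irr => /(_ _ _ i); rewrite -ei cfdotE => e.
have := congr1 (fun z => #|B|%:R * z) e; rewrite mulVKf ?neq0CG // mulr1 => <-.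
apply: eq_bigr => b Bb.
by rewrite conjg1 cfResE ?ug_sub_line.
Qed.

Section Conjugate.

Variable y : gT.
Hypotheses (Gy : y \in G) (nKy : y \notin K).

Let S := (B :&: K :^ y^-1)%G.

Lemma mem_S b : (b \in S) = (b \in B) && ((b ^ y)%g \in K).
Proof. by rewrite inE mem_conjg invgK. Qed.

Definition rhoS b := rhoK (b ^ y)%g.

Lemma rhoS_repr : mx_repr S rhoS.
Proof.
split=> [|a b]; first by rewrite /rhoS conj1g repr_mx1.
by rewrite !mem_S => /andP[_ Ka] /andP[_ Kb]; rewrite /rhoS conjMg repr_mxM.
Qed.
Canonical rhoS_repn := MxRepresentation rhoS_repr.

Lemma mackey_cfdot : mackey_sum y / #|S|%:R = '[cfRepr rhoS_repn, 'Res[S] psi].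
Proof.
rewrite cfdotE mulrC; congr (_ * _).
rewrite /mackey_sum (bigID (fun b => (b ^ y)%g \in K)) [LHS]/= [X in _ + X]big1 ?addr0 => [|b /andP[_ nK]]; last first.
  by rewrite (cfun0 phi nK) mul0r.
apply: eq_big => b; first by rewrite mem_S.
move=> /andP[Bb Kb]; congr (_ * _^*).
  by rewrite !cfunE mem_S Bb Kb.
by rewrite cfResE ?subsetIl // mem_S Bb.
Qed.

Lemma even_abelian : abelian S -> (2 %| mackey_sum y / #|S|%:R)%C.
Proof.
move=> abS; rewrite mackey_cfdot.
have sSB : S \subset B by apply: subsetIl.
apply: even_cfdot_abelian => //; first exact: cfRepr_char.
- apply/eqP/cfun_inP=> b; rewrite mem_S => /andP[Bb Kb].
  by rewrite cfConjCE !cfunE mem_S Bb Kb /= mulr1n matWD_trace // phival_real.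
- by rewrite cfRes_char ?psi_char.
- by rewrite cfRes1 psi1.
move=> b Sb; have Bb := subsetP sSB b Sb.
by rewrite !cfResE ?groupX ?(subset_trans sSB ug_sub_line) ?ug_sub_line // phi_det ?(subsetP ug_sub_line).
Qed.

(** The eigenvalues of [rho u] are omega and omega^2, so 1 + rho(u) + rho(u)^2 = 0. *)
Lemma psi_orbit_u b : b \in B -> psi b + psi (u * b)%g + psi (u * (u * b))%g = 0.
Proof.
move=> Bb; have Bu : u \in B by rewrite mem_gen // set21.
have Kb := subsetP ug_sub_line b Bb.
rewrite !psiE ?groupM // !shear_mul ?groupM ?u_line // !scale0_mul ?groupM ?u_line // scale0_u shear_u.
move: (scale0 b) (shear b) (scale0_neq0 Kb).
by move=> [[[]|] [[]|]] [[]|] //= _; rewrite /phival /=; ring.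
Qed.

(** Here u^y lies in the kernel of [rho], so [phi (b ^ y)] does not change when b is multiplied by u
    on the left, while psi sums to 0 over the cosets of <u>. *)
Lemma mackey_kernel : (u ^ y)%g \in K -> scale0 (u ^ y)%g = one9 -> shear (u ^ y)%g = None -> mackey_sum y = 0.
Proof.
have kerphi k z : k \in K -> scale0 k = one9 -> shear k = None -> phi (k * z)%g = phi z.
  move=> Kk ak tk; have [Kz|nKz] := boolP (z \in K); last by rewrite !cfun0 // groupMl.
  rewrite !phiE ?groupM // scale0_mul // shear_mul // ak tk.
  by congr phival; move: (scale0 z) (shear z) => [[[]|] [[]|]] [[]|].
move=> Kk ak tk; have Bu : u \in B by rewrite mem_gen // set21.
have hu c : c \in B -> mackey_sum y = \sum_(b in B) phi (b ^ y)%g * (psi (c * b)%g)^* ->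
    mackey_sum y = \sum_(b in B) phi (b ^ y)%g * (psi (c * (u * b))%g)^*.
  move=> Bc {1}->; rewrite (reindex_inj (mulgI u)) /=; apply: eq_big => b; first by rewrite groupMl.
  by move=> _; rewrite conjMg kerphi.
have h0 : mackey_sum y = \sum_(b in B) phi (b ^ y)%g * (psi (1 * b)%g)^*.
  by apply: eq_bigr => b _; rewrite mul1g.
have h1 := hu _ (group1 _) h0.
have h2 : mackey_sum y = \sum_(b in B) phi (b ^ y)%g * (psi (u * (u * b))%g)^*.
  by apply: hu => //; rewrite h1; apply: eq_bigr => b _; rewrite mul1g.
have : mackey_sum y + mackey_sum y + mackey_sum y = 0.
  rewrite {1}h0 {1}h1 {1}h2 -!big_split big1 //= => b Bb.
  by rewrite -!mulrDr !mul1g -!rmorphD psi_orbit_u // rmorph0 mulr0.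
have -> : mackey_sum y + mackey_sum y + mackey_sum y = 3%:R * mackey_sum y by ring.
by move/eqP; rewrite mulf_eq0 pnatr_eq0 /= => /eqP.
Qed.

(* If S is not abelian it contains u and g. When u^y has trivial shear, the sum
   vanishes. Otherwise y^-1 maps the line of e_0 to itself, and comparing the
   eigenvalues of g shows that it preserves the plane of e_0 and e_1. *)
Lemma mackey_even : (2 %| mackey_sum y / #|S|%:R)%C.
Proof.
have [abS|nabS] := boolP (abelian S); first exact: even_abelian.
have [u1 hu3 _ _ _] := ug_rels.
have [] := nonabelian_sub_ug u1 u_expg3 g_expg4 g_expg8 u_conjg (subsetIl _ _) nabS.
rewrite !mem_S => /andP[_ Kk] /andP[_ Kk'].
(* The scale has order dividing 3 in the multiplicative group of F_9, of order 8. *)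
have ak : scale0 (u ^ y)%g = one9.
  have : scale0 (u ^ y * u ^ y * u ^ y)%g = one9 by rewrite -!conjMg hu3 conj1g scale01.
  move: (u ^ y)%g Kk => k Kk; rewrite !scale0_mul ?groupM //.
  by move: (scale0 k) => [[[]|] [[]|]].
case tk: (shear (u ^ y)%g) => [t|]; last by rewrite mackey_kernel // mul0r dvdC0.
case/negP: nKy; rewrite -groupV; set v := (y^-1)%g.
have Gv : v \in G by rewrite groupV.
(* Turns the membership of [x ^ y] in K, for x = u and x = g, into linear equations between the
   entries of [M v]. *)
have hv x : (v * x = x ^ y * v)%g by rewrite conjgE -!mulgA mulgV mulg1.
have M00 : M (u ^ y)%g 0 0 = 1 by rewrite -[LHS]f9_ofK -/(scale0 _) ak ev9_1.
have M11 : M (u ^ y)%g 1 1 = 1.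
  have [/(congr1 theta) + _] := line_form Kk; rewrite M00 mul1r (thetaK cardF thetaE) rmorph1.
  by [].
have ns : M (u ^ y)%g 1 0 != 0.
  have := shearE Kk; rewrite /slope M11 divr1 tk => ->; rewrite mulf_neq0 ?(im_neq0 im2) //.
  by case: t {tk}; rewrite /= ?oppr_eq0 oner_eq0.
have Vu i j : M (v * u)%g i j = M v i j + (if j == 0 then M v i 1 * im else 0).
  rewrite M_mul // Mu; move: (M v) => V; rewrite mxE (bigD1 j) //= [in LHS]mxE.
  have -> : get9 unip9m j j = one9 by case: j => [[|[|[|[|[|//]]]]] ?].
  rewrite ev9_1 mulr1; congr (_ + _); case: eqP => [->|nj].
    rewrite (bigD1 1) //= mxE -[get9 _ _ _]/(None, Some true) /ev9 /= mul1r add0r.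
    rewrite big1 ?addr0 // => k /andP[nk0 nk1]; rewrite mxE.
    have -> : get9 unip9m k 0 = zero9 by case: k nk0 nk1 => [[|[|[|[|[|//]]]]] ?].
    by rewrite ev9_0 mulr0.
  rewrite big1 // => k nk; rewrite mxE.
  have -> : get9 unip9m k j = zero9.
    by case: k j nk nj => [[|[|[|[|[|//]]]]] ?] [[|[|[|[|[|//]]]]] ?] // _ [] //; apply: val_inj.
  by rewrite ev9_0 mulr0.
have Vg i j : M (v * g)%g i j = M v i j * ev (dec9 (if j == 0 then 5%N else if j == 1 then 7%N else 2%N)).
  rewrite M_mul // Mg; move: (M v) => V; rewrite mxE (bigD1 j) //= [in LHS]mxE.
  rewrite big1 => [|k nk]; last first.
    rewrite mxE; have -> : get9 diag9m k j = zero9; last by rewrite ev9_0 mulr0.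
    by case: k j nk => [[|[|[|[|[|//]]]]] ?] [[|[|[|[|[|//]]]]] ?].
  by rewrite addr0; congr (_ * ev _); case: j => [[|[|[|[|[|//]]]]] ?].
have V01 : M v 0 1 = 0.
  have := row0_mul 0 Kk Gv; rewrite -hv Vu eqxx M00 mul1r -[RHS]addr0 => /addrI /eqP.
  by rewrite mulf_eq0 (negPf (im_neq0 im2)) orbF => /eqP.
have V0 (j : 'I_5) : (0 < j)%N -> M v 0 j = 0.
  move=> hj; have nj : j != 0 by apply: contraTneq hj => ->.
  have := row1_mul j Kk Gv; rewrite -hv Vu (negPf nj) M11 mul1r addrC => /addIr /esym/eqP.
  by rewrite mulf_eq0 (negPf ns) => /eqP.
have V11 : M v 1 1 != 0.
  have := row1_mul 0 Kk Gv; rewrite -hv Vu eqxx M11 mul1r addrC => /addIr e.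
  apply: contraTneq isT => v11; move: e; rewrite v11 mul0r => /esym/eqP.
  rewrite mulf_eq0 (negPf ns) /= => /eqP v00.
  have /(congr1 (fun A : 'M[F]_5 => A 0 0)) : M v *m M y = 1%:M by rewrite -M_mul // mulVg gram_M1.
  rewrite !mxE big_ord_recl v00 mul0r add0r big1 => [/esym/eqP|k _]; first by rewrite oner_eq0.
  by rewrite V0 // mul0r.
have row1g (j : 'I_5) : (0 < j)%N ->
    M v 1 j * ev (dec9 (if j == 0 then 5%N else if j == 1 then 7%N else 2%N)) = M (g ^ y)%g 1 1 * M v 1 j.
  by move=> hj; rewrite -Vg hv row1_mul // V0 // mulr0 add0r.
have d7 : M (g ^ y)%g 1 1 = ev (dec9 7).
  by apply: (mulIf V11); rewrite -(row1g 1) // mulrC.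
apply/line_setP; split=> // j hj; have := row1g j (ltnW hj).
have nj0 : j != 0 by apply: contraTneq hj => ->.
have nj1 : j != 1 by apply: contraTneq hj => ->.
rewrite (negPf nj0) (negPf nj1) d7 mulrC => /eqP; rewrite -subr_eq0 -mulrBl mulf_eq0.
by rewrite subr_eq0 (inj_eq (ev9_inj char3 im2)) => /eqP.
Qed.

End Conjugate.

Lemma odd_real_constituent : exists2 i : Iirr G, cfReal 'chi_i &
  exists2 m, odd m & '['Res[B] 'chi_i, psi] = m%:R.
Proof.
have sBG : B \subset G := subset_trans ug_sub_line line_sub.
have odd1 := odd_cfdot_Res_Ind ug_sub_line line_sub mackey_diag mackey_even.
have conjphi : (phi^*)%CF = phi by apply/cfun_inP=> x Kx; rewrite cfConjCE phi_real.
have conjpsi : (psi^*)%CF = psi by rewrite /psi cfAutRes conjphi.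
pose n i := Num.truncn '['Res[B] 'chi[G]_i, psi].
pose k i := Num.truncn '['Ind[G] phi, 'chi_i].
have nE i : '['Res[B] 'chi[G]_i, psi] = (n i)%:R.
  by rewrite /n truncnK // Cnat_cfdot_char ?cfRes_char ?irr_char ?cfRepr_char.
have kE i : '['Ind[G] phi, 'chi_i] = (k i)%:R.
  by rewrite /k truncnK // Cnat_cfdot_char ?cfInd_char ?irr_char ?cfRepr_char ?line_sub //.
have nC i : n (conjC_Iirr i) = n i.
  apply/eqP; rewrite -(eqr_nat algC) -!nE conjC_IirrE -cfAutRes cfdot_conjCl conjpsi.
  by rewrite nE rmorph_nat.
have kC i : k (conjC_Iirr i) = k i.
  apply/eqP; rewrite -(eqr_nat algC) -!kE conjC_IirrE cfdot_conjCr cfAutInd conjphi.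
  by rewrite kE rmorph_nat.
have [i /andP[Ri oi]|hno] := pickP (fun i : Iirr G => cfReal 'chi_i && odd (n i)).
  by exists i => //; exists (n i); rewrite ?nE.
have ev2 : ~~ odd (\sum_(i : Iirr G) k i * n i)%N.
  apply: (sum_involution (@conjC_IirrK _ G)) => i; first by rewrite kC nC.
  move=> ci; rewrite oddM negb_and; apply/orP; right.
  have := hno i; rewrite /cfReal -conjC_IirrE ci eqxx /= => ->.
  by [].
have e : '['Res[B] ('Ind[G] phi), psi] = (\sum_(i : Iirr G) k i * n i)%:R.
  rewrite cfdot_Res_l cfdot_sum_irr natr_sum; apply: eq_bigr => i _.
  by rewrite kE natrM -nE cfdot_Res_l -cfdotC.
have d2 : (2 %| (\sum_(i : Iirr G) k i * n i)%:R)%C.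
  by rewrite (dvdC_nat 2) dvdn2.
have : (2 %| 1%:R)%C.
  have -> : 1%:R = (\sum_(i : Iirr G) k i * n i)%:R - ('['Res[B] ('Ind[G] phi), psi] - 1) :> algC.
    by rewrite e opprB addrC subrK.
  by rewrite rpredB.
by rewrite (dvdC_nat 2 1).
Qed.

Lemma psi_word i j : psi (u ^+ i * g ^+ j)%g =
  phival (iter j (fun a => mul9 a (dec9 5)) one9)
    (mul3 (iter i (add3^~ (Some true)) None) (norm9 (iter j (fun a => mul9 a (dec9 5)) one9)).1).
Proof.
have Bu : u \in B by rewrite mem_gen // set21.
have Bg : g \in B by rewrite mem_gen // set22.
have K_u : (u ^+ i)%g \in K by rewrite groupX ?u_line.
have K_g e : (g ^+ e)%g \in K by rewrite groupX ?g_line.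
have ag : scale0 (g ^+ j)%g = iter j (fun a => mul9 a (dec9 5)) one9.
  by elim: j => [|j IH]; rewrite ?scale01 // expgSr scale0_mul ?g_line // IH scale0_g.
have tg : shear (g ^+ j)%g = None.
  elim: j {ag} => [|j IH]; rewrite ?shear1 // expgSr shear_mul ?g_line // shear_g IH //.
have [au tu] : scale0 (u ^+ i)%g = one9 /\ shear (u ^+ i)%g = iter i (add3^~ (Some true)) None.
  elim: i {K_u} => [|i [IHa IHt]]; first by rewrite scale01 shear1.
  rewrite expgSr scale0_mul ?shear_mul ?groupX ?u_line // IHa IHt scale0_u shear_u; split=> //=.
  by move: (iter i _ _) => [[]|].
rewrite psiE ?groupM ?groupX // scale0_mul // shear_mul // ag tg au tu.
move: (iter j _ _) (iter i _ _) => a t; congr phival; first by move: a => [[[]|] [[]|]].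
by move: (mul3 _ _) => [[]|].
Qed.

Lemma quaternionic_character (R : realType) : exists i : Iirr G, real_schur_index_2 R 'chi_i.
Proof.
have [i Ri [m om hm]] := odd_real_constituent; exists i; split=> // aff.
have [u1 hu3 g4 hg8 hug] := ug_rels.
suff : ~~ odd m by rewrite om.
apply: (afforded_even Gu Gg hu3 _ _ Ri aff); rewrite -?mulgA -?hg8 ?mulgA //.
  by rewrite -!mulgA in hug *.
have := hm; rewrite cfdotE => /(congr1 (fun z => #|B|%:R * z)); rewrite mulVKf ?neq0CG //.
rewrite (card_ug u1 u_expg3 g_expg4 g_expg8 u_conjg) -natrM => <-.
have sBG : B \subset G := subset_trans ug_sub_line line_sub.
rewrite [RHS](big_ug u1 u_expg3 g_expg4 g_expg8 u_conjg); apply: eq_bigr => a _.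
have Bu : u \in B by rewrite mem_gen // set21.
have Bg : g \in B by rewrite mem_gen // set22.
rewrite [RHS](eq_bigr (fun c : 'I_8 => 'chi_i (u ^+ a * g ^+ c)%g * psi (u ^+ a * g ^+ c)%g)); last first.
  move=> c _; rewrite cfResE ?groupM ?groupX // psi_word.
  by congr (_ * _); rewrite phival_real.
(* The scale 1 - i of g squares to i, so for odd c the square of its c-th power is i or -i, with
   real part 0. *)
have hz c : odd c -> (c < 8)%N -> psi (u ^+ a * g ^+ c)%g = 0.
  move=> oc hc; rewrite psi_word /phival.
  set x := iter _ _ _; have -> : (mul9 x x).1 = None.
    by rewrite /x; move: c oc hc {x} => [|[|[|[|[|[|[|[|c]]]]]]]].
  exact: mul0r.
have hq c : (c < 4)%N -> psi (u ^+ a * g ^+ (c * 2))%g = (quat_coef a c)%:~R.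
  move=> hc; rewrite psi_word.
  have -> : (quat_coef a c)%:~R = (if a == 0 :> nat then 2%:R else -1) * (-1) ^+ c :> algC.
    by rewrite /quat_coef rmorphM rmorphXn rmorphN1; case: eqP; rewrite ?rmorphN1.
  case: a {hz} => [[|[|[|//]]] ha]; move: c hc => [|[|[|[|//]]]] hc; rewrite /phival /=;
    ring.
rewrite (eq_bigr (fun c : 'I_4 => 'chi_i (u ^+ a * g ^+ (2 * c))%g * psi (u ^+ a * g ^+ (c * 2))%g)).
  rewrite !big_ord_recl !big_ord0 /= /bump /=.
  by rewrite !(hz 1%N, hz 3%N, hz 5%N, hz 7%N) // !mulr0 !add0r !addr0.
by move=> c _; rewrite hq // mulrC -expg2 -expgM.
Qed.

End Elements.

End Hyperbolic.

(** * The group PSU(5, 3) *)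

Section OrthonormalBasis.

Variables (F : finFieldType) (cardF : #|F| = 9%N) (char3 : 3%N \in [pchar F]).
Variable theta : {rmorphism F -> F}.
Hypothesis thetaE : forall x, theta x = x ^+ 3.

Local Notation adj := (adj theta).

(** Polarisation at e_i + z e_j with z = N_ij yields twice the norm of z, and 2 = -1. *)
Lemma hermitian_anisotropic n (N : 'M[F]_n) : adj N = N ->
  (forall x : 'rV_n, (x *m N *m adj x) 0 0 = 0) -> N = 0.
Proof.
move=> hN h0; have NC i j : N j i = theta (N i j).
  by rewrite -[in LHS]hN !mxE.
have hs : N \is (false, theta).-sesqui by apply/sesquiP; rewrite scale1r; exact/esym.
have hf x : form theta N x x = 0 by exact: h0.
apply/matrixP=> i j; rewrite [RHS]mxE; set z := N i j.
have := hf ('e_i + z *: 'e_j).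
rewrite formDl !formDr !formZl !formZr hf (hf 'e_j) !formee (NC i j) -/z !mulr0 addr0 add0r.
have -> : theta z * z + z * theta z = (1 + 1) * (z * theta z) by ring.
move/eqP; rewrite (two_char3 char3) mulN1r oppr_eq0 mulf_eq0 fmorph_eq0 orbb => /eqP.
by [].
Qed.

(** Gram-Schmidt: U projects onto the orthogonal complement of the rows of Q, is nonzero as k < n,
    and so has a non-isotropic vector in its image. Surjectivity of the norm rescales it to norm
    1. *)
Lemma orthonormal_rows n (H : 'M[F]_n) k : adj H = H -> H \in unitmx -> (k <= n)%N ->
  exists Q : 'M_(k, n), Q *m H *m adj Q = 1%:M.
Proof.
move=> hH uH; elim: k => [|k IH] hk; first by exists 0; apply/matrixP=> -[].
have [Q hQ] := IH (ltnW hk).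
have [im im2] := exists_im cardF.
pose U := 1%:M - H *m adj Q *m Q.
have UQ : U *m H *m adj Q = 0.
  by rewrite mulmxBl mulmxBl mul1mx -(mulmxA _ Q) -(mulmxA _ (Q *m H)) hQ mulmx1 subrr.
have U0 : U != 0.
  apply: contraTneq hk; rewrite -leqNgt => /eqP; rewrite subr_eq0 => /eqP e.
  by rewrite -(mxrank1 F n) e (leq_trans (mxrankM_maxr _ _)) // rank_leq_row.
have adjB m p (X Y : 'M[F]_(m, p)) : adj (X + Y) = adj X + adj Y.
  by rewrite /adj linearD map_mxD.
have UU : U *m H *m adj U = U *m H.
  have e1 : 1%:M = U + H *m adj Q *m Q by rewrite subrK.
  rewrite -[in RHS](mulmx1 (U *m H)) -(adj1 theta) e1.
  by rewrite (adjB _ _ U) (adjM _ _ Q) mulmxDr mulmxA UQ mul0mx addr0.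
have [x hx] : exists x : 'rV_n, (x *m (U *m H) *m adj x) 0 0 != 0.
  apply/existsP; rewrite -negb_forall; apply: contra U0 => /forallP h.
  apply/eqP/(row_free_inj (A := H)); rewrite ?row_free_unit // mul0mx.
  apply: hermitian_anisotropic => [|x]; last by apply/eqP; have := h x.
  by rewrite -[in LHS]UU !adjM (adjK cardF thetaE) hH mulmxA UU.
pose w := x *m U; set t := (x *m (U *m H) *m adj x) 0 0 in hx.
have wt : w *m H *m adj w = t%:M.
  by rewrite /w adjM !mulmxA -(mulmxA x) -(mulmxA x (U *m H)) UU [LHS]mx11_scalar.
have tt : theta t = t.
  have : adj (w *m H *m adj w) = w *m H *m adj w by rewrite (adjM _ (w *m H)) (adjM _ w H) (adjK cardF thetaE) hH mulmxA.
  by rewrite wt => /matrixP/(_ 0 0); rewrite !mxE eqxx mulr1n.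
have [z hz] := exists_norm char3 thetaE im2 tt.
have nz : z != 0 by apply: contraNneq hx => z0; rewrite -hz z0 mul0r.
have ntz : theta z != 0 by rewrite fmorph_eq0.
have adjZ m p c (X : 'M[F]_(m, p)) : adj (c *: X) = theta c *: adj X.
  by rewrite /adj linearZ map_mxZ.
have wQ : w *m H *m adj Q = 0 by rewrite /w -!mulmxA (mulmxA U) UQ mulmx0.
have Qw : Q *m H *m adj w = 0.
  have := congr1 (@adj _ _) wQ; rewrite !adjM (adjK cardF thetaE) hH mulmxA => ->.
  by rewrite /adj trmx0 map_mx0.
rewrite -[k.+1]/(1 + k)%N; exists (col_mx (z^-1 *: w) Q).
have -> : adj (col_mx (z^-1 *: w) Q) = row_mx (adj (z^-1 *: w)) (adj Q).
  by rewrite /adj tr_col_mx map_row_mx.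
rewrite mul_col_mx mul_col_row hQ adjZ -!scalemxAl -!scalemxAr wQ Qw wt !scaler0.
rewrite (scalar_mx_block 1) scalerA scale_scalar_mx fmorphV -hz.
congr (block_mx _%:M _ _ _); field; by rewrite nz ntz.
Qed.

End OrthonormalBasis.

Section ProjectiveUnitary.

Variables (F : finFieldType) (cardF : #|F| = 9%N) (char3 : 3%N \in [pchar F]).
Variable theta : {rmorphism F -> F}.
Hypothesis thetaE : forall x, theta x = x ^+ 3.
Variable f : {hermitian 'rV[F]_5 for false & theta}.
Hypothesis f_nondeg : nondegenerate f.
Variable im : F.
Hypothesis im2 : im * im = -1.

Local Notation adj := (adj theta).

Definition gram : 'M[F]_5 := matrix_of_form f.

Lemma gramE u v : f u v = (u *m gram *m adj v) 0 0.
Proof. by rewrite -(matrix_of_formK f) /form_of_matrix trace_mx11. Qed.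

Lemma gram_herm : adj gram = gram.
Proof. by apply/matrixP=> i j; rewrite !mxE hermC mul1r (thetaK cardF thetaE). Qed.

Lemma gram_unit : gram \in unitmx.
Proof.
rewrite -row_free_unit -kermx_eq0; apply/rowV0P=> v /sub_kermxP hv.
have : v \in orthov f fullv by apply/mem_orthovP=> w _; rewrite gramE hv mul0mx mxE.
by rewrite (eqP f_nondeg) memv0 => /eqP.
Qed.

Lemma SU_P (A : {'GL_5[F]}) : reflect
  (GLval A *m gram *m adj (GLval A) = gram /\ \det (GLval A) = 1) (A \in SU f).
Proof.
rewrite inE; apply: (iffP andP) => [[/eqP dA /forallP h]|[h ->]]; split=> //.
  apply/matrixP=> i j; have /forallP/(_ 'e_j)/eqP := h 'e_i.
  have e (X : 'M[F]_5) : X i j = (('e_i : 'rV_5) *m X *m adj ('e_j : 'rV_5)) 0 0 by exact: esym (formee theta X i j).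
  by rewrite !gramE !e (adjM _ 'e_j) !mulmxA.
apply/forallP=> u; apply/forallP=> v.
by rewrite !gramE adjM -!mulmxA (mulmxA gram) (mulmxA (GLval A)) (mulmxA (GLval A)) h.
Qed.

Definition SUmx (P : 'M[F]_5) (A : {'GL_5[F]}) : 'M[F]_5 := P *m GLval A *m invmx P.

(** Base change by P. It is used with J the identity for the polytope and with J the matrix [gram9m]
    for the Schur index. *)
Lemma SU_interface (J P : 'M[F]_5) : P \in unitmx -> P *m gram *m adj P = J ->
  [/\ {in SU f &, forall x y, SUmx P (x * y)%g = SUmx P x *m SUmx P y},
      {in SU f &, injective (SUmx P)} &
      forall C, (exists2 x, x \in SU f & SUmx P x = C) <-> C *m J *m adj C = J /\ \det C = 1].
Proof.
move=> uP hJ; have aP : adj P *m adj (invmx P) = 1%:M by rewrite -adjM mulVmx ?adj1.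
have aP' : adj (invmx P) *m adj P = 1%:M by rewrite -adjM mulmxV ?adj1.
split.
- by move=> x y _ _; rewrite /SUmx GL_MxE !mulmxA mulmxKV.
- move=> x y _ _ h; apply: val_inj; move/(congr1 (fun C => invmx P *m C *m P)): h.
  by rewrite /SUmx !mulmxA mulVmx // !mul1mx !mulmxKV.
move=> C; split=> [[x /SU_P[h dx] <-]|[h dC]].
  split; last by rewrite /SUmx !det_mulmx det_inv dx mulr1 mulrV // -unitmxE.
  rewrite /SUmx -hJ !adjM !mulmxA mulmxKV //.
  rewrite -!mulmxA (mulmxA (adj P)) aP mul1mx !mulmxA -(mulmxA P) -(mulmxA P (GLval x *m gram)).
  by rewrite h.
have dA : \det (invmx P *m C *m P) = 1.
  by rewrite !det_mulmx det_inv dC mulr1 mulVr // -unitmxE.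
have uA : (invmx P *m C *m P : 'M[F]_5) \is a GRing.unit.
  by have : invmx P *m C *m P \in unitmx by rewrite unitmxE dA unitr1.
have [x hx] : exists x : {'GL_5[F]}, GLval x = invmx P *m C *m P.
  by exists (insubd (1%g : {'GL_5[F]}) (invmx P *m C *m P)); exact: (insubdK (1%g : {'GL_5[F]})).
exists x; last by rewrite /SUmx hx !mulmxA mulmxV // mul1mx mulmxK.
apply/SU_P; rewrite hx; split=> //.
have -> : gram = invmx P *m J *m adj (invmx P).
  by rewrite -hJ -!mulmxA aP mulmx1 mulKmx.
by rewrite -[in RHS]h !adjM !mulmxA mulmxK // -!mulmxA (mulmxA (adj (invmx P))) aP' mul1mx.
Qed.

Lemma exists_orthonormal : exists2 P : 'M[F]_5, P \in unitmx & P *m gram *m adj P = 1%:M.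
Proof.
have [P hP] := orthonormal_rows cardF char3 thetaE gram_herm gram_unit (leqnn 5).
by exists P => //; move: hP; rewrite -mulmxA => /mulmx1_unit[].
Qed.

Lemma emb_check : all (fun k => all (fun l => (k == l) ||
  su9m (emb9 k l (dec9 1) zero9) && su9m (emb9 k l zero9 one9)) (iota 0 5)) (iota 0 5).
Proof. by vm_compute. Qed.

(** Commuting with diag(i, -i) on two coordinates kills the off-diagonal entries, and commuting with
    the signed swaps equates the diagonal ones. A scalar a then satisfies a^4 = 1 by unitarity and
    a^5 = 1 by the determinant. *)
Lemma SU_center : 'Z(SU f)%G :=: 1%g.
Proof.
have [P uP hP] := exists_orthonormal.
have [M_mul M_inj M_im] := SU_interface uP hP.
set M := SUmx P in M_mul M_inj M_im.
have M_im1 C : (exists2 x, x \in SU f & M x = C) <-> unitary theta C /\ \det C = 1.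
  by rewrite M_im mulmx1.
have Memb (k l : 'I_5) : k != l -> (exists2 x, x \in SU f & M x = emb theta k l im 0) /\
    (exists2 x, x \in SU f & M x = emb theta k l 0 1).
  move=> nkl; have /allP/(_ k) := emb_check; rewrite mem_iota => /(_ (ltn_ord k)).
  move=> /allP/(_ l); rewrite mem_iota => /(_ (ltn_ord l)); rewrite (inj_eq val_inj) (negPf nkl) /=.
  have ei : ev9 im (dec9 1) = im by rewrite /ev9 /= mul1r add0r.
  case/andP=> /(su9_lift char3 thetaE im2 M_im1) + /(su9_lift char3 thetaE im2 M_im1).
  by rewrite !(emb_evm thetaE im2) ei ev9_0 ev9_1.
apply/trivgP/subsetP=> x /centerP[Gx cx]; rewrite inE; apply/eqP.
have cM y : y \in SU f -> M x *m M y = M y *m M x.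
  by move=> Gy; rewrite -!M_mul // cx.
have M11 : M 1%g = 1%:M by rewrite /M /SUmx GL_1E mulmx1 mulmxV.
have [uX dX] : unitary theta (M x) /\ \det (M x) = 1 by apply/M_im1; exists x.
apply: M_inj; rewrite ?group1 // M11; move: (M x) cM uX dX => X cX uX dX.
have third (i k : 'I_5) : exists l : 'I_5, (l != i) && (l != k).
  apply/existsP; rewrite -[[exists _, _]]negbK negb_exists; apply/negP=> /forallP h.
  have /subset_leq_card : [set: 'I_5] \subset [set i; k].
    by apply/subsetP=> l _; have := h l; rewrite !inE negb_and !negbK.
  by rewrite cardsT card_ord cards2; case: (i != k).
have row_entry (i j : 'I_5) (A B : 'M[F]_5) : (A *m B) i j = (row i A *m B) 0 j by rewrite -row_mul [RHS]mxE.
have Xoff (i k : 'I_5) : i != k -> X i k = 0.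
  move=> nik; have [l /andP[nli nlk]] := third i k.
  have nkl : k != l by rewrite eq_sym.
  have [[y Gy My] _] := Memb k l nkl.
  have := cX y Gy; rewrite My => /matrixP/(_ i k).
  rewrite !row_entry mul_emb // eqxx rmorph0 mulr0 subr0 mxE.
  have -> : row i (emb theta k l im 0) = 'e_i.
    by apply/rowP=> j; rewrite !mxE (negPf nik) eq_sym (negPf nli) eq_sym.
  rewrite -rowE mxE => /eqP; rewrite -subr_eq0 -[X in _ - X]mulr1 -mulrBr mulf_eq0 subr_eq0.
  case/orP=> /eqP // i1; have := im2; rewrite i1 mulr1 => /eqP.
  by rewrite (negPf (one_neqN1 char3)).
have Xdiag (k l : 'I_5) : X k k = X l l.
  have [->//|nkl] := eqVneq k l; have [_ [y Gy My]] := Memb k l nkl.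
  have := cX y Gy; rewrite My => /matrixP/(_ k l).
  rewrite !row_entry mul_emb // eq_sym (negPf nkl) eqxx rmorph0 mulr0 addr0 mulr1 mxE => ->.
  have -> : row k (emb theta k l 0 1) = 'e_l.
    apply/rowP=> j; rewrite !mxE eqxx; case: eqVneq => [->|_]; first by rewrite (negPf nkl).
    by case: eqVneq.
  by rewrite -rowE mxE.
have [a e] : exists a, X = a%:M.
  exists (X 0 0); apply/matrixP=> i j; rewrite [RHS]mxE.
  by case: eqVneq => [->|nij]; [exact: Xdiag | exact: Xoff].
have h3 : a * a ^+ 3 = 1.
  have := uX; rewrite /unitary e mul_scalar_mx => /matrixP/(_ 0 0).
  by rewrite !mxE eqxx thetaE !mulr1n.
by have := dX; rewrite e det_scalar exprS (exprS _ 3) h3 mulr1 => ->.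
Qed.

End ProjectiveUnitary.

Section QuotientInterface.

Variables (F : finFieldType) (gT : finGroupType) (G Z : {group gT}) (M : gT -> 'M[F]_5).
Variable U : 'M[F]_5 -> Prop.
Hypothesis M_mul : {in G &, forall x y, M (x * y)%g = M x *m M y}.
Hypothesis M_inj : {in G &, injective M}.
Hypothesis M_im : forall A, (exists2 x, x \in G & M x = A) <-> U A.
Hypothesis Z1 : Z :=: 1%g.

Let Mq (X : coset_of Z) := M (repr X).

Lemma quotient_repr x : repr (coset Z x) = x.
Proof. by rewrite val_coset ?Z1 ?norm1 ?inE // mul1g repr_set1. Qed.

Lemma quotient_interface : 
  [/\ {in (G / Z)%G &, forall x y, Mq (x * y)%g = Mq x *m Mq y},
      {in (G / Z)%G &, injective Mq} &
      forall A, (exists2 x, x \in (G / Z)%G & Mq x = A) <-> U A].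
Proof.
have nZ x : x \in 'N(Z)%g by rewrite Z1 norm1 inE.
split.
- move=> _ _ /morphimP[x _ Gx ->] /morphimP[y _ Gy ->].
  by rewrite -morphM // /Mq /= !quotient_repr M_mul.
- move=> _ _ /morphimP[x _ Gx ->] /morphimP[y _ Gy ->].
  by rewrite /Mq /= !quotient_repr => /(M_inj Gx Gy) ->.
move=> A; rewrite -M_im; split=> [[_ /morphimP[x _ Gx ->] hx]|[x Gx hx]].
  by exists x => //; rewrite -hx /Mq /= quotient_repr.
by exists (coset Z x); rewrite ?mem_quotient // /Mq quotient_repr.
Qed.

End QuotientInterface.

Section Main.

Variables (F : finFieldType) (cardF : #|F| = 9%N) (char3 : 3%N \in [pchar F]).
Variable theta : {rmorphism F -> F}.
Hypothesis thetaE : forall x, theta x = x ^+ 3.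
Variable f : {hermitian 'rV[F]_5 for false & theta}.
Hypothesis f_nondeg : nondegenerate f.

(** As 1 + i has norm -1, the vectors (1, 1 + i) and (-1, 1 + i) are isotropic with product -1 - 1 =
    1. *)
Definition hyperbolic9m : mat9 := mx9
  [:: [:: 3; 4; 0; 0; 0]; [:: 6; 4; 0; 0; 0]; [:: 0; 0; 3; 0; 0];
      [:: 0; 0; 0; 3; 0]; [:: 0; 0; 0; 0; 3]]%N.

Lemma PSU_interface (J P : 'M[F]_5) : P \in unitmx -> P *m gram f *m adj theta P = J ->
  exists M : coset_of 'Z(SU f) -> 'M[F]_5,
  [/\ {in PSU f &, forall x y, M (x * y)%g = M x *m M y},
      {in PSU f &, injective M} &
      forall C, (exists2 x, x \in PSU f & M x = C) <-> C *m J *m adj theta C = J /\ \det C = 1].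
Proof.
have [im im2] := exists_im cardF.
move=> uP hJ; have [M_mul M_inj M_im] := SU_interface uP hJ.
have Z1 := SU_center cardF char3 thetaE f_nondeg im2.
by have := quotient_interface M_mul M_inj M_im Z1; exists (fun X => SUmx P (repr X)).
Qed.

Lemma PSU_schur_index_2 (R : realType) : exists i : Iirr (PSU f), real_schur_index_2 R 'chi_i.
Proof.
have [im im2] := exists_im cardF.
have [omega omega_prim] := C_prim_root_exists (isT : (0 < 3)%N).
have [P uP hP] := exists_orthonormal cardF char3 thetaE f_nondeg.
pose P1 := evm im hyperbolic9m.
have hP1 : P1 *m adj theta P1 = evm im gram9m.
  by rewrite /P1 /adj -(evm_star thetaE im2) -(evm_mul char3 im2); congr evm.
have uP1 : P1 \in unitmx.
  rewrite unitmxE (evm_det char3 im2) unitfE (ev9_eq0 char3 im2).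
  by vm_compute.
have uP1P : P1 *m P \in unitmx by rewrite unitmx_mul uP1.
have hJ : (P1 *m P) *m gram f *m adj theta (P1 *m P) = evm im gram9m.
  by rewrite adjM mulmxA -(mulmxA P1 P) -(mulmxA P1 (P *m _)) hP mulmx1.
have [M [M_mul M_inj M_im]] := PSU_interface uP1P hJ.
have /and3P[su sg _] := unip_diag_check.
have [u Gu Mu] := isom9m_lift char3 thetaE im2 M_im su.
have [g Gg Mg] := isom9m_lift char3 thetaE im2 M_im sg.
exact: (quaternionic_character cardF char3 thetaE im2 M_mul M_inj M_im omega_prim Gu Gg Mu Mg).
Qed.

Lemma PSU_polytope : exists s : 'I_3 -> coset_of 'Z(SU f),
  [/\ string_C_group (PSU f) s, schlafli_type s = [:: 5; 5]%N &
      forall i : Iirr (PSU f), i != 0 -> polytopal s i].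
Proof.
have [im im2] := exists_im cardF.
have [P uP hP] := exists_orthonormal cardF char3 thetaE f_nondeg.
have [M [M_mul M_inj M_im']] := PSU_interface uP hP.
have M_im C : (exists2 x, x \in PSU f & M x = C) <-> unitary theta C /\ \det C = 1.
  by rewrite M_im' mulmx1.
have lift k : (k < 3)%N -> exists2 x, x \in PSU f & M x = evm im (gen9m k).
  move=> hk; apply: (su9_lift char3 thetaE im2 M_im).
  have /and5P[_ _ /allP/(_ k) h /allP/(_ k) h' _] := tau_word_check.
  by rewrite /su9m h ?h' ?mem_iota.
have [s0 s0G s0M] := lift 0%N isT; have [s1 s1G s1M] := lift 1%N isT.
have [s2 s2G s2M] := lift 2%N isT.
pose s k := nth 1%g [:: s0; s1; s2] k.
have sG k : (k < 3)%N -> s k \in PSU f by case: k => [|[|[|]]].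
have sM k : (k < 3)%N -> M (s k) = evm im (gen9m k) by case: k => [|[|[|]]].
exists (fun i : 'I_3 => s i); split.
- exact: (string_C_group_gens cardF char3 thetaE M_mul M_inj M_im im2 sG sM).
- exact: (schlafli_gens char3 M_mul M_inj M_im im2 sG sM).
exact: (all_polytopal cardF char3 thetaE M_mul M_inj M_im im2 sG sM).
Qed.

End Main.

Theorem mainTheorem2 (R : realType) (F : finFieldType) (F9 : #|F| = 9%N)
    (char3 : 3%N \in [pchar F])
    (f : {hermitian 'rV[F]_5 for false & pFrobenius_aut char3})
    (f_nondeg : nondegenerate f) :
  (exists i : Iirr (PSU f), real_schur_index_2 R 'chi_i) /\
  (exists s : 'I_3 -> coset_of 'Z(SU f),
     [/\ string_C_group (PSU f) s,
         schlafli_type s = [:: 5%N; 5%N] &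
         forall i : Iirr (PSU f), i != 0 -> polytopal s i]).
Proof.
have thetaE x : pFrobenius_aut char3 x = x ^+ 3 by rewrite pFrobenius_autE.
split; first exact: (PSU_schur_index_2 F9 char3 thetaE f_nondeg R).
exact: (PSU_polytope F9 char3 thetaE f_nondeg).
Qed.
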